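(* Let $X$ be a proper CAT(-1) space and let $\Gamma$ be a (nonelementary) convex cocompact discrete group of isometries of $X$ with critical exponent $\alpha(\Gamma)<\infty$. Let $\mu=(\mu_x)_{x\in X}$ be a $\Gamma$-invariant conformal density of dimension $\alpha=\alpha(\Gamma)$. Then for each $x\in X$ and every $f\in L^1(\partial X,\mu_x)$, the function $\mathcal P_0f$ has weak nontangential limit $f(v)$ at $v$ for $\mu_x$-almost every $v$.
   Context: $\partial X$ is the Gromov boundary of $X$, $\overline X=X\cup\partial X$ with its usual topology. $(y,z)_x=\frac12(d(x,y)+d(x,z)-d(y,z))$ is the Gromov product, extended to $\overline X$. The boundary carries the visual metric $d_x(v,w)=e^{-(v,w)_x}$ (with $d_x(v,v)=0$; visual parameter $\epsilon=1$). The Busemann function is $\beta_v(x,y)=2(v,y)_x-d(x,y)$. $\alpha(\Gamma)=\inf\{s>0:\sum_{\gamma\in\Gamma}e^{-sd(\gamma x,x)}<\infty\}$. The limit set is $\Lambda_\Gamma=\overline{\Gamma x}\cap\partial X$. $GH(\Lambda_\Gamma)$ is the union of all geodesics in $X$ with both endpoints in $\Lambda_\Gamma$. $CH(\Lambda_\Gamma)$ is the smallest subset of $X$ containing $GH(\Lambda_\Gamma)$ and containing every geodesic segment between any two of its points. $\Gamma$ is convex cocompact if it acts cocompactly on $CH(\Lambda_\Gamma)$. A $\Gamma$-invariant conformal density of dimension $\alpha$ is a map $x\in X\mapsto\mu_x$ into positive finite measures on $\overline X$ such that for all $x,y\in X$ the measures $\mu_x,\mu_y$ are equivalent with $\frac{d\mu_y}{d\mu_x}(v)=e^{\alpha\beta_v(x,y)}$,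 and $\gamma_*\mu_x=\mu_{\gamma x}$ for all $\gamma\in\Gamma$. The Poisson kernel is $P(x,y,v)=\big(\frac{d\mu_y}{d\mu_x}(v)\big)^{1/\alpha}=e^{\beta_v(x,y)}$. Fixing the origin $x$, for $f\in L^1(\partial X,\mu_x)$ and $y\in X$, $$\mathcal P_0f(y)=\frac{\int_{\partial X}P(x,y,v)^{\alpha/2}f(v)\,d\mu_x(v)}{\int_{\partial X}P(x,y,v)^{\alpha/2}\,d\mu_x(v)}.$$ Fix, for $y\in GH(\Lambda_\Gamma)$, a point $w_x^y\in\partial X$ such that $(y,w_x^y)_x\ge d(x,y)-c$, with a constant $c>0$ independent of $y$. For $v\in\Lambda_\Gamma$ and $C>0$ put $$\Omega_C(v)=\{y\in GH(\Lambda_\Gamma): d_x(w_x^y,v)\le C\,d(x,y)^{1/\alpha}e^{-d(x,y)}\}.$$ A function $F:X\to\mathbb C$ has weak nontangential limit $L$ at $v$ if for all $C>0$, $F(y)\to L$ as $y\to v$ (in the topology of $\overline X$) with $y\in\Omega_C(v)$. *)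

(* Defs.v *)
From HB Require Import structures.
From mathcomp Require Import all_boot all_order all_algebra.
From mathcomp Require Import all_classical all_reals all_analysis.
From mathcomp Require Import complex.

Set Implicit Arguments.
Unset Strict Implicit.
Unset Printing Implicit Defensive.

Import Order.TTheory GRing.Theory Num.Theory.
Import numFieldNormedType.Exports.

Local Open Scope classical_set_scope.
Local Open Scope ring_scope.
Local Open Scope charge_scope.

(* Measurable types are pointed in the library, hence the chosen point of the
   space; it plays no other role. *)
#[short(type="pointedMetricType")]
HB.structure Definition PointedMetric (K : numDomainType) :=
  {M of Pointed M & Metric K M}.

Section Cat.
Context {R : realType} {X : metricType R}.

Definition geodesic_segment (p q : X) (g : R -> X) :=
  [/\ g 0 = p, g (mdist p q) = q &
   {in `[0, mdist p q] &, forall s t, mdist (g s) (g t) = `|s - t|}].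

Definition geodesic_line (g : R -> X) :=
  forall s t, mdist (g s) (g t) = `|s - t|.

Definition proper_space := forall (x : X) (r : R), compact [set y | mdist x y <= r].

Definition geodesic_space := forall p q : X, exists g, geodesic_segment p q g.

Definition geodesically_convex (A : set X) :=
  forall p q g, A p -> A q -> geodesic_segment p q g ->
    g @` `[0, mdist p q] `<=` A.

(* The upper half-plane {z | z.2 > 0} with its metric of curvature -1:
   cosh d(z, w) = 1 + |z - w|^2 / (2 z.2 w.2). *)
Definition hyp_dist (z w : R * R) : R :=
  let t := 1 + ((z.1 - w.1) ^+ 2 + (z.2 - w.2) ^+ 2) / (2 * z.2 * w.2) in
  ln (t + Num.sqrt (t ^+ 2 - 1)).

(* Comparison triangle p' q' r' of a geodesic triangle p q r, with comparison
   points a' on [p', q'] and b' on [p', r'].  As p, q, r are arbitrary, this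
   covers any two sides of any triangle. *)
Definition cat_minus1 :=
  geodesic_space /\
  forall (p q r : X) (g h : R -> X) (s t : R) (p' q' r' a' b' : R * R),
    geodesic_segment p q g -> geodesic_segment p r h ->
    0 <= s <= mdist p q -> 0 <= t <= mdist p r ->
    [/\ 0 < p'.2, 0 < q'.2, 0 < r'.2, 0 < a'.2 & 0 < b'.2] ->
    [/\ hyp_dist p' q' = mdist p q, hyp_dist p' r' = mdist p r &
        hyp_dist q' r' = mdist q r] ->
    hyp_dist p' a' = s -> hyp_dist a' q' = mdist p q - s ->
    hyp_dist p' b' = t -> hyp_dist b' r' = mdist p r - t ->
    mdist (g s) (h t) <= hyp_dist a' b'.

End Cat.

Arguments proper_space {R} X.
Arguments geodesic_space {R} X.
Arguments cat_minus1 {R} X.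

Section Boundary.
Context {R : realType} (X : metricType R).

Definition gromov_product (x y z : X) : R :=
  (mdist x y + mdist x z - mdist y z) / 2.

Definition same_end (u v : nat -> X) := forall o : X,
  gromov_product o (u n.1) (v n.2) @[n --> (\oo, \oo)] --> +oo.

(* A boundary point is the class, as a set, of a sequence converging to
   infinity. *)
Definition is_end (V : set (nat -> X)) :=
  exists2 u, same_end u u & V = [set v | same_end v v /\ same_end u v].

Definition gboundary := {V : set (nat -> X) | `[< is_end V >]}.

Inductive gbar := Pt of X | Bd of gboundary.

HB.instance Definition _ := gen_eqMixin gbar.
HB.instance Definition _ := gen_choiceMixin gbar.

End Boundary.

Arguments Pt {R X}.
Arguments Bd {R X}.

Section Bordification.
Context {R : realType} {X : metricType R}.
Implicit Types (x y o : X) (p q v : gbar X) (u : nat -> X).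

Definition bdry : set (gbar X) := range Bd.

Definition seq_cvg p : set (nat -> X) :=
  match p with
  | Pt y => [set u | u @ \oo --> y]
  | Bd V => \val V
  end.

(* The extension of the Gromov product to the bordification.  The supremum is
   the usual one for hyperbolic spaces; in a CAT(-1) space every pair of
   sequences in it has the same limit, so this is the continuous extension. *)
Definition gprod x p q : \bar R :=
  ereal_sup [set limn_einf (fun n => (gromov_product x (s n) (t n))%:E)
            | s in seq_cvg p & t in seq_cvg q].

Definition visual_dist x p q : R :=
  if p == q then 0 else expR (- fine (gprod x p q)).

Definition busemann v x y : R := 2 * fine (gprod x v (Pt y)) - mdist x y.

Definition gbar_open (U : set (gbar X)) :=
  open (Pt @^-1` U) /\
  forall V, U (Bd V) -> forall o, exists r : R,
    [set p | (r%:E < gprod o p (Bd V))%E] `<=` U.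

Lemma gbar_openT : gbar_open setT.
Proof.
split; first by rewrite preimage_setT; exact: openT.
by move=> V _ o; exists 0.
Qed.

Lemma gbar_openI : setI_closed gbar_open.
Proof.
move=> A B [oA hA] [oB hB]; split; first by rewrite preimage_setI; exact: openI.
move=> V [/hA AV /hB BV] o; have [r rA] := AV o; have [s sB] := BV o.
exists (Num.max r s) => p /= rsp; split.
  by apply: rA; rewrite /= (le_lt_trans _ rsp)// lee_fin le_max lexx.
by apply: sB; rewrite /= (le_lt_trans _ rsp)// lee_fin le_max lexx orbT.
Qed.

Lemma gbar_open_bigU (I : Type) (f : I -> set (gbar X)) :
  (forall i, gbar_open (f i)) -> gbar_open (\bigcup_i f i).
Proof.
move=> fo; split.
  by rewrite preimage_bigcup; apply: bigcup_open => i _; have [] := fo i.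
move=> V [i _ fiV] o; have [_ /(_ V fiV o)[r rf]] := fo i.
by exists r => p /rf; exists i.
Qed.

HB.instance Definition _ := isOpenTopological.Build (gbar X)
  gbar_openT gbar_openI gbar_open_bigU.

End Bordification.

Arguments bdry {R} X.

HB.instance Definition _ (R : realType) (X : pointedMetricType R) :=
  isPointed.Build (gbar X) (Pt point).

Notation gborel X := (g_sigma_algebraType (@open (gbar X))).

Section Group.
Context {R : realType} {X : metricType R}.
Implicit Types (G : set (X -> X)) (L : set (gbar X)) (o x : X).

Definition isometry_group G :=
  [/\ G id, (forall g h, G g -> G h -> G (g \o h)),
      (forall g, G g -> exists h, [/\ G h, cancel g h & cancel h g]) &
      (forall g, G g -> forall x y, mdist (g x) (g y) = mdist x y)].

Definition discrete_group G :=
  let G' : set {compact-open, X -> X} := G in G' `<=` isolated G'.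

Definition orbit G x : set X := [set g x | g in G].

Definition critical_exponent G x : \bar R :=
  ereal_inf [set s%:E | s in [set s : R |
    0 < s /\ (\esum_(g in G) (expR (- s * mdist (g x) x))%:E < +oo)%E]].

Definition limit_set G x : set (gbar X) :=
  closure (Pt @` orbit G x) `&` bdry X.

Definition nonelementary G x := ~ exists p q, limit_set G x `<=` [set p; q].

Definition geodesic_hull L : set X :=
  [set y | exists g : R -> X, [/\ geodesic_line g, range g y &
    exists p q, [/\ L p, L q, Pt (g t) @[t --> -oo] --> p &
                    Pt (g t) @[t --> +oo] --> q]]].

Definition convex_hull L : set X :=
  smallest geodesically_convex (geodesic_hull L).

Definition convex_cocompact G x :=
  exists2 K : set X, compact K &
    convex_hull (limit_set G x) = \bigcup_(g in G) (g @` K).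

(* An isometry maps a class of sequences onto a class, so the default value
   provided by insubd is irrelevant for it. *)
Definition gbar_map (g : X -> X) (p : gbar X) : gbar X :=
  match p with
  | Pt y => Pt (g y)
  | Bd V => Bd (insubd V [set g \o u | u in \val V])
  end.

End Group.

Section Density.
Context {R : realType} {X : pointedMetricType R}.
Variables (G : set (X -> X)) (alpha : R)
          (mu : X -> {finite_measure set (gborel X) -> \bar R}).

Definition conformal_density :=
  [/\ forall x y, mu y `<< mu x,
      forall x y,
        ae_eq (mu x) setT ('d (charge_of_finite_measure (mu y)) '/d (mu x))
              (fun v => (expR (alpha * busemann v x y))%:E) &
      forall g x A, G g -> measurable A ->
        pushforward (mu x) (gbar_map g : gborel X -> gborel X) A = mu (g x) A].

End Density.

Section ComplexIntegral.
Context d (T : measurableType d) (R : realType).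
Variables (m : {measure set T -> \bar R}) (D : set T) (f : T -> R[i]).

Definition cintegrable :=
  m.-integrable D (fun t => (complex.Re (f t))%:E) /\
  m.-integrable D (fun t => (complex.Im (f t))%:E).

Definition cintegral : R[i] :=
  Complex (\int[m]_(t in D) complex.Re (f t)) (\int[m]_(t in D) complex.Im (f t)).

End ComplexIntegral.

Section Poisson.
Context {R : realType} {X : pointedMetricType R}.

Definition poisson (x y : X) (v : gbar X) : R := expR (busemann v x y).

Definition P0 (alpha : R) (m : {finite_measure set (gborel X) -> \bar R})
    (x : X) (f : gborel X -> R[i]) (y : X) : R[i] :=
  cintegral m (bdry X)
    (fun v => (real_complex R (poisson x y v `^ (alpha / 2))) * f v) /
  real_complex R (\int[m]_(v in bdry X) poisson x y v `^ (alpha / 2)).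

End Poisson.

Section WeakLimit.
Context {R : realType} {X : metricType R}.
Variables (L : set (gbar X)) (alpha : R) (x : X) (w : X -> gboundary X).

Definition Omega (C : R) (v : gbar X) : set X :=
  [set y | geodesic_hull L y /\
    visual_dist x (Bd (w y)) v <=
      C * mdist x y `^ (alpha^-1) * expR (- mdist x y)].

(* The notion is defined at points of L only, hence the first conjunct. *)
Definition weak_nontangential_limit (F : X -> R[i]) (l : R[i]) (v : gbar X) :=
  L v /\ forall C : R, 0 < C -> forall e : R[i], 0 < e ->
    \forall p \near v, forall y, p = Pt y -> Omega C v y -> `|F y - l| < e.

End WeakLimit.

(* Main.v *)
Require Import Defs.
From HB Require Import structures.
From mathcomp Require Import all_boot all_order all_algebra.
From mathcomp Require Import all_classical all_reals all_analysis.
From mathcomp Require Import complex.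
From mathcomp Require Import measurable_realfun ring lra.

Set Implicit Arguments.
Unset Strict Implicit.
Unset Printing Implicit Defensive.

Import Order.TTheory GRing.Theory Num.Theory.
Import numFieldNormedType.Exports.

Local Open Scope classical_set_scope.
Local Open Scope ring_scope.

(* Only the coarse geometry of the boundary matters.  Comparison with the
   half-plane gives Gromov's four-point condition; convex cocompactness makes the
   orbit of x quasi-convex, and the hull of the limit set stays close to it.

   Let T_g be the shadow of g x seen from x, and d = d(x, y).  Since the critical
   exponent is positive and the orbit series diverges at it, mu_x is supported by
   the limit set and mu_x(T_g) is comparable to exp(- alpha d(x, g x)) (shadow
   lemma).  The shadows satisfy a Vitali covering property, hence at almost every
   v the integral of |f - f(v)| over T_g is o(exp(- alpha d(x, g x))) as the g with
   v in T_g go to infinity.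

   Up to constants P(x, y, u)^(alpha / 2) is exp(- alpha d / 2 + alpha (y | u)_x).
   Its integral is at least of order d exp(- alpha d / 2), each of the d annuli
   around the shadow of y having a mass inverse to the size of the kernel on it.
   Let g_k follow a ray from x to v, and y be in the region Omega_C(v).  The
   endpoint w_x^y is close to v up to the depth n = d - (ln d) / alpha - O(1), so
   the kernel is dominated by exp(- alpha d / 2) times the sum of exp(alpha k) over
   the k <= n with u in T_(g_k), plus exp(alpha d) on T_(g_n).  The integral of
   |f - f(v)| against it is therefore o(exp(- alpha d / 2)) times
   d + exp(alpha (d - n)) = O(d): the factor d^(1 / alpha) in the definition of
   Omega_C(v) is exactly what makes the last term harmless. *)

(** The extended Gromov product is a supremum of lower limits, so the identities valid for points of
    X survive at infinity only up to additive errors. The recurring constants have few sources: 2 is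
    the four-point constant, from arcosh(3/2) <= 2; 5 is the loss between a product at infinity and
    the products of representing sequences; 7 = 5 + 2 is the four-point condition at infinity; 10 =
    5 + 5 compares two such products. A further 7 is paid each time a set of boundary points is
    replaced by its closure.

    The shadow lemma needs that the mass is neither off the limit set nor concentrated at one point.
    Both facts rest on the boundary points whose products with the whole orbit are bounded. Their
    translates cover the complement of the limit set, and overlap so little that divergence of the
    series makes them null. A point carrying all the boundary mass would have to be one of them,
    which a limit point is not. *)

(** * Comparison triangles in the upper half-plane *)

Section HalfPlane.
Context {R : realType}.
Implicit Types (s t k A B T : R).

(* Hyperbolic cosine and sine of [ln A], as functions of [A]. *)
Definition ch A : R := (A + A^-1) / 2.
Definition sh A : R := (A - A^-1) / 2.

Lemma ch_ge1 A : 0 < A -> 1 <= ch A.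
Proof.
move=> A0; rewrite -subr_ge0.
have -> : ch A - 1 = (A - 1) ^+ 2 / (2 * A) by rewrite /ch; field; exact: lt0r_neq0.
by rewrite divr_ge0 ?sqr_ge0// mulr_ge0// ltW.
Qed.

Lemma sh_ge0 A : 1 <= A -> 0 <= sh A.
Proof.
move=> A1; have A0 : 0 < A by rewrite (lt_le_trans _ A1).
by rewrite /sh divr_ge0// subr_ge0 (le_trans _ A1)// invf_le1.
Qed.

Lemma sh_gt0 A : 1 < A -> 0 < sh A.
Proof.
move=> A1; have A0 : 0 < A by rewrite (lt_trans _ A1).
by rewrite /sh divr_gt0// subr_gt0 (lt_trans _ A1)// invf_lt1.
Qed.

Lemma le_ch A B : 0 < A -> A <= B -> 1 <= A * B -> ch A <= ch B.
Proof.
move=> A0 AB AB1; have B0 : 0 < B by rewrite (lt_le_trans A0).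
rewrite -subr_ge0.
have -> : ch B - ch A = (B - A) * (A * B - 1) / (2 * (A * B)).
  by rewrite /ch; field; rewrite !lt0r_neq0.
by rewrite divr_ge0// mulr_ge0// ?subr_ge0// mulr_ge0// ltW.
Qed.

Lemma hyp_dist_ch (z w : R * R) s : 0 <= s ->
  1 + ((z.1 - w.1) ^+ 2 + (z.2 - w.2) ^+ 2) / (2 * z.2 * w.2) = ch (expR s) ->
  hyp_dist z w = s.
Proof.
move=> s0 e; rewrite /hyp_dist e.
have E0 : 0 < expR s := expR_gt0 s.
have E1 : 1 <= expR s by rewrite -expR0 ler_expR.
have -> : ch (expR s) ^+ 2 - 1 = sh (expR s) ^+ 2.
  by rewrite /ch /sh; field; exact: lt0r_neq0.
rewrite sqrtr_sqr ger0_norm ?sh_ge0//.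
have -> : ch (expR s) + sh (expR s) = expR s by rewrite /ch /sh; field; exact: lt0r_neq0.
by rewrite expRK.
Qed.

Lemma hyp_dist_le2 (z w : R * R) :
  1 <= 1 + ((z.1 - w.1) ^+ 2 + (z.2 - w.2) ^+ 2) / (2 * z.2 * w.2) <= 3 / 2 ->
  hyp_dist z w <= 2.
Proof.
rewrite /hyp_dist; set t := (X in 1 <= X <= _) => /andP[t1 t2].
have q0 : 0 <= t ^+ 2 - 1 by nra.
have q1 : Num.sqrt (t ^+ 2 - 1) <= 2.
  by rewrite -(@ler_sqr _ _ 2) ?nnegrE ?sqrtr_ge0// sqr_sqrtr//; nra.
have e1 : 2 <= expR 1 :> R by have := @expR_ge1Dx R 1; lra.
rewrite -ler_expR lnK; last by rewrite posrE (lt_le_trans ltr01)// ler_wpDr ?sqrtr_ge0.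
have e2 : 2 * 2 <= expR 1 * expR 1 :> R by rewrite ler_pM.
have -> : expR 2 = expR 1 * expR 1 :> R by rewrite -expRD.
apply: le_trans e2; apply: (le_trans (lerD t2 q1)); lra.
Qed.

(* The point at distance [ln A] from (0, 1) on the ray making with the vertical
   an angle of cosine [k] and sine [l]. *)
Definition polar k l A : R * R :=
  (sh A * l / (ch A - sh A * k), (ch A - sh A * k)^-1).

Lemma polar_den_gt0 k A : 0 < A -> -1 <= k <= 1 -> 0 < ch A - sh A * k.
Proof.
move=> A0 /andP[k1 k2].
have -> : ch A - sh A * k = ((1 - k) * A + (1 + k) * A^-1) / 2.
  by rewrite /ch /sh; field; exact: lt0r_neq0.
have Ai : 0 < A^-1 by rewrite invr_gt0.
rewrite divr_gt0//; have [kl|kl] := ltP k 0.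
  rewrite ltr_wpDr//; [apply: mulr_ge0 | apply: mulr_gt0]; first [done | exact: ltW | lra].
rewrite ltr_wpDl//; [apply: mulr_ge0 | apply: mulr_gt0]; first [done | exact: ltW | lra].
Qed.

(** This is the law of cosines at the vertex (0, 1): the left side is the cosh of the distance
    between the two points, and (0, T) lies at signed height ln T above that vertex. *)
Lemma polar_vertical k l A T : 0 < A -> 0 < T -> -1 <= k <= 1 ->
  l ^+ 2 = 1 - k ^+ 2 ->
  let z := (0, T) in let w := polar k l A in
  1 + ((z.1 - w.1) ^+ 2 + (z.2 - w.2) ^+ 2) / (2 * z.2 * w.2) =
  ch A * ch T - sh A * sh T * k.
Proof.
move=> A0 T0 k1 hl /=; have := polar_den_gt0 A0 k1; set D := ch A - _ => D0.
have -> : (0 - sh A * l / D) ^+ 2 = sh A ^+ 2 * (1 - k ^+ 2) / D ^+ 2.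
  by rewrite -hl; field; exact: lt0r_neq0.
have -> : 1 + (sh A ^+ 2 * (1 - k ^+ 2) / D ^+ 2 + (T - D^-1) ^+ 2) / (2 * T / D)
  = (2 * T * D + sh A ^+ 2 * (1 - k ^+ 2) + (T * D - 1) ^+ 2) / (2 * T * D).
  by field; rewrite !lt0r_neq0.
apply: (canLR (mulfK _)); first by rewrite !mulf_neq0// lt0r_neq0.
by rewrite /D /ch /sh; field; rewrite !lt0r_neq0.
Qed.

Lemma polar_ray k l A B : 0 < A -> 0 < B -> -1 <= k <= 1 ->
  l ^+ 2 = 1 - k ^+ 2 ->
  let z := polar k l A in let w := polar k l B in
  1 + ((z.1 - w.1) ^+ 2 + (z.2 - w.2) ^+ 2) / (2 * z.2 * w.2) = ch (B / A).
Proof.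
move=> A0 B0 k1 hl /=.
have := polar_den_gt0 A0 k1; have := polar_den_gt0 B0 k1.
set D := ch A - _; set E := ch B - _ => E0 D0.
have -> : (sh A * l / D - sh B * l / E) ^+ 2 =
   (sh A * E - sh B * D) ^+ 2 * (1 - k ^+ 2) / (D * E) ^+ 2.
  by rewrite -hl; field; rewrite !lt0r_neq0.
have -> : 1 + ((sh A * E - sh B * D) ^+ 2 * (1 - k ^+ 2) / (D * E) ^+ 2 +
    (D^-1 - E^-1) ^+ 2) / (2 / D / E) =
  (2 * (D * E) + (sh A * E - sh B * D) ^+ 2 * (1 - k ^+ 2) + (E - D) ^+ 2)
   / (2 * (D * E)).
  by field; rewrite !lt0r_neq0.
apply: (canLR (mulfK _)); first by rewrite !mulf_neq0// lt0r_neq0.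
by rewrite /D /E /ch /sh; field; rewrite !lt0r_neq0.
Qed.

(** With a = ln A and t = ln T, the product formula 2 sinh t sinh (a - t) = cosh a - cosh (2t - a)
    is bounded by cosh a - 1, hence by sinh a. *)
Lemma half_sh A T : 1 <= T -> T <= A -> sh T * sh (A / T) <= sh A / 2.
Proof.
move=> T1 TA; have T0 : 0 < T by rewrite (lt_le_trans _ T1).
have A0 : 0 < A by rewrite (lt_le_trans T0).
have e : 2 * (sh T * sh (A / T)) = ch A - ch (T ^+ 2 / A).
  by rewrite /ch /sh; field; rewrite !lt0r_neq0.
have : 1 <= ch (T ^+ 2 / A) by rewrite ch_ge1// divr_gt0// exprn_gt0.
have : ch A - 1 <= sh A.
  rewrite -subr_ge0.
  have -> : sh A - (ch A - 1) = 1 - A^-1 by rewrite /sh /ch; field; exact: lt0r_neq0.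
  by rewrite subr_ge0 invf_le1// (le_trans T1).
lra.
Qed.

(* By the law of cosines, [k] is the cosine of the angle opposite to the side ln C
   of a triangle with sides ln A, ln B and ln C; the hypothesis on [T ^+ 2] says
   that ln T is at most the Gromov product based at the vertex of this angle. *)
Lemma tripod_angle A B C T : 1 <= T -> T <= A -> T <= B -> 1 < A -> 1 < B ->
  1 <= C -> A / B <= C -> B / A <= C -> C * T ^+ 2 <= A * B ->
  let k := (ch A * ch B - ch C) / (sh A * sh B) in
  (-1 <= k <= 1) /\ ch T * ch T - sh T * sh T * k <= 3 / 2.
Proof.
move=> T1 TA TB A1 B1 C1 hAB hBA hC k.
have T0 : 0 < T by rewrite (lt_le_trans _ T1).
have A0 : 0 < A by rewrite (lt_trans _ A1).
have B0 : 0 < B by rewrite (lt_trans _ B1).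
have C0 : 0 < C by rewrite (lt_le_trans _ C1).
have sA := sh_gt0 A1; have sB := sh_gt0 B1.
have sAB : 0 < sh A * sh B by rewrite mulr_gt0.
have CAB : C <= A * B by apply: le_trans hC; rewrite ler_peMr ?(ltW C0)// exprn_ege1.
have c1 : ch C <= ch (A * B).
  by rewrite le_ch// mulr_ege1// mulr_ege1 ?ltW.
have c2 : ch (A / B) <= ch C.
  by rewrite le_ch ?divr_gt0// mulrC -ler_pdivrMr ?divr_gt0// mul1r invf_div.
have e1 : ch (A * B) = ch A * ch B + sh A * sh B.
  by rewrite /ch /sh; field; rewrite !lt0r_neq0.
have e2 : ch (A / B) = ch A * ch B - sh A * sh B.
  by rewrite /ch /sh; field; rewrite !lt0r_neq0.
(* The angle exists by the triangle inequalities: [c1] and [c2] read cosh (a - b) <= cosh c <= cosh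
   (a + b). *)
split.
  by rewrite /k ler_pdivlMr// ler_pdivrMr//; apply/andP; split; lra.
have -> : ch T * ch T - sh T * sh T * k =
    1 + sh T ^+ 2 * (ch C - ch (A / B)) / (sh A * sh B).
  by rewrite /k e2; rewrite /ch /sh; field; rewrite ?mulf_neq0 ?lt0r_neq0//;
   move: sA sB; rewrite /sh => sA sB; rewrite -!expr2 in sA sB *; nra.
(* The bound on the Gromov product gives c <= a + b - 2t, and cosh (a + b - 2t) - cosh (a - b) = 2
   sinh (a - t) sinh (b - t). Applying [half_sh] to each factor leaves an excess of at most 1/2 over
   1. *)
have c3 : ch C <= ch (A * B / T ^+ 2).
  rewrite le_ch//; first by rewrite ler_pdivlMr// exprn_gt0.
  by rewrite mulr_ege1// ler_pdivlMr ?exprn_gt0// mul1r expr2 ler_pM// ltW.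
have e3 : ch (A * B / T ^+ 2) - ch (A / B) = 2 * (sh (A / T) * sh (B / T)).
  by rewrite /ch /sh; field; rewrite !lt0r_neq0.
have hA := half_sh T1 TA; have hB := half_sh T1 TB.
have sT := sh_ge0 T1.
have sAT : 0 <= sh (A / T) by rewrite sh_ge0// ler_pdivlMr// mul1r.
have sBT : 0 <= sh (B / T) by rewrite sh_ge0// ler_pdivlMr// mul1r.
suff : sh T ^+ 2 * (ch C - ch (A / B)) / (sh A * sh B) <= 1 / 2 by lra.
rewrite ler_pdivrMr//.
apply: (@le_trans _ _ (sh T ^+ 2 * (2 * (sh (A / T) * sh (B / T))))).
  by rewrite ler_wpM2l ?sqr_ge0// -e3 lerD2r.
have -> : sh T ^+ 2 * (2 * (sh (A / T) * sh (B / T))) =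
  2 * ((sh T * sh (A / T)) * (sh T * sh (B / T))) by ring.
have : (sh T * sh (A / T)) * (sh T * sh (B / T)) <= sh A / 2 * (sh B / 2).
  by rewrite ler_pM// mulr_ge0.
lra.
Qed.

End HalfPlane.

(** * Thin tripods and the four-point condition *)

Section Tripod.
Context {R : realType} {X : metricType R}.
Implicit Types o p q r x y z : X.

Lemma gromov_product_ge0 x y z : 0 <= gromov_product x y z :> R.
Proof.
by rewrite /gromov_product divr_ge0// subr_ge0 (metric_sym x y) metric_triangle.
Qed.

Lemma gromov_product_le x y z : gromov_product x y z <= mdist x y.
Proof.
rewrite /gromov_product ler_pdivrMr//.
have := metric_triangle x y z; lra.
Qed.

Lemma gromov_productC (x y z : X) : gromov_product x y z = gromov_product x z y.
Proof. by rewrite /gromov_product (metric_sym y z) (addrC (mdist x y)). Qed.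

Lemma gromov_product_base x x' y z :
  gromov_product x y z <= gromov_product x' y z + mdist x x'.
Proof.
rewrite /gromov_product; have := metric_triangle x x' y; have := metric_triangle x x' z; lra.
Qed.

Lemma gromov_product_lip x y y' z :
  gromov_product x y z <= gromov_product x y' z + mdist y y'.
Proof.
rewrite /gromov_product; have := metric_triangle x y' y; have := metric_triangle y' y z.
by rewrite (metric_sym y' y); lra.
Qed.

Lemma comparison_tripod (a b c t : R) : 0 < t -> t <= a -> t <= b ->
  a <= b + c -> b <= a + c -> 0 <= c -> t <= (a + b - c) / 2 ->
  exists p' q' r' a' b' : R * R,
  [/\ [/\ 0 < p'.2, 0 < q'.2, 0 < r'.2, 0 < a'.2 & 0 < b'.2],
    [/\ hyp_dist p' q' = a, hyp_dist p' r' = b & hyp_dist q' r' = c],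
    hyp_dist p' a' = t /\ hyp_dist a' q' = a - t,
    hyp_dist p' b' = t /\ hyp_dist b' r' = b - t &
    hyp_dist a' b' <= 2].
Proof.
move=> t0 ta tb abc bac c0 tp.
pose A := expR a; pose B := expR b; pose C := expR c; pose T := expR t.
have [A0 B0 C0 T0] : [/\ 0 < A, 0 < B, 0 < C & 0 < T] by split; exact: expR_gt0.
have a0 : 0 < a := lt_le_trans t0 ta.
have b0 : 0 < b := lt_le_trans t0 tb.
have [|||||||||] := @tripod_angle R A B C T.
- by rewrite -expR0 ler_expR ltW.
- by rewrite ler_expR.
- by rewrite ler_expR.
- by rewrite -expR0 ltr_expR.
- by rewrite -expR0 ltr_expR.
- by rewrite -expR0 ler_expR.
- by rewrite /A /B /C -expRN -expRD ler_expR; lra.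
- by rewrite /A /B /C -expRN -expRD ler_expR; lra.
- by rewrite /A /B /C /T expr2 -!expRD ler_expR; lra.
set k := (ch A * ch B - ch C) / _ => k1 hk.
have sA : 0 < sh A by apply: sh_gt0; rewrite -expR0 ltr_expR.
have sB : 0 < sh B by apply: sh_gt0; rewrite -expR0 ltr_expR.
pose l := Num.sqrt (1 - k ^+ 2).
have hl : l ^+ 2 = 1 - k ^+ 2.
  by rewrite sqr_sqrtr// subr_ge0; move: k1 => /andP[]; nra.
have vert U V : 0 < U -> 0 < V -> 1 + (((0, U).1 - (0, V).1) ^+ 2 +
   ((0, U).2 - (0, V).2) ^+ 2) / (2 * (0, U).2 * (0, V).2) = ch (V / U).
  by move=> U0 V0 /=; rewrite /ch; field; rewrite !lt0r_neq0.
have p1 : ch A * ch 1 - sh A * sh 1 * k = ch A by rewrite /ch /sh; field; exact: lt0r_neq0.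
(* The vertex p' is (0, 1), q' lies vertically above it, and r' lies on the ray whose angle has the
   cosine [k] imposed by the law of cosines; a' and b' are at distance t from p' on these two
   rays. *)
exists (0, 1), (0, A), (polar k l B), (0, T), (polar k l T); split.
- by split => //=; rewrite invr_gt0 polar_den_gt0.
- split.
  + by apply: hyp_dist_ch; [exact: ltW | rewrite vert// divr1].
  + apply: hyp_dist_ch; [exact: ltW | rewrite polar_vertical//].
    by rewrite -/B /ch /sh; field; exact: lt0r_neq0.
  + apply: hyp_dist_ch; [exact: c0 | rewrite polar_vertical//].
    by rewrite -/C /k; field; rewrite !lt0r_neq0.
- split.
  + by apply: hyp_dist_ch; [exact: ltW | rewrite vert// divr1].
  + apply: hyp_dist_ch; [lra | rewrite vert//].
    by rewrite /A /T expRD expRN.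
- split.
  + apply: hyp_dist_ch; [exact: ltW | rewrite polar_vertical//].
    by rewrite -/T /ch /sh; field; exact: lt0r_neq0.
  + apply: hyp_dist_ch; [lra | rewrite polar_ray//].
    by rewrite /B /T expRD expRN.
apply: hyp_dist_le2; rewrite polar_vertical//; apply/andP; split => //.
have : 0 <= sh T ^+ 2 * (1 - k) by rewrite mulr_ge0 ?sqr_ge0//; lra.
have : ch T ^+ 2 = 1 + sh T ^+ 2 by rewrite /ch /sh; field; exact: lt0r_neq0.
by rewrite !expr2; lra.
Qed.

Lemma tripod (hX : cat_minus1 X) p q r g h t :
  geodesic_segment p q g -> geodesic_segment p r h ->
  0 <= t <= gromov_product p q r -> mdist (g t) (h t) <= 2.
Proof.
move=> gg hh /andP[t0 tp].
have ta : t <= mdist p q := le_trans tp (gromov_product_le _ _ _).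
have tb : t <= mdist p r.
  by rewrite (le_trans tp)// gromov_productC gromov_product_le.
(* At t = 0 the sides may be degenerate and have no angle at p; both points are then p itself. *)
have [t00|tn0] := eqVneq t 0.
  by case: gg hh => [g0 _ _] [h0 _ _]; rewrite t00 g0 h0 mdistxx.
have {}tn0 : 0 < t by rewrite lt_neqAle eq_sym tn0.
have [||p' [q' [r' [a' [b' [h1 h2 [h3 h4] [h5 h6] h7]]]]]] :=
  comparison_tripod tn0 ta tb _ _ (mdist_ge0 q r) tp.
- by have := metric_triangle p r q; rewrite (metric_sym r q).
- exact: metric_triangle.
apply: le_trans h7; have [_ /(_ p q r g h t t)] := hX; apply; eauto.
  by rewrite t0.
by rewrite t0.
Qed.

(** At time m the geodesics from o to x, y and z are at points that are 2-close for consecutive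
    endpoints. Going through these points, d(x, z) <= (d(o, x) - m) + 4 + (d(o, z) - m). *)
Lemma four_point (hX : cat_minus1 X) (o x y z : X) m :
  m <= gromov_product o x y -> m <= gromov_product o y z ->
  m - 2 <= gromov_product o x z.
Proof.
have [m0 _ _|m0] := ltP m 0; first by have := gromov_product_ge0 o x z; lra.
move=> mxy myz; have [gX _] := hX.
have [g1 s1] := gX o x; have [g2 s2] := gX o y; have [g3 s3] := gX o z.
have mx : m <= mdist o x := le_trans mxy (gromov_product_le _ _ _).
have mz : m <= mdist o z.
  by rewrite (le_trans myz)// gromov_productC gromov_product_le.
have d12 : mdist (g1 m) (g2 m) <= 2 by apply: tripod s1 s2 _ => //; rewrite m0.
have d23 : mdist (g2 m) (g3 m) <= 2 by apply: tripod s2 s3 _ => //; rewrite m0.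
have e1 : mdist x (g1 m) = mdist o x - m.
  have [_ ge e] := s1; rewrite -{1}ge e ?in_itv/= ?mdist_ge0 ?lexx ?m0 ?mx//.
  by rewrite ger0_norm// subr_ge0.
have e3 : mdist (g3 m) z = mdist o z - m.
  have [_ ge e] := s3; rewrite -{1}ge e ?in_itv/= ?mdist_ge0 ?lexx ?m0 ?mz//.
  by rewrite distrC ger0_norm// subr_ge0.
have := metric_triangle x (g1 m) z; have := metric_triangle (g1 m) (g2 m) z.
have := metric_triangle (g2 m) (g3 m) z.
rewrite /gromov_product; lra.
Qed.
End Tripod.

(** * Lower limits and Gromov products at infinity *)

Section EinfBounds.
Context {R : realType}.
Implicit Types (u : (\bar R)^nat) (c : \bar R).

Lemma limn_einf_sup_einfs u : limn_einf u = ereal_sup (range (einfs u)).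
Proof. by rewrite limn_einf_lim; apply/cvg_lim => //; exact: cvg_einfs_sup. Qed.

Lemma limn_einf_ge u c : (\forall n \near \oo, c <= u n)%E -> (c <= limn_einf u)%E.
Proof.
move=> [N _ hN]; rewrite limn_einf_sup_einfs; apply: ereal_sup_ge; exists (einfs u N).
  by exists N.
by apply: le_ereal_inf_tmp => _ [n /= Nn <-]; exact: hN.
Qed.

Lemma limn_einf_le u c : (\forall n \near \oo, u n <= c)%E -> (limn_einf u <= c)%E.
Proof.
move=> [N _ hN]; rewrite limn_einf_sup_einfs; apply: ge_ereal_sup => _ [n _ <-].
apply: ereal_inf_le; exists (u (maxn n N)); last by apply: hN => /=; rewrite leq_maxr.
by exists (maxn n N) => //=; rewrite leq_maxl.
Qed.

Lemma limn_einf_gt u c : (c < limn_einf u)%E -> (\forall n \near \oo, c <= u n)%E.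
Proof.
rewrite limn_einf_sup_einfs => /ereal_sup_gt[_ [N _ <-] cN].
exists N => // n /= Nn; apply: (le_trans (ltW cN)).
by apply: ereal_inf_lbound; exists n.
Qed.

End EinfBounds.

Definition four_point_condition {R : realType} (X : metricType R) :=
  forall (o x y z : X) m, m <= gromov_product o x y -> m <= gromov_product o y z ->
  m - 2 <= gromov_product o x z.

Section Ends.
Context {R : realType} {X : metricType R}.
Hypothesis h4 : four_point_condition X.
Implicit Types (o x y z : X) (p q : gbar X) (V W : gboundary X) (u v w s t : nat -> X) (r : R).

Lemma same_endP u v : same_end u v <->
  forall o r, exists N, forall n m, (N <= n)%N -> (N <= m)%N ->
    r <= gromov_product o (u n) (v m).
Proof.
split => [uv o r|h o].
  have /cvgryPge/(_ r) := uv o.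
  rewrite !near_simpl => -[[A B] /= [[N1 _ h1] [N2 _ h2]] h].
  exists (maxn N1 N2) => n m; rewrite !geq_max => /andP[n1 n2] /andP[m1 m2].
  by apply: (h (n, m)); split => /=; [exact: h1 | exact: h2].
apply/cvgryPge => r; have [N hN] := h o r.
exists ([set n | (N <= n)%N], [set n | (N <= n)%N]) => /=.
  by split; exists N.
by move=> [n m] [/= nN mN]; exact: hN.
Qed.

Lemma same_end_sym u v : same_end u v -> same_end v u.
Proof.
move=> /same_endP h; apply/same_endP => o r; have [N hN] := h o r.
by exists N => n m nN mN; rewrite gromov_productC hN.
Qed.

Lemma same_end_trans v u w : same_end u v -> same_end v w -> same_end u w.
Proof.
move=> /same_endP uv /same_endP vw; apply/same_endP => o r.
have [N hN] := uv o (r + 2); have [M hM] := vw o (r + 2).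
exists (maxn N M) => n m; rewrite !geq_max => /andP[nN nM] /andP[mN mM].
have := h4 (hN _ N nN (leqnn _)); have := hN n (maxn N M) nN (leq_maxl _ _).
have := hM (maxn N M) m (leq_maxr _ _) mM => h2 h1 _.
by have := h4 h1 h2; lra.
Qed.

Lemma end_ex V : exists u, val V u.
Proof. by case: V => V /= /asboolP[u uu ->]; exists u; split. Qed.

Lemma end_same V u v : val V u -> val V v -> same_end u v.
Proof.
case: V => V /= /asboolP[s ss ->] [uu su] [vv sv].
by apply: same_end_trans sv; exact: same_end_sym.
Qed.

Lemma end_eq V W u v : val V u -> val W v -> same_end u v -> V = W.
Proof.
move=> Vu Wv uv; apply: val_inj; apply/seteqP; split => t.
  move=> Vt; move: Wv; have := end_same Vu Vt.
  case: W => W /= /asboolP[s ss ->] ut [vv sv]; split.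
    exact: (end_same Vt Vt).
  by apply: (same_end_trans sv); apply: same_end_trans ut; exact: same_end_sym.
move=> Wt; move: Vu; have := end_same Wv Wt.
case: V => V /= /asboolP[s ss ->] vt [uu su]; split.
  exact: (end_same Wt Wt).
by apply: (same_end_trans su); apply: same_end_trans vt.
Qed.

Lemma seq_cvg_ex p : exists u, seq_cvg p u.
Proof. by case: p => [y|V]; [exists (cst y); exact: cvg_cst | exact: end_ex]. Qed.

(** For p in X, both sequences are eventually 1-close to p, hence 2-close to each other. For p at
    infinity, (s' n | s n) tends to infinity and the four-point condition costs 2. *)
Lemma seq_cvg_change p s s' x t r : seq_cvg p s -> seq_cvg p s' ->
  (\forall n \near \oo, r <= gromov_product x (s n) (t n)) ->
  \forall n \near \oo, r - 2 <= gromov_product x (s' n) (t n).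
Proof.
case: p => [y|V] /=.
  move=> sy s'y h; near=> n.
  have h1 : mdist y (s n) < 1.
    by near: n; exact: (metricType_numDomainType.cvgr_dist_lt sy).
  have h2 : mdist y (s' n) < 1.
    by near: n; exact: (metricType_numDomainType.cvgr_dist_lt s'y).
  have h3 : r <= gromov_product x (s n) (t n) by near: n.
  have := gromov_product_lip x (s n) (s' n) (t n).
  have := metric_triangle (s n) y (s' n); rewrite (metric_sym (s n) y); lra.
move=> Vs Vs' h; have /same_endP/(_ x r)[N hN] := end_same Vs' Vs.
near=> n; apply: (@h4 _ _ (s n)); last by near: n.
by apply: hN; near: n; exists N.
Unshelve. all: by end_near. Qed.

(** Passing strictly below the supremum costs 1, and exchanging each of the two sequences for a
    prescribed one costs 2; hence the 5. *)
Lemma gprod_gt x p q s t r : seq_cvg p s -> seq_cvg q t ->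
  (r%:E <= gprod x p q)%E ->
  \forall n \near \oo, r - 5 <= gromov_product x (s n) (t n).
Proof.
move=> ps qt h; have : ((r - 1)%:E < gprod x p q)%E.
  by apply: lt_le_trans h; rewrite lte_fin; lra.
move=> /ereal_sup_gt[_ [s' ps' [t' qt' <-]] /limn_einf_gt] {}h.
have {}h : \forall n \near \oo, r - 1 <= gromov_product x (s' n) (t' n).
  by apply: filterS h => n; rewrite lee_fin.
have {}h := seq_cvg_change ps' ps h.
have {}h : \forall n \near \oo, r - 1 - 2 <= gromov_product x (t' n) (s n).
  by apply: filterS h => n; rewrite gromov_productC.
have := seq_cvg_change qt' qt h; apply: filterS => n; rewrite gromov_productC; lra.
Qed.

Lemma gprod_ge x p q s t r : seq_cvg p s -> seq_cvg q t ->
  (\forall n \near \oo, r <= gromov_product x (s n) (t n)) ->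
  (r%:E <= gprod x p q)%E.
Proof.
move=> ps qt h; apply: ereal_sup_ge.
exists (limn_einf (fun n => (gromov_product x (s n) (t n))%:E)).
  by exists s => //; exists t.
by apply: limn_einf_ge; apply: filterS h => n; rewrite lee_fin.
Qed.

Lemma gprodC x p q : gprod x p q = gprod x q p.
Proof.
rewrite /gprod; congr ereal_sup; apply/seteqP; split => _ [s ss [t tt <-]];
  exists t => //; exists s => //; congr limn_einf; apply/funext => n;
  by rewrite gromov_productC.
Qed.

Lemma gprod_four_point x p q (v : gbar X) r : (r%:E <= gprod x p q)%E ->
  (r%:E <= gprod x q v)%E -> ((r - 7)%:E <= gprod x p v)%E.
Proof.
have [s ps] := seq_cvg_ex p; have [t qt] := seq_cvg_ex q; have [u vu] := seq_cvg_ex v.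
move=> /(gprod_gt ps qt) h1 /(gprod_gt qt vu) h2; apply: (gprod_ge ps vu).
near=> n; have -> : r - 7 = r - 5 - 2 by lra.
by apply: (@h4 _ _ (t n)); near: n.
Unshelve. all: by end_near. Qed.

Lemma gprod_base x x' p q r : (r%:E <= gprod x p q)%E ->
  ((r - 5 - mdist x x')%:E <= gprod x' p q)%E.
Proof.
have [s ps] := seq_cvg_ex p; have [t qt] := seq_cvg_ex q.
move=> /(gprod_gt ps qt) h; apply: (gprod_ge ps qt).
apply: filterS h => n; have := gromov_product_base x x' (s n) (t n); lra.
Qed.

Lemma gprod_lip x y y' q r : (r%:E <= gprod x (Pt y) q)%E ->
  ((r - 5 - mdist y y')%:E <= gprod x (Pt y') q)%E.
Proof.
have [t qt] := seq_cvg_ex q.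
have cy z : seq_cvg (Pt z) (cst z) by exact: cvg_cst.
move=> /(gprod_gt (cy y) qt) h; apply: (gprod_ge (cy y') qt).
apply: filterS h => n /=; have := gromov_product_lip x y y' (t n); lra.
Qed.

Lemma gprod_bd_same x V : gprod x (Bd V) (Bd V) = +oo%E.
Proof.
have [u Vu] := end_ex V; apply/eqyP => r r0; apply: (@gprod_ge _ _ _ u u) => //.
have /same_endP/(_ x r)[N hN] := end_same Vu Vu.
by exists N => // n /= nN; exact: hN.
Qed.

Lemma gprod_bd_eq x V W : (forall r, (r%:E <= gprod x (Bd V) (Bd W))%E) -> V = W.
Proof.
move=> h; have [u Vu] := end_ex V; have [v Wv] := end_ex W.
apply: (end_eq Vu Wv); apply/same_endP => o r.
(* This compares terms of equal index only. A common index M links u n to v m through u M and v M; 9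
   = 5 + 4 pays for [gprod_gt] and for two uses of the four-point condition. *)
have [N _ hN] := @gprod_gt x (Bd V) (Bd W) u v _ Vu Wv (h (r + 9 + mdist x o)).
have /same_endP/(_ x (r + 4 + mdist x o))[N1 h1] := end_same Vu Vu.
have /same_endP/(_ x (r + 4 + mdist x o))[N2 h2] := end_same Wv Wv.
pose M := maxn N (maxn N1 N2).
exists M => n m; rewrite !geq_max => /and3P[n0 n1 n2] /and3P[m0 m1 m2].
have M0 : (N <= M)%N by rewrite leq_maxl.
have M1 : (N1 <= M)%N by rewrite /M !leq_max leqnn !orbT.
have M2 : (N2 <= M)%N by rewrite /M !leq_max leqnn !orbT.
have e1 := h1 n M n1 M1; have e2 := h2 M m M2 m2.
have e3 : r + 4 + mdist x o <= gromov_product x (u M) (v M) by have := hN M M0; lra.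
have := gromov_product_base x o (u n) (v m).
have e5 := h4 e1 e3; have e6 : r + 4 + mdist x o - 2 <= gromov_product x (v M) (v m) by lra.
have := h4 e5 e6; lra.
Qed.

(** With one argument in X the product lies between 0 and d(x, y), so [fine] loses nothing here. *)
Definition gpb x y V : R := fine (gprod x (Pt y) (Bd V)).

Lemma gpbE x y V : gprod x (Pt y) (Bd V) = (gpb x y V)%:E.
Proof.
rewrite /gpb fineK// fin_numE; have [u Vu] := end_ex V.
have cy z : seq_cvg (Pt z) (cst z) by exact: cvg_cst.
apply/andP; split.
  suff : (0%:E <= gprod x (Pt y) (Bd V))%E by case: gprod.
  by apply: (@gprod_ge _ (Pt y) (Bd V) _ u _ (cy y) Vu); near=> n; exact: gromov_product_ge0.
suff : (gprod x (Pt y) (Bd V) <= (mdist x y + 1)%:E)%E by case: gprod.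
apply: ge_ereal_sup => _ [s sy [t Vt <-]]; apply: limn_einf_le; near=> n.
have h1 : mdist y (s n) < 1.
  by near: n; exact: (metricType_numDomainType.cvgr_dist_lt sy).
rewrite lee_fin; have := gromov_product_le x (s n) (t n).
by have := metric_triangle x y (s n); lra.
Unshelve. all: by end_near. Qed.

Lemma gpb_ge x y V r : (r <= gpb x y V) = (r%:E <= gprod x (Pt y) (Bd V))%E.
Proof. by rewrite gpbE lee_fin. Qed.

Lemma gpb_ge0 x y V : 0 <= gpb x y V.
Proof.
rewrite gpb_ge; have [u Vu] := end_ex V.
have cy z : seq_cvg (Pt z) (cst z) by exact: cvg_cst.
by apply: (@gprod_ge _ (Pt y) (Bd V) _ u _ (cy y) Vu); near=> n; exact: gromov_product_ge0.
Unshelve. all: by end_near. Qed.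

Lemma gpb_le x y V : gpb x y V <= mdist x y.
Proof.
rewrite -lee_fin -gpbE; apply/lee_addgt0Pr => e e0.
apply: ge_ereal_sup => _ [s sy [t Vt <-]]; apply: limn_einf_le; near=> n.
have h1 : mdist y (s n) < e.
  by near: n; exact: (metricType_numDomainType.cvgr_dist_lt sy).
rewrite -EFinD lee_fin; have := gromov_product_le x (s n) (t n).
by have := metric_triangle x y (s n); lra.
Unshelve. all: by end_near. Qed.

(** One inequality is [gprod_gt]. For the other, (u n | u m) is eventually at least d(x, y), the
    largest value a product with y can take, so (y | u n) and (y | u m) differ by at most 2. *)
Lemma gpb_near x y V u : val V u ->
  \forall n \near \oo, `|gpb x y V - gromov_product x y (u n)| <= 5.
Proof.
move=> Vu; have cy z : seq_cvg (Pt z) (cst z) by exact: cvg_cst.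
have h1 : gpb x y V <= gpb x y V := lexx _.
rewrite gpb_ge in h1; have h := @gprod_gt x (Pt y) (Bd V) _ u _ (cy y) Vu h1.
have /same_endP/(_ x (mdist x y))[N hN] := end_same Vu Vu.
have h2 n m : (N <= n)%N -> (N <= m)%N ->
    gromov_product x y (u n) - 2 <= gromov_product x y (u m).
  move=> nN mN; apply: (@h4 _ _ (u n)) => //.
  exact: le_trans (gromov_product_le _ _ _) (hN _ _ nN mN).
near=> n; have nN : (N <= n)%N by near: n; exists N.
rewrite ler_norml; apply/andP; split; last first.
  have : gpb x y V - 5 <= gromov_product x (cst y n) (u n) by near: n.
  by rewrite /=; lra.
suff : gromov_product x y (u n) - 2 <= gpb x y V by lra.
rewrite gpb_ge; apply: (@gprod_ge _ (Pt y) (Bd V) _ u _ (cy y) Vu); exists N => // m /= mN.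
exact: h2.
Unshelve. all: by end_near. Qed.

(** For three points of X one has exactly (y | u)_x + (x | u)_y = d(x, y); each of the two products
    is then moved to infinity at a cost of 5. *)
Lemma gpb_sum x y V : `|gpb x y V + gpb y x V - mdist x y| <= 10.
Proof.
have [u Vu] := end_ex V.
have [N1 _ h1] := gpb_near x y Vu; have [N2 _ h2] := gpb_near y x Vu.
have := h1 (maxn N1 N2) (leq_maxl _ _); have := h2 (maxn N1 N2) (leq_maxr _ _).
rewrite !ler_norml /gromov_product (metric_sym y x) => /andP[? ?] /andP[? ?].
by apply/andP; split; lra.
Qed.

(* [2 * gpb x y V - mdist x y] is the Busemann function at V. *)
Lemma gpb_cocycle x y z V :
  `|(2 * gpb x z V - mdist x z) - (2 * gpb x y V - mdist x y)
    - (2 * gpb y z V - mdist y z)| <= 30.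
Proof.
have [u Vu] := end_ex V.
have [N1 _ h1] := gpb_near x z Vu; have [N2 _ h2] := gpb_near x y Vu.
have [N3 _ h3] := gpb_near y z Vu; pose M := maxn N1 (maxn N2 N3).
have M1 : (N1 <= M)%N by rewrite /M !leq_max leqnn ?orbT.
have M2 : (N2 <= M)%N by rewrite /M !leq_max leqnn ?orbT.
have M3 : (N3 <= M)%N by rewrite /M !leq_max leqnn ?orbT.
have := h1 _ M1; have := h2 _ M2; have := h3 _ M3.
rewrite !ler_norml /gromov_product => /andP[? ?] /andP[? ?] /andP[? ?].
by apply/andP; split; lra.
Qed.

Lemma busemannE V x y : busemann (Bd V) x y = 2 * gpb x y V - mdist x y.
Proof. by rewrite /busemann gprodC. Qed.

End Ends.

(** * Topology of the bordification and action of isometries *)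

Section BordificationTopology.
Context {R : realType} {X : metricType R}.
Hypothesis h4 : four_point_condition X.
Implicit Types (o x y z : X) (p q : gbar X) (V W : gboundary X) (r : R).

(** The set [N] need not be open. [U] collects the points around which [N] still contains a basic
    neighbourhood, and the four-point condition shows that [U] is open. *)
Lemma nbhs_gprod o V r : nbhs (Bd V) [set p | (r%:E <= gprod o p (Bd V))%E].
Proof.
set N := [set p | _].
pose U := [set p : gbar X | match p with Pt y => nbhs y (Pt @^-1` N)
  | Bd W => exists s : R, [set p' | (s%:E <= gprod o p' (Bd W))%E] `<=` N end].
have UN : U `<=` N.
  move=> [y|W] /=; first exact: nbhs_singleton.
  by move=> [s]; apply => /=; rewrite gprod_bd_same// leey.
have oU : gbar_open U.
  split; first exact: open_interior.
  (* Of the margin 20, 5 pays for the base point. The remaining 15 covers a displacement by 1 in X,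
     which costs 6, or a four-point condition at infinity, which costs 7. *)
  move=> W [s sN] o'; exists (s + 20 + mdist o o') => p /= hp.
  have {}hp : ((s + 15)%:E <= gprod o p (Bd W))%E.
    have := gprod_base h4 o (ltW hp); apply: le_trans.
    by rewrite (metric_sym o' o) lee_fin; lra.
  case: p hp => [y|W'] hp /=.
    apply: filterS (nbhsx_ballx y 1 ltr01) => y'.
    rewrite ballEmdist/= => yy'; apply: sN => /=.
    by apply: le_trans (gprod_lip h4 y' hp); rewrite lee_fin; lra.
  exists (s + 15) => p' /= p'W'; apply: sN => /=.
  by apply: le_trans (gprod_four_point h4 p'W' hp); rewrite lee_fin; lra.
have UV : U (Bd V) by exists r.
by rewrite nbhsE; exists U.
Qed.

Lemma nbhs_bd o V A : nbhs (Bd V) A ->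
  exists r : R, [set p | (r%:E <= gprod o p (Bd V))%E] `<=` A.
Proof.
rewrite nbhsE => -[U [[_ /(_ V)hU] UV] UA]; have [r hr] := hU UV o.
exists (r + 1) => p /= h; apply/UA/hr => /=; apply: lt_le_trans h.
by rewrite lte_fin; lra.
Qed.

Lemma closed_bdry : closed (bdry X).
Proof.
rewrite -[bdry X]setCK; apply: open_closedC.
have -> : ~` bdry X = range Pt.
  apply/seteqP; split => [[y _|V]|_ [y _ <-] [V _]//]; first by exists y.
  by case; exists V.
split; last by move=> V [].
by have -> : Pt @^-1` range Pt = [set: X];
  [by apply/seteqP; split => // y _; exists y|exact: openT].
Qed.

(* Sets of boundary points are not known to be Borel; their closures are, and
   passing to the closure only changes Gromov products by bounded amounts. *)
Definition bdcl (A : set (gboundary X)) : set (gbar X) := closure (Bd @` A).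

Lemma bdcl_sub A V : A V -> bdcl A (Bd V).
Proof. by move=> AV; apply: subset_closure; exists V. Qed.

Lemma bdcl_bdry A : bdcl A `<=` bdry X.
Proof.
move=> p Ap; apply: closed_bdry; move: p Ap; apply: closure_subset.
by move=> _ [V _ <-]; exists V.
Qed.

Lemma bdclP A o V r : bdcl A (Bd V) ->
  exists2 W, A W & (r%:E <= gprod o (Bd W) (Bd V))%E.
Proof. by move=> /(_ _ (nbhs_gprod o V r))[_ [[W AW <-] h]]; exists W. Qed.

Lemma bdcl_gprod_ge o p r : bdcl [set V | (r%:E <= gprod o p (Bd V))%E] `<=`
  Bd @` [set V | ((r - 7)%:E <= gprod o p (Bd V))%E].
Proof.
move=> q Aq; have [V _ e] := bdcl_bdry Aq; subst q.
have [W /= h1 h2] := bdclP o r Aq; exists V => //=.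
exact: gprod_four_point h1 h2.
Qed.

Lemma bdcl_gpb_ge o y r : bdcl [set V | r <= gpb o y V] `<=`
  Bd @` [set V | r - 7 <= gpb o y V].
Proof.
have e s : [set V | s <= gpb o y V] = [set V | (s%:E <= gprod o (Pt y) (Bd V))%E].
  by apply/seteqP; split => V /=; rewrite gpb_ge.
by rewrite !e; exact: bdcl_gprod_ge.
Qed.

(** A point V of the closure agrees with some W of the set up to depth d(o, y). No product with y
    goes deeper, so (y | V) exceeds (y | W) by at most 7. *)
Lemma bdcl_gpb_le o y r : bdcl [set V | gpb o y V <= r] `<=`
  Bd @` [set V | gpb o y V <= r + 7].
Proof.
move=> q Aq; have [V _ e] := bdcl_bdry Aq; subst q.
have [W /= h1 h2] := bdclP o (mdist o y) Aq; exists V => //=.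
have h3 : gpb o y V <= gpb o y V := lexx _; rewrite gpb_ge// in h3.
have h5 : ((gpb o y V)%:E <= gprod o (Bd V) (Bd W))%E.
  by rewrite gprodC; apply: le_trans h2; rewrite lee_fin gpb_le.
by have := gprod_four_point h4 h3 h5; rewrite -gpb_ge//; lra.
Qed.

Definition bmap (g : X -> X) V : gboundary X :=
  insubd V [set g \o u | u in \val V].

Section Isometry.
Variables g h : X -> X.
Hypothesis hg : cancel h g.
Hypothesis g_iso : forall x y, mdist (g x) (g y) = mdist x y.

Lemma gromov_product_iso x y z :
  gromov_product (g x) (g y) (g z) = gromov_product x y z.
Proof. by rewrite /gromov_product !g_iso. Qed.

Lemma same_end_iso (u v : nat -> X) : same_end u v -> same_end (g \o u) (g \o v).
Proof.
move=> /same_endP uv; apply/same_endP => o r; have [N hN] := uv (h o) r.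
by exists N => n m nN mN; rewrite -(hg o) gromov_product_iso hN.
Qed.

Lemma bmap_seq V u : val V u -> val (bmap g V) (g \o u).
Proof.
have hs (v w : nat -> X) : same_end (g \o v) w -> same_end v (h \o w).
  move=> /same_endP vw; apply/same_endP => o r; have [N hN] := vw (g o) r.
  exists N => n m nN mN; rewrite -gromov_product_iso /= hg; exact: hN.
move=> Vu; rewrite val_insubd ifT; first by exists u.
have [s Vs] := end_ex V; apply/asboolP; exists (g \o s).
  by apply: same_end_iso; exact: (end_same h4 Vs Vs).
apply/seteqP; split => [_ [v Vv <-]|v [vv /hs sv]] /=.
  by split; apply: same_end_iso; [exact: (end_same h4 Vv Vv) | exact: (end_same h4 Vs Vv)].
exists (h \o v); last by apply/funext => n /=; rewrite hg.
case: V Vu Vs => V /= /asboolP[t tt ->] _ [ss ts]; split.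
  have : same_end (g \o (h \o v)) v by have -> : g \o (h \o v) = v by apply/funext => n /=; rewrite hg.
  exact: hs.
exact: (same_end_trans h4 ts).
Qed.

Lemma seq_cvg_iso p u : seq_cvg p u -> seq_cvg (gbar_map g p) (g \o u).
Proof.
case: p => [y|V] /=; last exact: bmap_seq.
move=> uy; apply/(metricType_numDomainType.cvgrPdist_lt) => e e0.
near=> n; rewrite /= g_iso; near: n.
exact: metricType_numDomainType.cvgr_dist_lt uy _ e0.
Unshelve. all: by end_near. Qed.

Lemma gprod_iso x p q r : (r%:E <= gprod x p q)%E ->
  ((r - 5)%:E <= gprod (g x) (gbar_map g p) (gbar_map g q))%E.
Proof.
have [s ps] := seq_cvg_ex p; have [t qt] := seq_cvg_ex q.
move=> /(gprod_gt h4 ps qt) hr; apply: (gprod_ge (seq_cvg_iso ps) (seq_cvg_iso qt)).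
by apply: filterS hr => n /=; rewrite gromov_product_iso.
Qed.

Lemma gpb_iso x y V : `|gpb (g x) (g y) (bmap g V) - gpb x y V| <= 10.
Proof.
have [u Vu] := end_ex V; have Wu := bmap_seq Vu.
have [N1 _ h1] := gpb_near h4 x y Vu; have [N2 _ h2] := gpb_near h4 (g x) (g y) Wu.
have := h1 (maxn N1 N2) (leq_maxl _ _); have := h2 (maxn N1 N2) (leq_maxr _ _).
rewrite /= gromov_product_iso !ler_norml => /andP[? ?] /andP[? ?].
by apply/andP; split; lra.
Qed.

End Isometry.

Lemma bmapK g h (gh : cancel g h) (hg : cancel h g)
  (g_iso : forall x y, mdist (g x) (g y) = mdist x y) : cancel (bmap g) (bmap h).
Proof.
have h_iso x y : mdist (h x) (h y) = mdist x y by rewrite -g_iso !hg.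
move=> V; have [u Vu] := end_ex V.
have := bmap_seq gh h_iso (bmap_seq hg g_iso Vu).
have -> : h \o (g \o u) = u by apply/funext => n /=; rewrite gh.
by move=> Wu; apply: (end_eq h4 Wu Vu); exact: (end_same h4 Vu Vu).
Qed.

Lemma continuous_gbar_map g h (gh : cancel g h) (hg : cancel h g)
  (g_iso : forall x y, mdist (g x) (g y) = mdist x y) : continuous (gbar_map g).
Proof.
have h_iso x y : mdist (h x) (h y) = mdist x y by rewrite -g_iso !hg.
apply/continuousP => U [oU hU]; split.
  have cg : continuous g.
    move=> y; apply/metricType_numDomainType.cvgrPdist_lt => e e0.
    near=> z; rewrite g_iso; near: z.
    by apply: filterS (nbhsx_ballx y e e0) => z; rewrite ballEmdist.
  by move/continuousP: cg => /(_ _ oU).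
move=> V UV o; have [r hr] := hU (bmap g V) UV (g o); exists (r + 6) => p /= hp.
apply: hr => /=; have := gprod_iso hg g_iso (ltW hp).
by apply: lt_le_trans; rewrite lte_fin; lra.
Unshelve. all: by end_near. Qed.

End BordificationTopology.

(** * Geodesic lines between distinct ends of a proper space *)

Lemma ultra_compact_cvg (I : Type) (T : topologicalType) (F : set_system I)
    (f : I -> T) (K : set T) : UltraFilter F -> compact K -> F (f @^-1` K) ->
  exists y : T, f @ F --> y.
Proof.
move=> FU cK FK; have [y [_ yc]] := cK (f @ F) _ FK.
exists y => A yA; have [//|FA] := in_ultra_setVsetC (f @^-1` A) FU.
by have [z []] := yc (~` A) A FA yA.
Qed.

Section ProperSpace.
Context {R : realType} {X : metricType R}.
Hypotheses (hproper : proper_space X) (hcat : cat_minus1 X).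
Implicit Types (o x y z : X) (V W : gboundary X).

Let h4 : four_point_condition X := four_point hcat.

Lemma cvg_mdist (I : Type) (F : set_system I) (FF : Filter F) (f : I -> X) y (e : R) :
  0 < e -> f @ F --> y -> \forall i \near F, mdist y (f i) < e.
Proof.
by move=> e0 fy; apply: metricType_numDomainType.cvgr_dist_lt.
Qed.

Lemma gromov_product_ray o (q p b : X) (t l M : R) : mdist o q <= M ->
  mdist q p = t -> mdist q b = l -> mdist p b = l - t ->
  t - M <= gromov_product o p b.
Proof.
move=> h1 h2 h3 h5; rewrite /gromov_product h5.
have := metric_triangle q o p; have := metric_triangle q o b.
rewrite h2 h3 (metric_sym q o); lra.
Qed.

Lemma separated_ends o V W (u v : nat -> X) : V <> W -> val V u -> val W v ->
  exists M : R, \forall n \near \oo, gromov_product o (u n) (v n) <= M.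
Proof.
move=> VW Vu Wv; have [M hM] : exists M : R, ~ (M%:E <= gprod o (Bd V) (Bd W))%E.
  by apply/existsNP => h; apply/VW/(gprod_bd_eq h4 h).
exists (M + 4).
have /same_endP/(_ o (M + 4))[N1 h1] := end_same h4 Vu Vu.
have /same_endP/(_ o (M + 4))[N2 h2] := end_same h4 Wv Wv.
exists (maxn N1 N2) => // n; rewrite /= geq_max => /andP[n1 n2].
rewrite leNgt; apply/negP => h; apply: hM.
apply: (@gprod_ge _ _ _ (Bd V) (Bd W) u v _ Vu Wv); exists (maxn N1 N2) => // m.
rewrite /= geq_max => /andP[m1 m2].
have e1 := h4 (h1 m n m1 n1) (ltW h).
have e2 : M + 4 - 2 <= gromov_product o (v n) (v m) by have := h2 n m n2 m2; lra.
by have := h4 e1 e2; lra.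
Qed.

(** Since V and W are distinct, (u n | v n)_o stays below some M, so the segments from u n to v n
    pass within M + 2 of o. Parametrized from that passage, they have a limit line by properness. *)
Lemma geodesic_line_ex o V W : V <> W -> exists g : R -> X, [/\ geodesic_line g,
  Pt (g t) @[t --> -oo] --> Bd V & Pt (g t) @[t --> +oo] --> Bd W].
Proof.
move=> VW; have [u Vu] := end_ex V; have [v Wv] := end_ex W.
have [M hM] := separated_ends o VW Vu Wv.
have [gX _] := hcat.
have /choice[sg hsg] : forall n, exists g, geodesic_segment (u n) (v n) g by [].
pose l n := mdist (u n) (v n).
(* The time at which the segment from u n to v n passes near o: up to it, the segment stays 2-close
   to a geodesic from u n to o, whose point at that time is at distance (u n | v n)_o from o. *)
pose s n := gromov_product (u n) (v n) o.
have s0 n : 0 <= s n <= l n by rewrite gromov_product_ge0 gromov_product_le.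
have sE n : mdist o (u n) - s n = gromov_product o (u n) (v n).
  by rewrite /s /gromov_product (metric_sym (u n) o) (metric_sym (v n) o); lra.
have lE n : mdist o (v n) - (l n - s n) = gromov_product o (u n) (v n).
  by rewrite /s /l /gromov_product (metric_sym (u n) o) (metric_sym (v n) o); lra.
pose gn n t := sg n (s n + t).
have far (B : R) : \forall n \near \oo, B <= s n /\ B <= l n - s n.
  have /same_endP/(_ o (B + M))[N1 h1] := end_same h4 Vu Vu.
  have /same_endP/(_ o (B + M))[N2 h2] := end_same h4 Wv Wv.
  near=> n; have n1 : (N1 <= n)%N by near: n; exists N1.
  have n2 : (N2 <= n)%N by near: n; exists N2.
  have := h1 n n n1 n1; have := gromov_product_le o (u n) (u n).
  have := h2 n n n2 n2; have := gromov_product_le o (v n) (v n).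
  have := sE n; have := lE n.
  have : gromov_product o (u n) (v n) <= M by near: n.
  by move=> *; split; lra.
have mid : \forall n \near \oo, mdist o (gn n 0) <= M + 2.
  apply: filterS hM => n; rewrite -sE => hn.
  have [h hh] := gX (u n) o.
  have := tripod hcat (hsg n) hh; move=> /(_ (s n)).
  have [/andP[sn0 sn1]] := s0 n; rewrite sn0 lexx => /(_ isT).
  have sn2 : s n <= mdist (u n) o by rewrite /s gromov_productC gromov_product_le.
  have [_ ho he] := hh; have := he (s n) (mdist (u n) o).
  rewrite !in_itv/= sn0 sn2 lexx mdist_ge0 => /(_ isT isT); rewrite ho distrC.
  rewrite ger0_norm ?subr_ge0// (metric_sym (u n) o) => e1 e2.
  have := metric_triangle o (h (s n)) (sg n (s n)).
  rewrite (metric_sym o (h (s n))) (metric_sym (h _) (sg _ _)) /gn addr0; lra.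
have iso (a b : R) : \forall n \near \oo, mdist (gn n a) (gn n b) = `|a - b|.
  near=> n; have [/= f1 f2] : `|a| + `|b| <= s n /\ `|a| + `|b| <= l n - s n by near: n; exact: far.
  have [_ _ he] := hsg n.
  have ha : - (`|a| + `|b|) <= a <= `|a| + `|b|.
    by rewrite -ler_norml lerDl.
  have hb : - (`|a| + `|b|) <= b <= `|a| + `|b|.
    by rewrite -ler_norml lerDr.
  move: ha hb => /andP[ha1 ha2] /andP[hb1 hb2].
  rewrite /gn he ?in_itv/= -/(l n).
  - by congr `|_|; lra.
  - by apply/andP; split; lra.
  - by apply/andP; split; lra.
(* An ultrafilter yields limits at all times t at once, in place of a diagonal extraction. *)
have [F [FU ooF]] := ultraFilterLemma (_ : ProperFilter \oo).
have lim (t : R) : exists y : X, gn n t @[n --> F] --> y.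
  apply: (@ultra_compact_cvg _ X F (gn^~ t) _ FU (@hproper o (M + 2 + `|t|))).
  apply: ooF; near=> n; rewrite /=.
  have h1 : mdist o (gn n 0) <= M + 2 by near: n.
  have h2 : mdist (gn n 0) (gn n t) = `|0 - t| by near: n; exact: iso.
  have := metric_triangle o (gn n 0) (gn n t).
  by rewrite h2 sub0r normrN; lra.
have {lim} /choice[g hg] := lim.
have gl : geodesic_line g.
  move=> a b; apply/eqP; rewrite eq_le; apply/andP; split;
    apply/ler_addgt0Pr => e e0.
  - have : F [set n | (mdist (g a) (gn n a) < e / 2 /\ mdist (g b) (gn n b) < e / 2)
        /\ mdist (gn n a) (gn n b) = `|a - b|].
      apply: filterI; last by apply: ooF; exact: iso.
      by apply: filterI; apply: cvg_mdist => //; rewrite divr_gt0.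
    move=> /filter_ex[n [[h1 h2] h3]].
    have := metric_triangle (g a) (gn n a) (g b).
    have := metric_triangle (gn n a) (gn n b) (g b).
    by rewrite (metric_sym (gn n b) (g b)); lra.
  - have : F [set n | (mdist (g a) (gn n a) < e / 2 /\ mdist (g b) (gn n b) < e / 2)
        /\ mdist (gn n a) (gn n b) = `|a - b|].
      apply: filterI; last by apply: ooF; exact: iso.
      by apply: filterI; apply: cvg_mdist => //; rewrite divr_gt0.
    move=> /filter_ex[n [[h1 h2] h3]].
    have := metric_triangle (gn n a) (g a) (gn n b).
    have := metric_triangle (g a) (g b) (gn n b).
    by rewrite (metric_sym (gn n a) (g a)); lra.
have approach t : F [set n | mdist (g t) (gn n t) < 1 /\ mdist o (gn n 0) <= M + 2].
  by apply: filterI; [exact: cvg_mdist | exact: ooF].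
(* The loss M + 8 is M + 2 for the distance from o to the segment, 1 for replacing g t by its
   approximation, and 5 for replacing Z by the sequence z. *)
have ends t Z (z : nat -> X) (L : nat -> R) : val Z z ->
    (\forall n \near \oo, mdist (gn n 0) (z n) = L n /\
      mdist (gn n t) (z n) = L n - `|t|) -> `|t| - (M + 8) <= gpb o (g t) Z.
  move=> Zz hz.
  have : F [set n | (mdist (g t) (gn n t) < 1 /\ mdist o (gn n 0) <= M + 2) /\
    (mdist (gn n 0) (gn n t) = `|0 - t| /\
    ((mdist (gn n 0) (z n) = L n /\ mdist (gn n t) (z n) = L n - `|t|) /\
     `|gpb o (g t) Z - gromov_product o (g t) (z n)| <= 5))].
    apply: filterI; first exact: approach.
    apply: filterI; first by apply: ooF; exact: iso.
    by apply: filterI; apply: ooF => //; exact: gpb_near.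
  move=> /filter_ex[n [[h1 h2] [h3 [[e1 e2] h7]]]].
  move: h3; rewrite sub0r normrN => h3.
  have := gromov_product_ray h2 h3 e1 e2.
  have := gromov_product_lip o (gn n t) (g t) (z n); rewrite (metric_sym (gn n t)).
  by move: h7; rewrite ler_norml => /andP[]; lra.
have endW t : 0 <= t -> t - (M + 8) <= gpb o (g t) W.
  move=> t0; have := ends t W v (fun n => l n - s n) Wv; rewrite ger0_norm//; apply.
  near=> n; have [h5 h6] : t <= s n /\ t <= l n - s n by near: n; exact: far.
  have [_ ge he] := hsg n; have /andP[sn0 sn1] := s0 n.
  split.
    have := he (s n + 0) (l n); rewrite !in_itv/= lexx mdist_ge0 addr0 sn0 sn1.
    move=> /(_ isT isT); rewrite /gn addr0 -/(l n) {1}/l ge => ->.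
    by rewrite distrC ger0_norm//; lra.
  have := he (s n + t) (l n); rewrite !in_itv/= lexx mdist_ge0 -/(l n).
  have -> : 0 <= s n + t <= l n by apply/andP; split; lra.
  move=> /(_ isT isT); rewrite /gn {1}/l ge => ->.
  by rewrite distrC ger0_norm//; lra.
have endV t : t <= 0 -> - t - (M + 8) <= gpb o (g t) V.
  move=> t0; have := ends t V u s Vu; rewrite ler0_norm//; apply.
  near=> n; have [h5 h6] : - t <= s n /\ - t <= l n - s n by near: n; exact: far.
  have [ge _ he] := hsg n; have /andP[sn0 sn1] := s0 n.
  split.
    have := he (s n + 0) 0; rewrite !in_itv/= lexx mdist_ge0 addr0 sn0 sn1.
    move=> /(_ isT isT); rewrite /gn addr0 ge => ->.
    by rewrite ger0_norm//; lra.
  have := he (s n + t) 0; rewrite !in_itv/= lexx mdist_ge0 -/(l n).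
  have -> : 0 <= s n + t <= l n by apply/andP; split; lra.
  move=> /(_ isT isT); rewrite /gn ge => ->.
  by rewrite ger0_norm//; lra.
exists g; split => //.
  move=> A /(nbhs_bd o)[r hr]; exists (- Num.max 0 (r + (M + 8))); split.
    exact: num_real.
  move=> t; rewrite ltrNr gt_max => /andP[t1 t2]; apply: hr => /=.
  by rewrite -gpb_ge//; have := endV t; lra.
move=> A /(nbhs_bd o)[r hr]; exists (Num.max 0 (r + (M + 8))); split.
  exact: num_real.
move=> t; rewrite gt_max => /andP[t1 t2]; apply: hr => /=.
by rewrite -gpb_ge//; have := endW t; lra.
Unshelve. all: by end_near. Qed.

End ProperSpace.

(** * Local finiteness of the orbit *)

Section LocallyFinite.
Context {R : realType} {X : metricType R}.
Hypotheses (hproper : proper_space X).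
Variable G : set (X -> X).
Hypotheses (hG : isometry_group G) (hdiscrete : discrete_group G).
Implicit Types (x y z : X) (g h : X -> X).

Let base x (n : nat) : set (X -> X) :=
  [set g | forall y, mdist x y <= n%:R -> mdist y (g y) < n.+1%:R^-1].

(** The sets [base x n] form a filter base converging to the identity uniformly on bounded sets,
    hence in the compact-open topology, so one of them lies in a neighbourhood isolating the
    identity in G. *)
Lemma discrete_near_id x : exists n : nat, forall g, G g ->
  (forall y, mdist x y <= n%:R -> mdist y (g y) < n.+1%:R^-1) -> g = id.
Proof.
have [G1 _ _ _] := hG; have [_ [V Vid VG]] := hdiscrete G1.
pose F := filter_from [set: nat] (base x).
have FF : Filter F.
  apply: filter_from_filter; first by exists 0%N.
  move=> i j _ _; exists (maxn i j) => // g hg; split => y hy.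
    apply: (lt_le_trans (hg y _)); first by rewrite (le_trans hy)// ler_nat leq_maxl.
    by rewrite lef_pV2 ?posrE ?ltr0n// ler_nat ltnS leq_maxl.
  apply: (lt_le_trans (hg y _)); first by rewrite (le_trans hy)// ler_nat leq_maxr.
  by rewrite lef_pV2 ?posrE ?ltr0n// ler_nat ltnS leq_maxr.
have Fid : {compact-open, F --> (id : X -> X)}.
  apply/compact_open_cvgP => K O cK oO; rewrite image_id => KO.
  have [r Kr] : exists r : nat, forall y, K y -> mdist x y <= r%:R.
    move/compact_near_coveringP: cK => /(_ nat \oo (fun n y => mdist x y <= n%:R) _)[].
      move=> y Ky; exists (ball y 1, [set n | mdist x y + 1 <= n%:R]).
        split; first exact: nbhsx_ballx.
        exact: nbhs_infty_ger.
      move=> [y' n] [/=]; rewrite ballEmdist/= => yy' hn.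
      by have := metric_triangle x y y'; lra.
    by move=> N _ hN; exists N => y Ky; apply: (hN N) => //=.
  have [e Ke] : exists e : nat, forall y, K y -> ball y e.+1%:R^-1 `<=` O.
    move/compact_near_coveringP: cK => /(_ nat \oo (fun n y => ball y n.+1%:R^-1 `<=` O) _)[].
      move=> y Ky; have := oO; rewrite openE => /(_ y (KO y Ky)).
      rewrite /interior -nbhs_ballE => -[e /= e0 he].
      exists (ball y (e / 2), [set n | n.+1%:R^-1 < e / 2]).
        split; first by apply: nbhsx_ballx; rewrite divr_gt0.
        have e20 : 0 < e / 2 by rewrite divr_gt0.
        exact: (near_infty_natSinv_lt (PosNum e20)).
      move=> [y' n] [/=]; rewrite !ballEmdist/= => yy' hn z /= y'z.
      have {}y'z := lt_trans y'z hn.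
      by apply: he; rewrite ballEmdist/=; have := metric_triangle y y' z; lra.
    by move=> N _ hN; exists N => y Ky; apply: (hN N) => //=.
  exists (maxn r e) => // g hg _ [y Ky <-]; apply: (Ke y Ky).
  rewrite ballEmdist/=; apply: (lt_le_trans (hg y _)).
    by rewrite (le_trans (Kr y Ky))// ler_nat leq_maxl.
  by rewrite lef_pV2 ?posrE ?ltr0n// ler_nat ltnS leq_maxr.
have [n _ hn] := Fid V Vid.
exists n => g Gg hg; have : (V `&` G) g by split => //; exact: hn.
by rewrite VG.
Qed.

(** An infinite S carries an ultrafilter containing all its cofinite subsets. Along it, elements of
    G converge pointwise by properness, and uniformly on balls because they are isometries. Two
    elements close to the limit on a large ball differ by an element of G close to the identity,
    hence coincide, so a singleton would belong to the ultrafilter. *)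
Lemma locally_finite x (r : R) : finite_set [set g | G g /\ mdist x (g x) <= r].
Proof.
set S := [set g | _]; apply: contrapT => infS.
pose F := [set A : set (X -> X) | finite_set (S `\` A)].
have PF : ProperFilter F.
  split.
    by rewrite /F /= setD0.
  split.
  - by rewrite /F /= setDT.
  - move=> A B FA FB; rewrite /F /= setDIr; rewrite finite_setU; split; assumption.
  - move=> A B AB; apply: sub_finite_set; exact: setDS.
have [U [UU FU]] := ultraFilterLemma PF.
have US : U S by apply: FU; rewrite /F /= setDv.
have [n hn] := discrete_near_id x.
have [_ _ Ginv Giso] := hG.
have lim y : exists z : X, (g y) @[g --> U] --> z.
  apply: (@ultra_compact_cvg _ X U (fun g => g y) _ UU (@hproper x (r + mdist x y))).
  apply: filterS US => g [Gg gx] /=.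
  by have := metric_triangle x (g x) (g y); rewrite (Giso _ Gg); lra.
have {lim} /choice[f hf] := lim.
pose e : R := n.+1%:R^-1; have e0 : 0 < e by rewrite invr_gt0 ltr0n.
have flip y y' : mdist (f y) (f y') <= mdist y y'.
  apply/ler_addgt0Pr => d d0.
  have : U [set g | S g /\ mdist (f y) (g y) < d / 2 /\ mdist (f y') (g y') < d / 2].
    apply: filterI => //; apply: filterI; apply: cvg_mdist => //; by rewrite divr_gt0.
  move=> /filter_ex[g [[Gg _] [h1 h2]]].
  have := metric_triangle (f y) (g y) (f y'); have := metric_triangle (g y) (g y') (f y').
  by rewrite (Giso _ Gg) (metric_sym (g y') (f y')); lra.
have : \forall g \near U, [set y | mdist x y <= n%:R] `<=` (fun y => mdist (f y) (g y) < e / 2).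
  apply: (compact_near_coveringP _).1; first exact: hproper.
  move=> y _; exists (ball y (e / 6), [set g | S g /\ mdist (f y) (g y) < e / 6]).
    split; first by apply: nbhsx_ballx; rewrite divr_gt0.
    by apply: filterI => //; apply: cvg_mdist => //; rewrite divr_gt0.
  move=> [y' g] [/=]; rewrite ballEmdist/= => yy' [[Gg _] h].
  have := metric_triangle (f y') (f y) (g y'); have := metric_triangle (f y) (g y) (g y').
  by have := flip y' y; rewrite (Giso _ Gg) (metric_sym y' y); lra.
move=> /(filterI US); set A := S `&` _ => UA.
have [g [Sg hg]] := filter_ex UA.
have Ag : A `<=` [set g].
  move=> g' [[Gg' _] hg']; have [Gg _] := Sg.
  have [h [Gh gh hgK]] := Ginv g Gg; have [_ Gcomp _ _] := hG.
  have hg'1 : h \o g' = id.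
    apply: hn; first exact: Gcomp.
    move=> y yn; have -> : mdist y ((h \o g') y) = mdist (g y) (g' y).
      by rewrite -(Giso g Gg) /= hgK.
    have := hg y yn; have := hg' y yn.
    have := metric_triangle (g y) (f y) (g' y); rewrite (metric_sym (g y) (f y)) -/e; lra.
  apply/funext => y; have := congr1 (fun k => g (k y)) hg'1.
  by rewrite /= hgK.
have : U (~` A).
  apply: FU; rewrite /F /= setDE setCK; apply: sub_finite_set (finite_set1 g).
  by move=> k [_ /Ag].
by move=> /(filterI UA); rewrite setICr => /filter_not_empty.
Qed.

End LocallyFinite.

(** * Convex cocompactness and quasi-convexity of the orbit *)

Lemma compact_bounded_dist {R : realType} {X : metricType R} (K : set X) (x : X) :
  compact K -> exists r : R, forall y, K y -> mdist x y <= r.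
Proof.
move/compact_near_coveringP => /(_ nat \oo (fun n y => mdist x y <= n%:R) _)[].
  move=> y Ky; exists (ball y 1, [set n | mdist x y + 1 <= n%:R]).
    split; first exact: nbhsx_ballx.
    exact: nbhs_infty_ger.
  move=> [y' n] [/=]; rewrite ballEmdist/= => yy' hn.
  by have := metric_triangle x y y'; lra.
by move=> N _ hN; exists N%:R => y Ky; apply: (hN N) => //=.
Qed.

(* A coarse form of the convexity of the union of the geodesics between points
   of the orbit of [x]. *)
Definition quasi_convex_orbit {R : realType} {X : metricType R} (G : set (X -> X))
    (x : X) (D : R) := forall g t, G g -> 0 <= t <= mdist x (g x) ->
  exists g', [/\ G g', `|mdist x (g' x) - t| <= D &
                 mdist (g' x) (g x) <= mdist x (g x) - t + D].

(** A description of the limit set by real-valued products from x alone; [limit_setP] identifies it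
    with the closure of the orbit of any other point [o]. *)
Definition lims {R : realType} {X : metricType R} (G : set (X -> X)) (x : X)
    (V : gboundary X) := forall r : R, exists2 g, G g & r <= gpb x (g x) V.

Section ConvexCocompact.
Context {R : realType} {X : metricType R}.
Hypotheses (hproper : proper_space X) (hcat : cat_minus1 X).
Variables (G : set (X -> X)) (o x : X).
Hypotheses (hG : isometry_group G) (hnonel : nonelementary G o)
  (hcc : convex_cocompact G o).
Implicit Types (y z : X) (V W : gboundary X) (r : R).

Let h4 : four_point_condition X := four_point hcat.

Lemma limit_setP V : limit_set G o (Bd V) <-> lims G x V.
Proof.
have [_ _ _ Giso] := hG.
have base (y z : X) (r : R) g : G g -> r <= gpb y (g y) V ->
    r - 10 - 2 * mdist y z <= gpb z (g z) V.
  move=> Gg; rewrite !gpb_ge// => /(gprod_base h4 z)/(gprod_lip h4 (g z)).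
  by apply: le_trans; rewrite lee_fin Giso//; lra.
split => [[Vcl _] r|Vl].
  have [_ [[_ [g Gg <-] <-]]] := Vcl _ (nbhs_gprod h4 o V (r + 10 + 2 * mdist o x)).
  rewrite /= -gpb_ge// => h; exists g => //.
  by have := base _ x _ _ Gg h; lra.
split; last by exists V.
move=> A /(nbhs_bd o)[r hr]; have [g Gg h] := Vl (r + 10 + 2 * mdist x o).
exists (Pt (g o)); split; first by exists (g o) => //; exists g.
by apply: hr => /=; rewrite -gpb_ge//; have := base _ o _ _ Gg h; lra.
Qed.

Lemma three_limit_points : exists a b c : gboundary X,
  [/\ lims G x a, lims G x b & lims G x c] /\ [/\ a <> b, b <> c & a <> c].
Proof.
have ex p q : exists V, lims G x V /\ Bd V <> p /\ Bd V <> q.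
  apply: contrapT => h; apply: hnonel; exists p, q => v Lv.
  have [_ [V _ e]] := Lv; subst v; move/limit_setP: Lv => Vl.
  apply: contrapT => /= /not_orP[h1 h2].
  by apply: h; exists V.
have [a [la _]] := ex (Pt x) (Pt x); have [b [lb [ab _]]] := ex (Bd a) (Bd a).
have [c [lc [ac bc]]] := ex (Bd a) (Bd b).
by exists a, b, c; split => //; split => e; [apply: ab | apply: bc | apply: ac]; rewrite e.
Qed.

Lemma convex_hull_near_orbit : exists D : R, 0 <= D /\ forall y,
  convex_hull (limit_set G o) y -> exists2 g, G g & mdist y (g x) <= D.
Proof.
have [K cK KE] := hcc; have [r hr] := compact_bounded_dist x cK.
have [_ _ _ Giso] := hG.
exists (Num.max 0 r); split; first by rewrite le_max lexx.
move=> y; rewrite KE => -[g Gg [k Kk <-]]; exists g => //.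
by rewrite Giso// metric_sym le_max hr// orbT.
Qed.

Lemma geodesic_hull_sub : geodesic_hull (limit_set G o) `<=` convex_hull (limit_set G o).
Proof. exact: sub_smallest. Qed.

Lemma geodesically_convex_hull : geodesically_convex (convex_hull (limit_set G o)).
Proof.
move=> p q g hp hq gpq y gy A [cA sA]; apply: (cA p q g) => //.
  by apply: hp.
by apply: hq.
Qed.

Lemma convex_hull_inv g y : G g -> convex_hull (limit_set G o) y ->
  convex_hull (limit_set G o) (g y).
Proof.
have [K cK ->] := hcc; have [_ Gc _ _] := hG.
by move=> Gg [h Gh [k Kk <-]]; exists (g \o h); [exact: Gc | exists k].
Qed.

Lemma convex_hull_nonempty : convex_hull (limit_set G o) !=set0.
Proof.
have [a [b [_ [[la lb _] [ab _ _]]]]] := three_limit_points.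
have [g [gl ga gb]] := geodesic_line_ex hproper hcat x ab.
exists (g 0); apply: geodesic_hull_sub; exists g; split => //.
by exists (Bd a), (Bd b); split => //; exact/limit_setP.
Qed.

(** The hull contains some z together with g z, hence the segment between them, and it stays near
    the orbit. Replacing z by x costs multiples of d(x, z). *)
Lemma quasi_convex_orbit_ex : exists D : R, [/\ 0 <= D, quasi_convex_orbit G x D &
  forall y, geodesic_hull (limit_set G o) y -> exists2 g, G g & mdist y (g x) <= D].
Proof.
have [_ _ _ Giso] := hG.
have [D0 [D00 hD0]] := convex_hull_near_orbit.
have [z zC] := convex_hull_nonempty; have [gX _] := hcat.
have xz0 := mdist_ge0 x z.
exists (3 * mdist x z + D0); split; first lra; last first.
  move=> y /geodesic_hull_sub/hD0[g Gg h]; exists g => //; lra.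
move=> g t Gg /andP[t0 tl]; pose l := mdist z (g z).
have [s [s0 s1 s2]] := gX z (g z); rewrite -/l in s1 s2.
have l0 : 0 <= l by exact: mdist_ge0.
(* The segment from z to g z may be shorter than t, by at most 2 d(x, z). *)
pose t' := Num.min t l.
have t'0 : 0 <= t' by rewrite le_min t0 l0.
have t'l : t' <= l by rewrite ge_min lexx orbT.
have [|g' Gg' h] := hD0 (s t').
  apply: (geodesically_convex_hull zC (convex_hull_inv Gg zC)).
    by split; [exact: s0 | exact: s1 | exact: s2].
  by exists t' => //=; rewrite in_itv/= t'0.
have e1 : mdist z (s t') = t'.
  by rewrite -{1}s0 s2 ?in_itv/= ?lexx ?t'0 ?t'l// distrC subr0 ger0_norm.
have e2 : mdist (s t') (g z) = l - t'.
  by rewrite -s1 s2 ?in_itv/= ?lexx ?l0 ?t'0 ?t'l// distrC ger0_norm// subr_ge0.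
have lx1 : l <= mdist x (g x) + 2 * mdist x z.
  have := metric_triangle z x (g z); have := metric_triangle x (g x) (g z).
  by rewrite Giso// (metric_sym z x) -/l; lra.
have lx2 : mdist x (g x) <= l + 2 * mdist x z.
  have := metric_triangle x z (g x); have := metric_triangle z (g z) (g x).
  by rewrite Giso// (metric_sym z x) -/l; lra.
have tt1 : t' <= t by rewrite ge_min lexx.
have tt2 : t - 2 * mdist x z <= t'.
  by rewrite le_min; apply/andP; split; lra.
have tt3 : l - t' <= mdist x (g x) - t + 2 * mdist x z.
  by have [tl'|tl'] := leP t l; rewrite /t' ?(min_l tl') ?(min_r (ltW tl')); lra.
exists g'; split => //.
- rewrite ler_norml; have := metric_triangle x z (g' x); have := metric_triangle z (s t') (g' x).
  have := metric_triangle z (g' x) (s t'); have := metric_triangle z x (g' x).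
  rewrite e1 (metric_sym (g' x)) (metric_sym z x) => *; apply/andP; split; lra.
- have := metric_triangle (g' x) (s t') (g x); have := metric_triangle (s t') (g z) (g x).
  rewrite e2 Giso// (metric_sym z x) (metric_sym (g' x) (s t')); lra.
Qed.

End ConvexCocompact.

(** * Branching of the orbit and a lower bound for the critical exponent *)

Lemma ler_sum_subseq {R : realType} (I : eqType) (F : I -> R) (s t : seq I) :
  (forall i, 0 <= F i) -> uniq s -> {subset s <= t} ->
  \sum_(i <- s) F i <= \sum_(i <- t) F i.
Proof.
move=> F0; elim: s t => [|a s IH] t /=; first by rewrite big_nil sumr_ge0.
move=> /andP[as_ us] st; have at_ : a \in t by rewrite st// mem_head.
rewrite big_cons (perm_big _ (perm_to_rem at_)) /= big_cons lerD2l; apply: IH => // b bs.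
have := st b; rewrite inE bs orbT => /(_ isT).
rewrite (perm_mem (perm_to_rem at_)) inE => /orP[/eqP e|//].
by move: as_; rewrite -e bs.
Qed.

Lemma expr_unbounded {R : realType} (B k : R) : 1 < k -> exists n, B <= k ^+ n.
Proof.
move=> k1; have [n _ /(_ n (leqnn n)) /= hn] := nbhs_infty_ger (B / (k - 1)).
exists n; have {hn} : B <= n%:R * (k - 1) by rewrite -ler_pdivrMr ?subr_gt0.
move=> /le_trans; apply; suff : 1 + n%:R * (k - 1) <= k ^+ n by lra.
elim: n => [|n IH]; first by rewrite expr0; lra.
rewrite exprS -natr1; have n0 : 0 <= n%:R :> R by rewrite ler0n.
have h := ler_wpM2l (le_trans ler01 (ltW k1)) IH; apply: le_trans h.
have : 0 <= n%:R * (k - 1) ^+ 2 by rewrite mulr_ge0// sqr_ge0.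
by move: (n%:R : R) => m; lra.
Qed.

Section OrbitGeometry.
Context {R : realType} {X : metricType R}.
Hypothesis h4 : four_point_condition X.
Variables (G : set (X -> X)) (x : X) (D : R).
Hypotheses (hG : isometry_group G) (D0 : 0 <= D) (hD : quasi_convex_orbit G x D).
Hypothesis hfin : forall r, finite_set [set g | G g /\ mdist x (g x) <= r].
Implicit Types (y z : X) (V W : gboundary X) (r s t : R) (g : X -> X).

Lemma gpb_gromov y z V r : r <= gromov_product x y z -> r <= gpb x z V ->
  r - 7 <= gpb x y V.
Proof.
have [u Vu] := end_ex V; have cy z' : seq_cvg (Pt z') (cst z') by exact: cvg_cst.
move=> h1; rewrite !gpb_ge// => /(@gprod_gt _ _ h4 x (Pt z) (Bd V) _ u _ (cy z) Vu) h2.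
apply: (@gprod_ge _ _ _ (Pt y) (Bd V) _ u _ (cy y) Vu).
apply: filterS h2 => n h2; have -> : r - 7 = r - 5 - 2 by lra.
by apply: (@h4 _ _ z) => //; lra.
Qed.

Lemma gromov_gpb y z V r : r <= gpb x y V -> r <= gpb x z V ->
  r - 7 <= gromov_product x y z.
Proof.
have [u Vu] := end_ex V; have cy z' : seq_cvg (Pt z') (cst z') by exact: cvg_cst.
rewrite !gpb_ge// => /(@gprod_gt _ _ h4 x (Pt y) (Bd V) _ u _ (cy y) Vu) h1
  /(@gprod_gt _ _ h4 x (Pt z) (Bd V) _ u _ (cy z) Vu) h2.
have [n [/= h3 h5]] := filter_ex (filterI h1 h2).
rewrite gromov_productC in h5; rewrite gromov_productC in h3.
have -> : r - 7 = r - 5 - 2 by lra.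
by apply: (@h4 _ _ (u n)); rewrite gromov_productC// gromov_productC.
Qed.

Lemma orbit_midpoint g t : G g -> 0 <= t <= mdist x (g x) ->
  exists g', [/\ G g', `|mdist x (g' x) - t| <= D,
    mdist (g' x) (g x) <= mdist x (g x) - t + D &
    t - D <= gromov_product x (g' x) (g x)].
Proof.
move=> Gg ht; have [g' [Gg' h1 h2]] := hD Gg ht; exists g'; split => //.
by rewrite /gromov_product; move: h1; rewrite ler_norml => /andP[]; lra.
Qed.

Lemma orbit_approx V t : 0 <= t ->
  (exists2 g, G g & t <= gpb x (g x) V) ->
  exists g, [/\ G g, `|mdist x (g x) - t| <= D & t - D - 7 <= gpb x (g x) V].
Proof.
move=> t0 [g0 Gg0 h]; have td := le_trans h (gpb_le x (g0 x) V).
have [|g [Gg h1 _ h2]] := @orbit_midpoint g0 t Gg0; first by rewrite t0.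
exists g; split => //; apply: (gpb_gromov h2); have := D0; lra.
Qed.

Lemma lims_bmap g V : G g -> lims G x V -> lims G x (bmap g V).
Proof.
have [_ Gc Ginv Giso] := hG => Gg Vl r.
have [h [Gh gh hg]] := Ginv g Gg.
have [k Gk hk] := Vl (r + 20 + mdist x (g x)); exists (g \o k); first exact: Gc.
have := gpb_iso h4 hg (Giso g Gg) x (k x) V; rewrite ler_norml => /andP[h1 _].
have h2 : r + 5 + mdist x (g x) <= gpb (g x) (g (k x)) (bmap g V) by lra.
move: h2; rewrite !gpb_ge// => /(gprod_base h4 x); apply: le_trans.
by rewrite lee_fin (metric_sym (g x)) /=; lra.
Qed.

Lemma gprod_iso_lt g V W r : G g -> ~ (r%:E <= gprod x (Bd V) (Bd W))%E ->
  ~ ((r + 5)%:E <= gprod (g x) (Bd (bmap g V)) (Bd (bmap g W)))%E.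
Proof.
have [_ Gc Ginv Giso] := hG => Gg hr; have [h [Gh gh hg]] := Ginv g Gg.
move=> /(gprod_iso h4 gh (Giso h Gh)); rewrite gh addrK.
rewrite -[gbar_map h (Bd (bmap g V))]/(Bd (bmap h (bmap g V))).
rewrite -[gbar_map h (Bd (bmap g W))]/(Bd (bmap h (bmap g W))).
by rewrite !(bmapK h4 gh hg (Giso g Gg)).
Qed.

(* V and W are the images by g of two of the three points. *)
Lemma branching (a b c : gboundary X) : lims G x a -> lims G x b -> lims G x c ->
  a <> b -> b <> c -> a <> c ->
  exists M : R, 0 <= M /\ forall g, G g -> exists V W,
    [/\ lims G x V, lims G x W, mdist x (g x) - M <= gpb x (g x) V,
     mdist x (g x) - M <= gpb x (g x) W &
     ~ ((mdist x (g x) + M)%:E <= gprod x (Bd V) (Bd W))%E].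
Proof.
move=> la lb lc ab bc ac.
have sep V W : V <> W -> exists M : R, ~ (M%:E <= gprod x (Bd V) (Bd W))%E.
  by move=> VW; apply/existsNP => h; apply/VW/(gprod_bd_eq h4 h).
have [M1 m1] := sep _ _ ab; have [M2 m2] := sep _ _ bc; have [M3 m3] := sep _ _ ac.
pose M := Num.max 0 (Num.max M1 (Num.max M2 M3)).
have M0 : 0 <= M by rewrite le_max lexx.
have weak V W r : r <= M -> ~ (r%:E <= gprod x (Bd V) (Bd W))%E ->
    ~ (M%:E <= gprod x (Bd V) (Bd W))%E.
  by move=> rM hr hM; apply: hr; apply: le_trans hM; rewrite lee_fin.
have {}m1 := weak _ _ M1 ltac:(by rewrite !le_max lexx !orbT) m1.
have {}m2 := weak _ _ M2 ltac:(by rewrite !le_max lexx !orbT) m2.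
have {}m3 := weak _ _ M3 ltac:(by rewrite !le_max lexx !orbT) m3.
exists (M + 22); split; first lra.
(* A point V is good when, seen from g x, its image is not in the direction of x; by [gpb_sum] its
   image is then seen from x behind g x. Two bad points would have a product of at least M (12 = 7 +
   5), so at least two of the three are good. *)
move=> g Gg; pose good V := gpb (g x) x (bmap g V) < M + 12.
have pair V W : lims G x V -> lims G x W -> good V -> good W ->
    ~ (M%:E <= gprod x (Bd V) (Bd W))%E -> exists V' W',
    [/\ lims G x V', lims G x W', mdist x (g x) - (M + 22) <= gpb x (g x) V',
     mdist x (g x) - (M + 22) <= gpb x (g x) W' &
     ~ ((mdist x (g x) + (M + 22))%:E <= gprod x (Bd V') (Bd W'))%E].
  move=> lV lW gV gW VW; exists (bmap g V), (bmap g W); split.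
  - exact: lims_bmap.
  - exact: lims_bmap.
  - by have := gpb_sum h4 x (g x) (bmap g V); move: gV; rewrite /good ler_norml => + /andP[]; lra.
  - by have := gpb_sum h4 x (g x) (bmap g W); move: gW; rewrite /good ler_norml => + /andP[]; lra.
  move=> /(gprod_base h4 (g x)) h; apply: (gprod_iso_lt Gg VW).
  by apply: le_trans h; rewrite lee_fin; lra.
have two V W : ~ (M%:E <= gprod x (Bd V) (Bd W))%E -> ~ good V -> good W.
  move=> VW /negP; rewrite /good -leNgt => gV; rewrite ltNge; apply/negP => gW.
  rewrite gpb_ge// gprodC in gV; rewrite gpb_ge// in gW.
  apply: (gprod_iso_lt Gg VW); have := gprod_four_point h4 gV gW.
  by apply: le_trans; rewrite lee_fin; lra.
have [ga|nga] := pselect (good a); last first.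
  exact: (pair b c lb lc (two a b m1 nga) (two a c m3 nga) m2).
have [gb|ngb] := pselect (good b); first exact: (pair a b).
exact: (pair a c la lc ga (two b c m2 ngb) m3).
Qed.

(** The two ends of [branching] separate at depth about d(x, g x). Orbit points T deeper on the way
    to each of them have disjoint shadows inside that of g, which embeds a binary tree in the
    orbit. *)
Lemma orbit_tree (a b c : gboundary X) : lims G x a -> lims G x b -> lims G x c ->
  a <> b -> b <> c -> a <> c ->
  exists T r : R, 0 < T /\ forall g, G g -> let Sh k := [set g' | G g' /\
    mdist x (k x) - r <= gromov_product x (g' x) (k x)] in
  [/\ Sh g g & exists g1 g2, [/\ G g1 /\ G g2, mdist x (g1 x) <= mdist x (g x) + T,
    mdist x (g2 x) <= mdist x (g x) + T,
    Sh g1 `<=` Sh g /\ Sh g2 `<=` Sh g & Sh g1 `&` Sh g2 = set0]].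
Proof.
move=> la lb lc ab bc ac; have [M [M0 hM]] := branching la lb lc ab bc ac.
pose r := M + 40; pose T := 2 * M + D + r + 40.
have D0' := D0.
exists (T + D), r; split; first by rewrite /T /r; lra.
move=> g Gg Sh; split.
  by split => //; rewrite /gromov_product mdistxx /r; lra.
have d0 := mdist_ge0 x (g x).
have [V [W [lV lW gV gW VW]]] := hM g Gg.
have t0 : 0 <= mdist x (g x) + T by rewrite /T /r; lra.
have [g1 [Gg1 d1 h1]] := orbit_approx t0 (lV _).
have [g2 [Gg2 d2 h2]] := orbit_approx t0 (lW _).
move: d1 d2; rewrite !ler_norml => /andP[d1 d1'] /andP[d2 d2'].
have near Z k : G k -> - D <= mdist x (k x) - (mdist x (g x) + T) ->
    mdist x (g x) + T - D - 7 <= gpb x (k x) Z -> forall k', Sh k k' ->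
    mdist x (g x) + T - D - r - 7 <= gpb x (k' x) Z.
  move=> Gk dk hk k' [Gk' hk'].
  by apply: (gpb_gromov (z := k x)); rewrite /r in hk' *; lra.
have sub Z k : G k -> - D <= mdist x (k x) - (mdist x (g x) + T) ->
    mdist x (g x) + T - D - 7 <= gpb x (k x) Z ->
    mdist x (g x) - M <= gpb x (g x) Z -> Sh k `<=` Sh g.
  move=> Gk dk hk hZ k' Sk'; have h := near Z k Gk dk hk k' Sk'.
  split; first by case: Sk'.
  have : mdist x (g x) - M - 7 <= gromov_product x (k' x) (g x).
    by apply: gromov_gpb hZ; rewrite /T in h; lra.
  by rewrite /r; lra.
exists g1, g2; split => //.
- lra.
- lra.
- by split; [apply: (sub V) | apply: (sub W)].
rewrite -subset0 => k [S1 S2]; apply: VW.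
have := near _ _ Gg1 d1 h1 k S1; have := near _ _ Gg2 d2 h2 k S2.
rewrite !gpb_ge// => e2; rewrite gprodC => e1.
by apply: le_trans (gprod_four_point h4 e1 e2); rewrite lee_fin /T; lra.
Qed.

(** Descending one level of the tree doubles the number of points and divides each term by at most
    exp(s T). For s < ln 2 / T the sums over successive levels grow geometrically. *)
Lemma exponent_lower_bound (a b c : gboundary X) : lims G x a -> lims G x b -> lims G x c ->
  a <> b -> b <> c -> a <> c ->
  exists s0 : R, 0 < s0 /\ forall s, 0 < s < s0 -> forall B : R, exists l : seq (X -> X),
    [/\ uniq l, {in l, forall g, G g} & B <= \sum_(g <- l) expR (- s * mdist x (g x))].
Proof.
move=> la lb lc ab bc ac; have [T [r [T0 hT]]] := orbit_tree la lb lc ab bc ac.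
exists (ln 2 / T); split; first by rewrite divr_gt0// ln_gt0// ltr1n.
move=> s /andP[s0 s1] B.
pose k := 2 * expR (- s * T).
have k1 : 1 < k.
  have -> : k = expR (ln 2 + - s * T) by rewrite expRD lnK ?posrE.
  by rewrite expR_gt1; move: s1; rewrite ltr_pdivlMr//; lra.
pose Sh g := [set g' | G g' /\ mdist x (g x) - r <= gromov_product x (g' x) (g x)].
have tree n g : G g -> exists l : seq (X -> X), [/\ uniq l, {in l, forall h, Sh g h} &
    expR (- s * mdist x (g x)) * k ^+ n <= \sum_(h <- l) expR (- s * mdist x (h x))].
  elim: n g => [|n IH] g Gg; have [Sg [g1 [g2 [[Gg1 Gg2] d1 d2 [S1 S2] S12]]]] := hT g Gg.
    exists [:: g]; split => //; first by move=> h; rewrite inE => /eqP ->.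
    by rewrite big_seq1 expr0 mulr1.
  have [l1 [u1 l1S h1]] := IH g1 Gg1; have [l2 [u2 l2S h2]] := IH g2 Gg2.
  exists (l1 ++ l2); split.
  - rewrite cat_uniq u1 u2 andbT /=; apply/hasPn => h hl2; apply/negP => hl1.
    by have : (Sh g1 `&` Sh g2) h; [split; [exact: l1S | exact: l2S] | rewrite S12].
  - by move=> h; rewrite mem_cat => /orP[/l1S/S1|/l2S/S2].
  rewrite big_cat /=; apply: le_trans (lerD h1 h2).
  have e g' : mdist x (g' x) <= mdist x (g x) + T ->
      expR (- s * mdist x (g x)) * expR (- s * T) * k ^+ n <=
      expR (- s * mdist x (g' x)) * k ^+ n.
    move=> dg'; rewrite ler_wpM2r ?exprn_ge0//; first by rewrite (le_trans _ (ltW k1)).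
    by rewrite -expRD ler_expR; nra.
  rewrite exprS {1}/k; have := e _ d1; have := e _ d2; lra.
have [G1 _ _ _] := hG.
have [n hn] := expr_unbounded (B / expR (- s * mdist x x)) k1.
have [l [ul lS hl]] := tree n id G1; exists l; split => //.
  by move=> g /lS[].
by apply: le_trans hl; rewrite /= mulrC -ler_pdivrMr ?expR_gt0.
Qed.

End OrbitGeometry.

(** * Divergence of the orbit series at the critical exponent *)

Section Series.
Context {R : realType} {I : choiceType}.
Implicit Types (A : set I) (a : I -> R).

Definition unbounded_sums A a := forall B : R, exists l : seq I,
  [/\ uniq l, {in l, forall i, A i} & B <= \sum_(i <- l) a i].

Lemma unbounded_sums_esum A a : (forall i, 0 <= a i) -> unbounded_sums A a <->
  (\esum_(i in A) (a i)%:E = +oo)%E.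
Proof.
move=> a0; split => [h|h B].
  apply/eqyP => r r0; have [l [ul lA hl]] := h r; apply: esum_ge.
  exists [set` l]; first by split; [exact: finite_seq | move=> i /=; exact: lA].
  by rewrite -fsbig_seq// sumEFin lee_fin.
have : (B%:E < \esum_(i in A) (a i)%:E)%E by rewrite h ltry.
move=> /ereal_sup_gt[_ [S [/finite_seqP[l Sl] SA] <-]] hB.
exists (undup l); split; first exact: undup_uniq.
  by move=> i; rewrite mem_undup => il; apply: SA; rewrite Sl.
move: hB; have -> : S = [set` undup l].
  by rewrite Sl; apply/seteqP; split => i /=; rewrite mem_undup.
by rewrite -fsbig_seq ?undup_uniq// sumEFin lte_fin => /ltW.
Qed.

Lemma seq_bounded (l : seq I) a : exists N : R, forall i, i \in l -> a i <= N.
Proof.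
elim: l => [|i l [N hN]]; first by exists 0.
exists (Num.max (a i) N) => j; rewrite inE le_max => /orP[/eqP ->|/hN ->].
  by rewrite lexx.
by rewrite orbT.
Qed.

(** A finite sum within e of the supremum leaves at most e for the other indices; N bounds [d] on
    the finitely many indices of that sum. *)
Lemma small_tails A a (d : I -> R) (B e : R) : (forall i, 0 <= a i) -> 0 < e ->
  (forall l, uniq l -> {in l, forall i, A i} -> \sum_(i <- l) a i <= B) ->
  exists N : R, forall l, uniq l -> {in l, forall i, A i /\ N < d i} ->
    \sum_(i <- l) a i <= e.
Proof.
move=> a0 e0 hB.
pose S := [set y : R | exists l, [/\ uniq l, {in l, forall i, A i} & y = \sum_(i <- l) a i]].
have hS : has_sup S.
  split; first by exists 0; exists [::]; split => //; rewrite big_nil.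
  by exists B => _ [l [ul lA ->]]; exact: hB.
have [_ [l0 [ul0 l0A ->]] hl0] := sup_adherent e0 hS.
have [N hN] := seq_bounded l0 d; exists N => l ul lA.
have : \sum_(i <- l0 ++ l) a i <= sup S.
  apply: sup_upper_bound => //; exists (l0 ++ l); split => //.
    rewrite cat_uniq ul0 ul andbT; apply/hasPn => i il; apply/negP => /hN.
    by rewrite leNgt (lA i il).2.
  by move=> i; rewrite mem_cat => /orP[/l0A//|/lA[]].
by rewrite big_cat /=; lra.
Qed.

End Series.

Section Divergence.
Context {R : realType} {X : metricType R}.
Variables (G : set (X -> X)) (x : X) (D : R).
Hypotheses (hG : isometry_group G) (D0 : 0 <= D) (hD : quasi_convex_orbit G x D).
Hypothesis hfin : forall r, finite_set [set g | G g /\ mdist x (g x) <= r].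
Implicit Types (s t : R) (g : X -> X).

Let d g : R := mdist x (g x).

Lemma orbit_enum (r : R) : exists l : seq (X -> X), uniq l /\
  forall g, (g \in l) <-> G g /\ d g <= r.
Proof.
have /finite_seqP[l El] := hfin r; exists (undup l); split; first exact: undup_uniq.
move=> g; rewrite mem_undup; have -> : (g \in l) = [set` l] g :> Prop by [].
by rewrite -El.
Qed.

(* If the orbit series converged at [alpha], so would it at some s < alpha: its
   annuli would have small sums, and cutting a segment of the orbit at the
   distance of an annulus bounds the sum over a ball by half of itself plus a
   constant. *)
Lemma divergence (alpha : R) : 0 < alpha ->
  (forall s, 0 < s < alpha -> unbounded_sums G (fun g => expR (- s * d g))) ->
  unbounded_sums G (fun g => expR (- alpha * d g)).
Proof.
move=> al0 hs; have D0' := D0; apply: contrapT => /existsNP[B hB].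
have {}hB l : uniq l -> {in l, forall g, G g} -> \sum_(g <- l) expR (- alpha * d g) <= B.
  by move=> ul lG; rewrite leNgt; apply/negP => h; apply: hB; exists l; split => //; exact: ltW.
(* The exponential compensates the error of cutting a segment, and the 4 leaves 1/2 after a factor 2
   for the change of exponent. *)
have e0 : 0 < expR (- 2 * alpha * D) / 4 by rewrite divr_gt0// expR_gt0.
have [N hN] := small_tails d (fun g => expR_ge0 (- alpha * d g)) e0 hB.
pose m := Num.max (N + D + 1) D.
have mD : D <= m by rewrite le_max lexx orbT.
have mN : N + D + 1 <= m by rewrite le_max lexx.
have [lb [ulb lbE]] := orbit_enum (m + D).
pose lm := [seq g <- lb | m - D <= d g].
have ulm : uniq lm by rewrite filter_uniq.
have lmP g : g \in lm <-> [/\ G g, m - D <= d g & d g <= m + D].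
  rewrite mem_filter; split => [/andP[h /lbE[]]//|[h1 h2 h3]].
  by rewrite h2; apply/lbE.
(* The first bound keeps s = alpha - eta positive; the second makes exp(eta d) at most 2 on the
   annulus, so replacing alpha by s there at most doubles the sum. *)
pose eta := Num.min (alpha / 2) (ln 2 / (m + D + 1)).
have l2 : 0 < ln 2 :> R by rewrite ln_gt0// ltr1n.
have mD1 : 0 < m + D + 1 by lra.
have eta0 : 0 < eta by rewrite lt_min !divr_gt0.
have eta1 : eta <= alpha / 2 by rewrite ge_min lexx.
have eta2 : eta * (m + D + 1) <= ln 2 by rewrite -ler_pdivlMr// ge_min lexx orbT.
pose s := alpha - eta.
have s0 : 0 < s by rewrite /s; lra.
have sa : s < alpha by rewrite /s; lra.
have hlm : expR (2 * s * D) * \sum_(g <- lm) expR (- s * d g) <= 1 / 2.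
  have h1 : \sum_(g <- lm) expR (- s * d g) <= 2 * \sum_(g <- lm) expR (- alpha * d g).
    rewrite mulr_sumr big_seq [leRHS]big_seq; apply: ler_sum => g /lmP[Gg g1 g2].
    have -> : - s * d g = eta * d g + - alpha * d g by rewrite /s; lra.
    rewrite expRD ler_wpM2r ?expR_ge0// -[leRHS]lnK ?posrE// ler_expR.
    by apply: le_trans eta2; rewrite ler_wpM2l ?(ltW eta0)//; lra.
  have h2 : \sum_(g <- lm) expR (- alpha * d g) <= expR (- 2 * alpha * D) / 4.
    by apply: hN => // g /lmP[Gg g1 g2]; split => //; lra.
  have h3 : expR (2 * s * D) * expR (- 2 * alpha * D) <= 1.
    rewrite -expRD expR_le1; have : 0 <= eta * D by rewrite mulr_ge0 ?(ltW eta0).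
    by rewrite /s; lra.
  apply: (@le_trans _ _ (expR (2 * s * D) * (2 * (expR (- 2 * alpha * D) / 4)))).
    by rewrite ler_wpM2l ?expR_ge0//; lra.
  by move: h3; move: (expR (2 * s * D)) (expR _) => u v; lra.
have [_ _ Ginv Giso] := hG; have [_ Gc _ _] := hG.
(* Cutting at distance m factors g as p.1 \o p.2 with p.1 in the annulus. The pair determines g, so
   the sum over the far g is bounded by the product of the sums over the two factors. *)
have /choice[phi hphi] : forall g, exists p : (X -> X) * (X -> X), G g -> m <= d g ->
    [/\ p.1 \in lm, G p.2, d p.2 <= d g - m + D, g = p.1 \o p.2 &
        d p.1 + d p.2 - 2 * D <= d g].
  move=> g; have [[Gg mg]|h] := pselect (G g /\ m <= d g); last first.
    by exists (id, id) => Gg mg; case: h.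
  have [|g1 [Gg1 h1 h2]] := hD Gg (t := m); first by rewrite mg andbT; lra.
  have [k [Gk g1k kg1]] := Ginv g1 Gg1.
  have dk : d (k \o g) = mdist (g1 x) (g x) by rewrite /d -(Giso g1 Gg1) /= kg1.
  move: h1; rewrite ler_norml => /andP[h1 h3].
  exists (g1, k \o g) => _ _ /=; rewrite dk; split => //.
  - by apply/lmP; split => //; rewrite /d; lra.
  - exact: Gc.
  - by apply/funext => y /=; rewrite kg1.
  - by rewrite /d in mg *; lra.
have ball_sum (M : R) lM : m + D <= M -> uniq lM ->
    (forall g, (g \in lM) <-> G g /\ d g <= M) ->
    \sum_(g <- lM) expR (- s * d g) <= 2 * \sum_(g <- lb) expR (- s * d g).
  move=> mM ulM lMP.
  rewrite (bigID (fun g => d g <= m + D)) /=.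
  have h1 : \sum_(g <- lM | d g <= m + D) expR (- s * d g) <= \sum_(g <- lb) expR (- s * d g).
    rewrite -big_filter; apply: ler_sum_subseq => [g||g].
    - exact: expR_ge0.
    - by rewrite filter_uniq.
    - by rewrite mem_filter => /andP[h /lMP[Gg _]]; apply/lbE.
  pose F (p : (X -> X) * (X -> X)) : R := expR (- s * d p.1) * expR (- s * d p.2).
  pose l' := [seq g <- lM | ~~ (d g <= m + D)].
  have l'P g : g \in l' -> [/\ G g, m <= d g & d g <= M].
    by rewrite mem_filter -ltNge => /andP[h /lMP[Gg hM]]; split => //; lra.
  have h2 : \sum_(g <- lM | ~~ (d g <= m + D)) expR (- s * d g) <=
      expR (2 * s * D) * \sum_(g <- l') F (phi g).
    rewrite -big_filter -/l' mulr_sumr big_seq [leRHS]big_seq; apply: ler_sum => g /l'P[Gg mg _].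
    have [_ _ _ _ h] := hphi g Gg mg.
    by rewrite /F -!expRD ler_expR; have := ler_wpM2l (ltW s0) h; lra.
  have h3 : \sum_(g <- l') F (phi g) <=
      (\sum_(g <- lm) expR (- s * d g)) * \sum_(g <- lM) expR (- s * d g).
    rewrite -[leLHS](big_map phi xpredT).
    apply: (@le_trans _ _ (\sum_(p <- [seq (g1, g2) | g1 <- lm, g2 <- lM]) F p)).
      apply: ler_sum_subseq.
      - by move=> p; rewrite mulr_ge0 ?expR_ge0.
      - rewrite map_inj_in_uniq ?filter_uniq// => g g' /l'P[Gg mg _] /l'P[Gg' mg' _] e.
        have [_ _ _ -> _] := hphi g Gg mg; have [_ _ _ -> _] := hphi g' Gg' mg'.
        by rewrite e.
      move=> _ /mapP[g /l'P[Gg mg gM] ->]; have [p1 p2 p3 _ _] := hphi g Gg mg.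
      apply/allpairsP; exists (phi g); split => //; last by case: (phi g).
      by apply/lMP; split => //; lra.
    rewrite big_allpairs /F /= mulr_suml; apply: ler_sum => g _.
    by rewrite mulr_sumr.
  have h5 : \sum_(g <- lM | ~~ (d g <= m + D)) expR (- s * d g) <=
      1 / 2 * \sum_(g <- lM) expR (- s * d g).
    apply: (le_trans h2); apply: (le_trans (ler_wpM2l (expR_ge0 _) h3)).
    by rewrite mulrA ler_wpM2r// sumr_ge0// => g _; exact: expR_ge0.
  move: h5; rewrite [X in _ <= _ * X](bigID (fun g => d g <= m + D)) /=; lra.
have [|l [ul lG]] := hs s _ (2 * \sum_(g <- lb) expR (- s * d g) + 1); first by rewrite s0.
have [M0 hM0] := seq_bounded l d; pose M := Num.max M0 (m + D).
have [lM [ulM lMP]] := orbit_enum M.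
have := ball_sum M lM; rewrite {1}/M le_max lexx orbT => /(_ isT ulM lMP).
have : \sum_(g <- l) expR (- s * d g) <= \sum_(g <- lM) expR (- s * d g).
  apply: ler_sum_subseq => // g gl.
  by apply/lMP; split; [exact: lG | rewrite le_max hM0].
by lra.
Qed.

End Divergence.

Section CriticalExponent.
Context {R : realType} {X : metricType R}.
Hypotheses (hproper : proper_space X) (hcat : cat_minus1 X).
Variables (G : set (X -> X)) (o : X) (alpha : R).
Hypotheses (hG : isometry_group G) (hdiscrete : discrete_group G)
  (hnonel : nonelementary G o) (hcc : convex_cocompact G o)
  (halpha : critical_exponent G o = alpha%:E).

Let h4 : four_point_condition X := four_point hcat.

Lemma critical_exponent_gt0 : 0 < alpha.
Proof.
have [D [D0 hD _]] := quasi_convex_orbit_ex hproper hcat o hG hnonel hcc.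
have [a [b [c [[la lb lc] [ab bc ac]]]]] := three_limit_points hcat o hG hnonel.
have [s0 [s00 hs0]] := exponent_lower_bound h4 hG D0 hD la lb lc ab bc ac.
rewrite (lt_le_trans s00)// leNgt; apply/negP => as0.
have : (critical_exponent G o < s0%:E)%E by rewrite halpha lte_fin.
move=> /ereal_inf_lt[_ [s [sgt0 hs] <-]]; rewrite lte_fin => ss0.
have /unbounded_sums_esum : unbounded_sums G (fun g => expR (- s * mdist o (g o))).
  by apply: hs0; rewrite sgt0.
move=> /(_ (fun g => expR_ge0 _)) e.
by move: hs; under eq_esum do rewrite metric_sym; rewrite e ltxx.
Qed.

Lemma critical_divergence x : unbounded_sums G (fun g => expR (- alpha * mdist x (g x))).
Proof.
have al0 := critical_exponent_gt0.
have [D [D0 hD _]] := quasi_convex_orbit_ex hproper hcat x hG hnonel hcc.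
have fin := locally_finite hproper hG hdiscrete x.
apply: (divergence hG D0 hD fin al0) => s /andP[s0 sa].
have : unbounded_sums G (fun g => expR (- s * mdist o (g o))).
  apply/unbounded_sums_esum; first by move=> g; exact: expR_ge0.
  apply/eqP; rewrite -leye_eq leNgt; apply/negP => h.
  suff : (critical_exponent G o <= s%:E)%E by rewrite halpha lee_fin leNgt sa.
  apply: ereal_inf_lbound; exists s => //; split => //.
  by under eq_esum do rewrite metric_sym.
move=> hu B; have [l [ul lG hl]] := hu (expR (2 * s * mdist o x) * B).
exists l; split => //.
rewrite -(ler_pM2l (expR_gt0 (2 * s * mdist o x))); apply: (le_trans hl).
rewrite mulr_sumr big_seq [leRHS]big_seq; apply: ler_sum => g /lG Gg.
rewrite -expRD ler_expR; have [_ _ _ Giso] := hG.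
have : mdist x (g x) <= mdist o (g o) + 2 * mdist o x.
  have := metric_triangle x o (g x); have := metric_triangle o (g o) (g x).
  by rewrite Giso// (metric_sym x o); lra.
by move=> h; have := ler_wpM2l (ltW s0) h; lra.
Qed.

End CriticalExponent.

(** * Conformal densities under a change of base point *)

Lemma negligible_bigcup_countable d (T : measurableType d) (R : realType)
    (m : {measure set T -> \bar R}) (I : Type) (D : set I) (F : I -> set T) :
  countable D -> (forall i, D i -> m.-negligible (F i)) ->
  m.-negligible (\bigcup_(i in D) F i).
Proof.
move=> /countable_injP[f finj] h.
apply: (@negligibleS _ _ _ _ (\bigcup_n \bigcup_(i in [set i | D i /\ f i = n]) F i)).
  by move=> y [i Di Fi]; exists (f i) => //; exists i.
apply: negligible_bigcup => n.
have [[i [Di fi]]|hn] := pselect (exists i, D i /\ f i = n).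
  apply: negligibleS (h i Di) => y [j [Dj fj] Fj].
  by have -> : i = j by apply: finj; rewrite ?inE//; exact: etrans fi (esym fj).
apply: negligibleS (negligible_set0 m) => y [j hj Fj].
by apply: hn; exists j.
Qed.

Lemma measurable_abs_fine d (T : measurableType d) (R : realType) (f : T -> \bar R) :
  measurable_fun setT f -> measurable_fun setT (fun v => `|fine (f v)|).
Proof. by move=> mf; do 2 apply: measurableT_comp => //. Qed.

Section Density.
Local Open Scope charge_scope.
Context {R : realType} {X : pointedMetricType R}.
Variables (G : set (X -> X)) (alpha : R)
  (mu : X -> {finite_measure set (gborel X) -> \bar R}).
Hypothesis hmu : conformal_density G alpha mu.
Implicit Types (x y : X) (A : set (gborel X)).

(** The exponential of the Busemann function equals the derivative only almost everywhere. Here [r]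
    is a measurable version of it, made real by [fine] and nonnegative everywhere by the absolute
    value. *)
Lemma density_ex x y : exists r : gborel X -> R, [/\ measurable_fun setT r,
  (forall v, 0 <= r v),
  {ae mu x, forall v, r v = expR (alpha * busemann v x y)} &
  forall A, measurable A -> mu y A = (\int[mu x]_(v in A) (r v)%:E)%E].
Proof.
have [dom RN _] := hmu.
pose f : gborel X -> \bar R := 'd (charge_of_finite_measure (mu y)) '/d (mu x).
have domc : charge_of_finite_measure (mu y) `<< mu x := dom x y.
have mf := measurable_int _ (Radon_Nikodym_integrable domc); rewrite -/f in mf.
have hf := RN x y; rewrite -/f in hf.
pose r v : R := `|fine (f v)|.
have mr : measurable_fun setT (r : gborel X -> R).
  exact: measurable_abs_fine mf.
exists r; split.
- exact: mr.
- by move=> v; exact: normr_ge0.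
- by apply: filterS hf => v /(_ I) e; rewrite /r e /= ger0_norm// expR_ge0.
move=> A mA; have -> : mu y A = charge_of_finite_measure (mu y) A by [].
rewrite (Radon_Nikodym_integral domc mA) -/f; apply: ae_eq_integral => //.
- exact: measurable_funS mf.
- apply/measurable_EFinP; apply: (@measurable_funS _ _ _ _ setT) => //; exact: mr.
by apply: filterS hf => v /(_ I) e _; rewrite /r e /= ger0_norm// expR_ge0.
Qed.

Lemma mu_ge x y A (m : R) : 0 <= alpha -> measurable A ->
  (forall v, A v -> m <= busemann v x y) ->
  ((expR (alpha * m))%:E * mu x A <= mu y A)%E.
Proof.
move=> al0 mA hA; have [r [mr r0 re rI]] := density_ex x y.
rewrite rI// -integral_cst//; apply: ae_ge0_le_integral => //.
- by move=> v _; rewrite lee_fin expR_ge0.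
- by move=> v _; rewrite lee_fin.
- by apply/measurable_EFinP; exact: measurable_funS mr.
by apply: filterS re => v -> /hA h; rewrite lee_fin ler_expR ler_wpM2l.
Qed.

Lemma mu_le x y A (m : R) : 0 <= alpha -> measurable A ->
  (forall v, A v -> busemann v x y <= m) ->
  (mu y A <= (expR (alpha * m))%:E * mu x A)%E.
Proof.
move=> al0 mA hA; have [r [mr r0 re rI]] := density_ex x y.
rewrite rI// -integral_cst//; apply: ae_ge0_le_integral => //.
- by move=> v _; rewrite lee_fin.
- by apply/measurable_EFinP; exact: measurable_funS mr.
- by move=> v _; rewrite lee_fin expR_ge0.
by apply: filterS re => v -> /hA h; rewrite lee_fin ler_expR ler_wpM2l.
Qed.

End Density.

(** * The boundary mass lies on the limit set *)

Section SupportOnLimitSet.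
Context {R : realType} {X : pointedMetricType R}.
Hypothesis h4 : four_point_condition X.
Variables (G : set (X -> X)) (alpha : R)
  (mu : X -> {finite_measure set (gborel X) -> \bar R}) (x : X) (D : R).
Hypotheses (hmu : conformal_density G alpha mu) (al0 : 0 < alpha).
Hypotheses (hG : isometry_group G) (D0 : 0 <= D) (hD : quasi_convex_orbit G x D).
Hypothesis hfin : forall r, finite_set [set g | G g /\ mdist x (g x) <= r].
Hypothesis hdiv : unbounded_sums G (fun g => expR (- alpha * mdist x (g x))).
Implicit Types (y z : X) (A : set (gborel X)) (g h : X -> X) (V W : gboundary X).

Let d g : R := mdist x (g x).

Lemma countable_group : countable G.
Proof.
have -> : G = \bigcup_n [set g | G g /\ mdist x (g x) <= n%:R].
  apply/seteqP; split => [g Gg|g [n _ []]//].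
  have [n _ /(_ n (leqnn n)) /= hn] := nbhs_infty_ger (mdist x (g x)).
  by exists n.
by apply: bigcup_countable => // n _; exact: finite_set_countable.
Qed.

Lemma measurable_bdcl (A : set (gboundary X)) : measurable (bdcl A : set (gborel X)).
Proof.
rewrite -[bdcl A]setCK; apply: measurableC; apply: sub_sigma_algebra.
exact/closed_openC/closed_closure.
Qed.

Lemma measurable_bdry : measurable (bdry X : set (gborel X)).
Proof.
rewrite -[bdry X]setCK; apply: measurableC; apply: sub_sigma_algebra.
exact/closed_openC/closed_bdry.
Qed.

Lemma measurable_gbar_map g : G g ->
  measurable_fun setT (gbar_map g : gborel X -> gborel X).
Proof.
have [_ _ Ginv Giso] := hG => Gg; have [h [Gh gh hg]] := Ginv g Gg.
have := @measurability _ _ (gborel X) (gborel X) setT (gbar_map g) (@open (gbar X)) (erefl _); apply => _ [U oU <-]; rewrite setTI; apply: sub_sigma_algebra.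
by move/continuousP: (continuous_gbar_map h4 gh hg (Giso g Gg)); apply.
Qed.

Lemma measurable_preimage g A : G g -> measurable A ->
  measurable (gbar_map g @^-1` A : set (gborel X)).
Proof. by move=> Gg mA; rewrite -[_ @^-1` _]setTI; exact: measurable_gbar_map. Qed.

Lemma mu_preimage g A : G g -> measurable A -> mu x (gbar_map g @^-1` A) = mu (g x) A.
Proof. by have [_ _ hpush] := hmu => Gg mA; rewrite -hpush. Qed.

Lemma mu_preimage_ge g A (m : R) : G g -> measurable A -> A `<=` bdry X ->
  (forall V, A (Bd V) -> m <= gpb x (g x) V) ->
  ((expR (alpha * (2 * m - d g)))%:E * mu x A <= mu x (gbar_map g @^-1` A))%E.
Proof.
move=> Gg mA Ab hA; rewrite mu_preimage//; apply: (mu_ge hmu) => //; first exact: ltW.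
by move=> v Av; have [V _ e] := Ab v Av; subst v; rewrite busemannE; have := hA V Av; rewrite /d; lra.
Qed.

Lemma mu_preimage_le g A (m : R) : G g -> measurable A -> A `<=` bdry X ->
  (forall V, A (Bd V) -> gpb x (g x) V <= m) ->
  (mu x (gbar_map g @^-1` A) <= (expR (alpha * (2 * m - d g)))%:E * mu x A)%E.
Proof.
move=> Gg mA Ab hA; rewrite mu_preimage//; apply: (mu_le hmu) => //; first exact: ltW.
by move=> v Av; have [V _ e] := Ab v Av; subst v; rewrite busemannE; have := hA V Av; rewrite /d; lra.
Qed.

(** A coarse fundamental domain for the complement of the limit set: it meets boundedly many of its
    translates ([shallow_multiplicity]), and every boundary point outside the limit set can be moved
    into it ([not_lims_shallow]). *)
Definition shallow (c : R) : set (gboundary X) := [set V | forall g, G g -> gpb x (g x) V <= c].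

Lemma bdcl_shallow c V g : bdcl (shallow c) (Bd V) -> G g -> gpb x (g x) V <= c + 7.
Proof.
move=> h Gg; have : bdcl [set V | gpb x (g x) V <= c] (Bd V).
  by move: h; apply: closure_subset => _ [W hW <-]; exists W => //; exact: hW.
by move=> /(bdcl_gpb_le h4)[W hW [<-]].
Qed.

(** Let g0 V and g V be shallow. From x, the orbit point (g g0^-1)^-1 x has a small product with g0
    V; from that orbit point, x has a small product with it too. By [gpb_sum], g g0^-1 moves x by a
    bounded amount, leaving finitely many choices. *)
Lemma shallow_multiplicity c : exists N : nat, forall (l : seq (X -> X)) p,
  uniq l -> {in l, forall g, G g} ->
  (count (fun g => `[< bdcl (shallow c) (gbar_map g p) >]) l <= N)%N.
Proof.
have [_ Gc Ginv Giso] := hG.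
have [L [uL LP]] := orbit_enum hfin (2 * c + 40); exists (size L) => l p ul lG.
have [/hasP[g0 g0l /asboolP hg0]|/hasPn hl] :=
    boolP (has (fun g => `[< bdcl (shallow c) (gbar_map g p) >]) l); last first.
  by rewrite (@eq_in_count _ _ xpred0) ?count_pred0// => g /hl /negbTE.
have Gg0 := lG _ g0l; have [k0 [Gk0 gk0 kg0]] := Ginv _ Gg0.
have [U _ eU] := bdcl_bdry hg0.
case: p hg0 eU => [y|V] /= hg0 eU; first by [].
have {}hg0 : bdcl (shallow c) (Bd (bmap g0 V)) := hg0.
rewrite -size_filter -(size_map (fun g => g \o k0)); apply: uniq_leq_size.
  rewrite map_inj_uniq ?filter_uniq// => g g' e; apply/funext => y.
  by have := congr1 (fun f => f (g0 y)) e; rewrite /= gk0.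
move=> k' /mapP[g]; rewrite mem_filter => /andP[/asboolP hg gl] ->.
have Gg := lG _ gl; have {}hg : bdcl (shallow c) (Bd (bmap g V)) := hg.
apply/LP; split; first exact: Gc.
have [k [Gk gk kg]] := Ginv _ (Gc _ _ Gg Gk0).
have e1 := bdcl_shallow hg0 Gk.
have e2 := bdcl_shallow hg (Gc _ _ Gg Gk0).
have e3 : bmap g V = bmap (g \o k0) (bmap g0 V).
  have [u Vu] := end_ex V.
  have s1 := bmap_seq h4 kg (Giso _ (Gc _ _ Gg Gk0)) (bmap_seq h4 kg0 (Giso _ Gg0) Vu).
  have [h [Gh gh hg']] := Ginv _ Gg.
  have s2 := bmap_seq h4 hg' (Giso _ Gg) Vu.
  have e : (g \o k0) \o (g0 \o u) = g \o u by apply/funext => n /=; rewrite gk0.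
  rewrite e in s1; apply: (end_eq h4 s2 s1); exact: (end_same h4 s2 s2).
have := gpb_iso h4 kg (Giso _ (Gc _ _ Gg Gk0)) (k x) x (bmap g0 V).
rewrite -e3 kg ler_norml => /andP[e4 e5].
have := gpb_sum h4 x (k x) (bmap g0 V); rewrite ler_norml => /andP[e6 e7].
have := Giso _ (Gc _ _ Gg Gk0) (k x) x; rewrite kg (metric_sym (k x)) => ->.
lra.
Qed.

(** As products are nonnegative, the preimage of F by g has mass at least exp(- alpha d g) times
    that of F. These preimages overlap at most N times in a finite measure, so a positive mass of F
    would bound the divergent series. *)
Lemma mu_shallow c : mu x (bdcl (shallow c)) = 0.
Proof.
set F := bdcl (shallow c); have mF : measurable (F : set (gborel X)) := measurable_bdcl _.
have [N hN] := shallow_multiplicity c.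
have bound (l : seq (X -> X)) : uniq l -> {in l, forall g, G g} ->
    ((\sum_(g <- l) expR (- alpha * d g))%:E * mu x F <= N%:R%:E * mu x setT)%E.
  move=> ul lG.
  have mp g : g \in l -> measurable (gbar_map g @^-1` F : set (gborel X)).
    by move=> gl; apply: measurable_preimage => //; exact: lG.
  apply: (@le_trans _ _ (\sum_(g <- l) mu x (gbar_map g @^-1` F))%E).
    rewrite -sumEFin ge0_sume_distrl; last by move=> g _; rewrite lee_fin expR_ge0.
    rewrite big_seq [leRHS]big_seq; apply: lee_sum => g gl.
    have := @mu_preimage_ge g F 0 (lG _ gl) mF (@bdcl_bdry _ _ _).
    rewrite mulr0 sub0r mulrN -mulNr; apply => V _; exact: gpb_ge0.
  (* The guard [g \in l] makes every summand measurable, including those for maps outside G. *)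
  have -> : (\sum_(g <- l) mu x (gbar_map g @^-1` F) =
      \int[mu x]_p (\sum_(g <- l) if g \in l then (\1_(gbar_map g @^-1` F : set (gborel X)) p)%:E else 0))%E.
    rewrite ge0_integral_sum//; last 2 first.
    - move=> g; have [gl|//] := boolP (g \in l); apply/measurable_EFinP.
      by apply: measurable_indic; exact: mp.
    - by move=> g p _; case: ifPn => // _; rewrite lee_fin.
    rewrite big_seq [RHS]big_seq; apply: eq_bigr => g gl; rewrite gl integral_indic ?setIT//.
    exact: mp.
  rewrite -integral_cst//; apply: ge0_le_integral => //.
  - by move=> p _; apply: sume_ge0 => g _; case: ifPn => // _; rewrite lee_fin.
  - apply: emeasurable_sum => g; have [gl|//] := boolP (g \in l); apply/measurable_EFinP.
    by apply: measurable_indic; exact: mp.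
  move=> p _; rewrite big_seq; under eq_bigr => g gl do rewrite gl indicE.
  rewrite -big_seq sumEFin lee_fin -natr_sum ler_nat.
  apply: leq_trans (hN l p ul lG); rewrite -sum1_count [leqRHS]big_mkcond /=.
  apply: leq_sum => g _; case: asboolP => h; first by rewrite leq_b1.
  by rewrite memNset.
have [e|e] := eqVneq (mu x F) 0%E; first exact: e.
have fF : mu x F \is a fin_num by exact: fin_num_measure.
have fT : mu x setT \is a fin_num by exact: fin_num_measure.
have F0 : 0 < fine (mu x F).
  by rewrite fine_gt0// lt0e e measure_ge0 ltey_eq fF.
have [l [ul lG hl]] := hdiv ((N%:R * fine (mu x setT) + 1) / fine (mu x F)).
have := bound l ul lG; rewrite -(fineK fF) -(fineK fT) -!EFinM lee_fin.
move: hl; rewrite ler_pdivrMr// => hl /(le_trans hl); by rewrite gerDl ler10.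
Qed.

(** Let s = (g x | W). The orbit point at depth s towards g x has product about s with W while being
    at distance about s from x, so the hypothesis reads s <= s / 2 + O(1). *)
Lemma shallow_of_half W (C : R) : (forall g, G g -> gpb x (g x) W <= d g / 2 + C) ->
  shallow (3 * D + 2 * C + 14) W.
Proof.
move=> half g Gg; pose s := gpb x (g x) W.
have [|g' [Gg' h1 _ h2]] := @orbit_midpoint _ _ G x D hD g s Gg.
  by rewrite gpb_ge0// gpb_le.
have D0' := D0.
have h3 : s - D - 7 <= gpb x (g' x) W by apply: (gpb_gromov h4 h2); rewrite -/s; lra.
have := half _ Gg'; rewrite -/s; move: h1; rewrite ler_norml /d => /andP[]; lra.
Qed.

(* A coarse projection of V to the orbit is a minimum g of the horofunction
   d g - 2 (g x | V), which exists when V is not a limit point. *)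
Lemma not_lims_shallow : exists c, forall V, ~ lims G x V ->
  exists2 g, G g & shallow c (bmap g V).
Proof.
have [_ Gc Ginv Giso] := hG; have D0' := D0.
exists (3 * D + 2 * 50 + 14) => V /existsNP[r hr].
have {}hr g : G g -> gpb x (g x) V < r.
  by move=> Gg; rewrite ltNge; apply/negP => h; apply: hr; exists g.
pose hf g := d g - 2 * gpb x (g x) V.
pose S := [set - hf g | g in G]; have [G1 _ _ _] := hG.
have hS : has_sup S.
  split; first by exists (- hf id); exists id.
  exists (2 * r) => _ [g Gg <-]; rewrite /hf; have := hr g Gg.
  by have := mdist_ge0 x (g x); rewrite /d; lra.
(* A minimum up to 1 suffices; with the errors 30 of the cocycle and 10 of the isometry it stays
   within the allowance C = 50. *)
have [_ [g0 Gg0 <-] hg0] := sup_adherent ltr01 hS.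
have {hg0} min g : G g -> hf g0 - 1 <= hf g.
  move=> Gg; have : - hf g <= sup S by apply: sup_upper_bound => //; exists g.
  by lra.
have [k [Gk g0k kg0]] := Ginv _ Gg0; exists k => //; set W := bmap k V.
apply: shallow_of_half => h Gh;  have := min (g0 \o h) (Gc _ _ Gg0 Gh).
have := gpb_cocycle h4 x (g0 x) ((g0 \o h) x) V.
have := gpb_iso h4 g0k (Giso _ Gk) (g0 x) ((g0 \o h) x) V.
rewrite /= !g0k -/W Giso// !ler_norml => /andP[e1 e2] /andP[e3 e4].
by rewrite /hf /d /=; lra.
Qed.

Lemma mu_off_limit : (mu x).-negligible (bdry X `\` Bd @` lims G x).
Proof.
have [c hc] := not_lims_shallow.
apply: (@negligibleS _ (gborel X) R (mu x) (\bigcup_(g in G) gbar_map g @^-1` bdcl (shallow c))).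
  move=> _ [[V _ <-] hV]; have [|g Gg h] := hc V.
    by move=> lV; apply: hV; exists V.
  by exists g => //; exact: bdcl_sub.
apply: negligible_bigcup_countable; first exact: countable_group.
move=> g Gg; have mp := measurable_preimage Gg (measurable_bdcl (shallow c)).
apply/negligibleP => //.
apply: (etrans (mu_preimage Gg (measurable_bdcl _))).
have [r [mr r0 re ->]] := density_ex hmu x (g x); last exact: measurable_bdcl.
apply: null_set_integral; [exact: measurable_bdcl| |exact: mu_shallow].
by apply/measurable_EFinP; exact: measurable_funS mr.
Qed.

End SupportOnLimitSet.

(** * The shadow lemma *)

Section ShadowLemma.
Context {R : realType} {X : pointedMetricType R}.
Hypothesis h4 : four_point_condition X.
Variables (G : set (X -> X)) (alpha : R)
  (mu : X -> {finite_measure set (gborel X) -> \bar R}) (x : X) (D : R).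
Hypotheses (hmu : conformal_density G alpha mu) (al0 : 0 < alpha).
Hypotheses (hG : isometry_group G) (D0 : 0 <= D) (hD : quasi_convex_orbit G x D).
Hypothesis hfin : forall r, finite_set [set g | G g /\ mdist x (g x) <= r].
Hypothesis hdiv : unbounded_sums G (fun g => expR (- alpha * mdist x (g x))).
Implicit Types (y z : X) (A : set (gborel X)) (g h : X -> X) (V W : gboundary X).

Let d g : R := mdist x (g x).

Definition shadow g (r : R) : set (gborel X) :=
  bdcl [set V | d g - r <= gpb x (g x) V].

Lemma measurable_shadow g r : measurable (shadow g r).
Proof. exact: measurable_bdcl. Qed.

Lemma sub_shadow g r V : d g - r <= gpb x (g x) V -> shadow g r (Bd V).
Proof. by move=> h; exact: bdcl_sub. Qed.

Lemma shadow_gpb g r V : shadow g r (Bd V) -> d g - r - 7 <= gpb x (g x) V.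
Proof. by move=> /(bdcl_gpb_ge h4)[W hW [<-]]. Qed.

Lemma shadow_bdry g r : shadow g r `<=` bdry X.
Proof. exact: bdcl_bdry. Qed.

Lemma bdcl1 V : bdcl [set V] = [set Bd V].
Proof.
apply/seteqP; split => [p hp|_ ->]; last exact: bdcl_sub.
have [W _ e] := bdcl_bdry hp; subst p; congr Bd.
apply/esym; apply: (gprod_bd_eq h4 (x := x)) => r.
by have [_ ->] := bdclP h4 x r hp.
Qed.

Let mu_le_setT A : measurable A -> (mu x A <= mu x setT)%E.
Proof. by move=> mA; rewrite le_measure ?inE//. Qed.

(** If V carried all of a positive boundary mass, no preimage of it would have more mass than V. The
    conformal factor would then force (g x | V) <= d g / 2 for all g, so V would be shallow,
    contrary to being a limit point. *)
Lemma mu_atom V : mu x (bdry X `\` [set Bd V]) = 0 -> mu x (bdry X) = 0.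
Proof.
move=> h; have mb : measurable (bdry X : set (gborel X)) := @measurable_bdry R X.
set P : set (gborel X) := [set Bd V].
have mP : measurable P by rewrite /P -bdcl1; exact: measurable_bdcl.
have mbP : measurable (bdry X `\` P : set (gborel X)) by exact: measurableD.
have muP : (mu x (bdry X) <= mu x P)%E.
  have -> : mu x P = (mu x P + mu x (bdry X `\` P))%E by rewrite h adde0.
  apply: le_trans (measureU2 _ _ _) => //; rewrite le_measure ?inE//.
    exact: measurableU.
  by move=> p bp; have [?|?] := pselect (P p); [left | right].
have [PL|PL] := pselect (P `<=` bdry X `\` Bd @` lims G x).
  have /negligibleP : (mu x).-negligible P.
    exact: negligibleS PL (mu_off_limit h4 hmu al0 hG D0 hD hfin hdiv).
  by move=> /(_ mP) e; apply/eqP; rewrite eq_le measure_ge0 andbT -e.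
have lV : lims G x V.
  apply: contrapT => lV; apply: PL => _ ->; split; first by exists V.
  by move=> [W lW [WV]]; apply: lV; rewrite -WV.
have [e|e] := eqVneq (mu x P) 0%E.
  by apply/eqP; rewrite eq_le measure_ge0 andbT -e.
have fP : mu x P \is a fin_num by exact: fin_num_measure.
have P0 : 0 < fine (mu x P) by rewrite fine_gt0// lt0e e measure_ge0 ltey_eq fP.
clear e.
have half g : G g -> gpb x (g x) V <= d g / 2 + 0.
  move=> Gg; have mgP := measurable_preimage h4 hG Gg mP.
  have : (mu x (gbar_map g @^-1` P) <= mu x P)%E.
    have -> : mu x P = (mu x P + mu x (bdry X `\` P))%E by rewrite h adde0.
    apply: le_trans (measureU2 _ _ _) => //; rewrite le_measure ?inE//.
      exact: measurableU.
    move=> p gp; have [?|nP] := pselect (P p); [by left | right; split => //].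
    by case: p gp {nP} => [y //|W _]; exists W.
  have e : ((expR (alpha * (2 * gpb x (g x) V - d g)))%:E * mu x P <=
      mu x (gbar_map g @^-1` P))%E.
    apply: (mu_preimage_ge hmu al0) => //; first by move=> _ ->; exists V.
    by move=> W [->].
  move=> /(le_trans e); rewrite -(fineK fP) -EFinM lee_fin ger_pMl// expR_le1.
  by rewrite pmulr_rle0//; lra.
have := shallow_of_half h4 D0 hD half; set c := (3 * D + _ + _) => hc.
have [g Gg] := lV (c + 1); move=> /le_trans/(_ (hc g Gg)).
by rewrite gerDl ler10.
Qed.

(** Otherwise the points not seen deeper than n towards k n x have summable masses. By
    Borel-Cantelli almost every boundary point is eventually deep in the directions k n x, and two
    such points coincide by the four-point condition: all the mass would sit at one point. *)
Lemma complement_mass : mu x (bdry X) != 0 -> exists c0 r0 : R, 0 < c0 /\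
  forall g, G g -> (c0%:E <= mu x (bdcl [set V | (gpb x (g x) V <= r0)%R]))%E.
Proof.
move=> mu0; apply: contrapT => hn.
have /choice[k hk] : forall n : nat, exists g, G g /\
    (mu x (bdcl [set V | (gpb x (g x) V <= n%:R)%R]) <= (1 / (2 ^ n.+1)%:R)%:E)%E.
  move=> n; apply: contrapT => h; apply: hn; exists (1 / (2 ^ n.+1)%:R), n%:R; split.
    by rewrite divr_gt0// ltr0n expn_gt0.
  by move=> g Gg; rewrite leNgt; apply/negP => hlt; apply: h; exists g; split => //; exact: ltW.
pose B n : set (gborel X) := bdcl [set V | gpb x (k n x) V <= n%:R].
have mB n : measurable (B n) := measurable_bdcl _.
have B0 : mu x (lim_sup_set B) = 0.
  apply: lim_sup_set_cvg0 => //; apply: (@le_lt_trans _ _ 1%:E); last by rewrite ltry.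
  apply: le_trans (epsilon_trick0 xpredT ler01).
  by apply: lee_nneseries => // n _; exact: (hk n).2.
have mL : measurable (lim_sup_set B).
  by apply: bigcap_measurable => // n _; exact: bigcup_measurable.
have [[V hV]|hV] := pselect (exists V, ~ lim_sup_set B (Bd V)).
  move/eqP: mu0; apply; apply: (@mu_atom V).
  have ev U : ~ lim_sup_set B (Bd U) -> exists N : nat, forall n, (N <= n)%N ->
      n%:R < gpb x (k n x) U.
    move=> /existsNP[N /not_implyP[_ hN]]; exists N => n Nn.
    rewrite ltNge; apply/negP => hU; apply: hN; exists n => //; exact: bdcl_sub.
  apply: (@subset_measure0 _ _ _ (mu x) _ (lim_sup_set B)) => //.
    apply: measurableD; first exact: measurable_bdry.
    by rewrite -bdcl1; exact: measurable_bdcl.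
  move=> _ [[W _ <-] WV]; apply: contrapT => hW; apply: WV; congr Bd.
  have [N1 h1] := ev _ hV; have [N2 h2] := ev _ hW.
  apply: (gprod_bd_eq h4 (x := x)) => r.
  have [N3 _ h3] := nbhs_infty_ger (r + 7); pose n := maxn N1 (maxn N2 N3).
  have n1 : (N1 <= n)%N by rewrite /n !leq_max leqnn ?orbT.
  have n2 : (N2 <= n)%N by rewrite /n !leq_max leqnn ?orbT.
  have n3 : (N3 <= n)%N by rewrite /n !leq_max leqnn ?orbT.
  have := ltW (h1 n n1); have := ltW (h2 n n2); rewrite !gpb_ge// gprodC => e1 e2.
  apply: le_trans (gprod_four_point h4 e1 e2); rewrite lee_fin.
  by have := h3 n n3; rewrite /=; move: (n%:R : R) => m; lra.
move/eqP: mu0; apply; apply: (@subset_measure0 _ _ _ (mu x) _ (lim_sup_set B)) => //.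
  exact: (@measurable_bdry R X).
by move=> _ [V _ <-]; apply: contrapT => h; apply: hV; exists V.
Qed.

(** Pulled back by g, the shadow of g x contains the points with a small product with g^-1 x, of
    mass at least c, while pulling back multiplies masses by at most exp(alpha d g). The 27 is 7 for
    the closure, 10 for the isometry and 10 for [gpb_sum]. *)
Lemma shadow_lower : mu x (bdry X) != 0 -> exists c r : R, 0 < c /\
  forall g, G g -> ((c * expR (- alpha * d g))%:E <= mu x (shadow g r))%E.
Proof.
move=> /complement_mass[c [r0 [c0 hc]]]; have [_ Gc Ginv Giso] := hG.
exists c, (r0 + 27); split => // g Gg; have [k [Gk gk kg]] := Ginv g Gg.
have mS := measurable_shadow g (r0 + 27).
have h1 : (mu x (gbar_map g @^-1` shadow g (r0 + 27)) <=
    (expR (alpha * (2 * d g - d g)))%:E * mu x (shadow g (r0 + 27)))%E.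
  apply: (mu_preimage_le hmu al0) => //; first exact: shadow_bdry.
  by move=> V _; exact: gpb_le.
have h2 : (c%:E <= mu x (gbar_map g @^-1` shadow g (r0 + 27)))%E.
  apply: le_trans (hc k Gk) _; rewrite le_measure ?inE//.
  - exact: measurable_bdcl.
  - exact: (measurable_preimage h4 hG Gg mS).
  move=> p hp; have [V _ e] := bdcl_bdry hp; subst p.
  have {hp} [W /= hV [WV]] := bdcl_gpb_le h4 hp; rewrite {W}WV in hV.
  change (shadow g (r0 + 27) (Bd (bmap g V))).
  apply: sub_shadow.
  have := gpb_iso h4 kg (Giso g Gg) x (k x) V; rewrite kg ler_norml => /andP[_ e1].
  have := gpb_sum h4 x (g x) (bmap g V); rewrite ler_norml => /andP[e2 _].
  by rewrite /d; lra.
have {h1 h2} := le_trans h2 h1.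
have fS : mu x (shadow g (r0 + 27)) \is a fin_num by exact: fin_num_measure.
rewrite -(fineK fS) -EFinM !lee_fin => h.
have -> : - alpha * d g = - (alpha * (2 * d g - d g)) by ring.
by rewrite expRN ler_pdivrMr ?expR_gt0// mulrC.
Qed.

(** On the shadow the Busemann function is at least d g - 2r - 14, so pulling back expands masses by
    at least the matching exponential, into a set of at most the total mass. *)
Lemma shadow_upper r : exists c : R, 0 < c /\
  forall g, G g -> (mu x (shadow g r) <= (c * expR (- alpha * d g))%:E)%E.
Proof.
have fT : mu x setT \is a fin_num by exact: fin_num_measure.
have T0 : 0 <= fine (mu x setT) by rewrite fine_ge0.
exists (expR (alpha * (2 * r + 14)) * (fine (mu x setT) + 1)); split.
  by rewrite mulr_gt0 ?expR_gt0//; lra.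
move=> g Gg; have mS := measurable_shadow g r.
have h1 : ((expR (alpha * (2 * (d g - r - 7) - d g)))%:E * mu x (shadow g r) <=
    mu x (gbar_map g @^-1` shadow g r))%E.
  apply: (mu_preimage_ge hmu al0) => //; first exact: shadow_bdry.
  by move=> V; exact: shadow_gpb.
have {h1} := le_trans h1 (mu_le_setT (measurable_preimage h4 hG Gg mS)).
have fS : mu x (shadow g r) \is a fin_num by exact: fin_num_measure.
rewrite -(fineK fS) -(fineK fT) -EFinM !lee_fin => h.
have e : expR (alpha * (2 * r + 14)) * expR (- alpha * d g) *
    expR (alpha * (2 * (d g - r - 7) - d g)) = 1.
  by rewrite -!expRD (_ : _ + _ = 0) ?expR0//; ring.
have E0 : 0 <= expR (alpha * (2 * r + 14)) * expR (- alpha * d g) by rewrite mulr_ge0 ?expR_ge0.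
have := ler_wpM2l E0 h; rewrite mulrA e mul1r => /le_trans; apply.
by rewrite [leRHS]mulrAC ler_wpM2l// lerDl.
Qed.

End ShadowLemma.

(** * Regularity of the measures and the Vitali covering property *)

Section Regularity.
Context {R : realType} {X : pointedMetricType R}.
Hypothesis h4 : four_point_condition X.
Variables (x : X) (m : {finite_measure set (gborel X) -> \bar R}).
Implicit Types (A : set (gborel X)).

(** Levels of the Gromov product replace the distance to the complement of O: F n closes up the
    points whose neighbourhood of level n lies in O. A limit of such points lies in one of these
    neighbourhoods, hence in O. *)
Lemma open_exhaustion (O : set (gbar X)) : open O -> exists F : nat -> set (gbar X),
  [/\ forall n, closed (F n), forall n, F n `<=` O,
      {homo F : i j / (i <= j)%N >-> i `<=` j} & O `&` bdry X `<=` \bigcup_n F n].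
Proof.
move=> oO.
pose S (n : nat) := [set V | [set p | (n%:R%:E <= gprod x p (Bd V))%E] `<=` O].
exists (fun n => bdcl (S n)); split.
- by move=> n; exact: closed_closure.
- move=> n p hp; have [V _ e] := bdcl_bdry hp; subst p.
  have [W SW h] := bdclP h4 x n%:R hp; apply: SW => /=.
  by rewrite gprodC.
- move=> i j ij; apply: closure_subset => _ [V SV <-]; exists V => // p hp; apply: SV.
  by apply: le_trans hp; rewrite lee_fin ler_nat.
move=> q [OV [V _ e]]; subst q; have : nbhs (Bd V) O by exact: open_nbhs_nbhs.
move=> /(nbhs_bd x)[r hr]; have [n _ /(_ n (leqnn n)) /= rn] := nbhs_infty_ger r.
exists n => //; apply: bdcl_sub => p hp; apply: hr => /=.
by apply: le_trans hp; rewrite lee_fin.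
Qed.

(** The mass is controlled on the boundary only, because [open_exhaustion] exhausts only the
    boundary part of an open set. *)
Let close_approx A := forall e : R, 0 < e -> exists C U : set (gbar X),
  [/\ closed C, open U, C `<=` A, A `<=` U &
      (m ((U `\` C) `&` bdry X : set (gborel X)) <= e%:E)%E].

Let mo (U : set (gbar X)) : open U -> measurable (U : set (gborel X)).
Proof. by move=> oU; exact: sub_sigma_algebra. Qed.

Let mc (C : set (gbar X)) : closed C -> measurable (C : set (gborel X)).
Proof. by move=> cC; rewrite -[C]setCK; apply: measurableC; apply: mo; exact: closed_openC. Qed.

Let mb : measurable (bdry X : set (gborel X)) := @measurable_bdry R X.

Let decreasing_near (F : nat -> set (gborel X)) (B : set (gborel X)) (e : R) : 0 < e ->
  (forall n, measurable (F n)) -> {homo F : i j / (i <= j)%N >-> j `<=` i} ->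
  \bigcap_n F n `<=` B -> measurable B -> exists n, (m (F n) <= m B + e%:E)%E.
Proof.
move=> e0 mF Fd FB mB.
have mI : measurable (\bigcap_n F n) by exact: bigcap_measurable.
have cv : (m \o F) n @[n --> \oo] --> m (\bigcap_n F n).
  apply: nonincreasing_cvg_mu => //; first by rewrite ltey_eq fin_num_measure.
  by move=> i j ij; apply/subsetPset; exact: Fd.
have fB : m B \is a fin_num by exact: fin_num_measure.
have lt : (m (\bigcap_n F n) < m B + e%:E)%E.
  apply: (@le_lt_trans _ _ (m B)); first by rewrite le_measure ?inE//.
  by rewrite lteDl// lte_fin.
have : \forall n \near \oo, (m (F n) < m B + e%:E)%E.
  by apply: (cv [set y | (y < m B + e%:E)%E]); apply: open_nbhs_nbhs; split => //; exact: open_ereal_lt_ereal.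
by move=> [n _ /(_ n (leqnn n)) /= h]; exists n; exact: ltW.
Qed.

Lemma close_approx_open (O : set (gbar X)) : open O -> close_approx O.
Proof.
move=> oO e e0; have [F [cF FO Fi OF]] := open_exhaustion oO.
have [||||n hn] := @decreasing_near (fun n => (O `\` F n) `&` bdry X) set0 e e0.
- by move=> n; apply: measurableI => //; apply: measurableD; [exact: mo | exact: mc].
- by move=> i j ij p [[Op Fp] bp]; split => //; split => // h; apply: Fp; exact: Fi ij _ h.
- move=> p hp; have [[Op _] bp] := hp 0%N I; have [n _ Fp] := OF p (conj Op bp).
  by have [[_ /(_ Fp)]] := hp n I.
- exact: measurable0.
exists (F n), O; split => //.
by move: hn; rewrite measure0 add0e.
Qed.

Lemma borel_close_approx A : measurable A -> close_approx A.
Proof.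
have : sigma_algebra [set: gbar X] close_approx.
  split.
  - move=> e e0; exists set0, set0; split => //; [exact: closed0 | exact: open0 |].
    by rewrite set0D set0I measure0 lee_fin ltW.
  - move=> B hB e e0; have [C [U [cC oU CB BU h]]] := hB e e0.
    exists (~` U), (~` C); rewrite setTD; split.
    + exact: open_closedC.
    + exact: closed_openC.
    + exact: subsetC.
    + exact: subsetC.
    have -> : ~` C `\` ~` U = U `\` C by rewrite setDE setCK setIC.
    exact: h.
  move=> B hB e e0.
  have e20 : 0 < e / 2 by rewrite divr_gt0.
  have /choice[P hP] : forall n, exists P : set (gbar X) * set (gbar X),
      [/\ closed P.1, open P.2, P.1 `<=` B n, B n `<=` P.2 &
        (m ((P.2 `\` P.1) `&` bdry X : set (gborel X)) <= (e / 2 / (2 ^ n.+1)%:R)%:E)%E].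
    move=> n; have [|C [U h]] := hB n (e / 2 / (2 ^ n.+1)%:R).
      by rewrite divr_gt0// ltr0n expn_gt0.
    by exists (C, U).
  pose U := \bigcup_n (P n).2.
  have oU : open U by apply: bigcup_open => n _; have [] := hP n.
  pose D n := ((P n).2 `\` (P n).1) `&` bdry X : set (gborel X).
  have mP1 n : measurable ((P n).1 : set (gborel X)) by apply: mc; have [] := hP n.
  have mP2 n : measurable ((P n).2 : set (gborel X)) by apply: mo; have [] := hP n.
  have mD n : measurable (D n).
    by apply: measurableI => //; exact: measurableD.
  have hD : (m (\bigcup_n D n) <= (e / 2)%:E)%E.
    apply: le_trans (epsilon_trick0 xpredT (ltW e20)).
    apply: (@le_trans _ _ (\sum_(n <oo) m (D n))%E).
      by apply: measure_sigma_subadditive => //; exact: bigcup_measurable.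
    by apply: lee_nneseries => // n _; have [] := hP n.
  (* The union of all the closed sets need not be closed; a finite union is, and loses at most
     another e / 2. *)
  pose C n := \bigcup_(i < n) (P i).1.
  have cC n : closed (C n).
    by rewrite /C bigcup_mkord; apply: closed_bigsetU => i _; have [] := hP i.
  have [||||n hn] := @decreasing_near (fun n => (U `\` C n) `&` bdry X) (\bigcup_n D n) _ e20.
  - by move=> n; apply: measurableI => //; apply: measurableD; [exact: mo | exact: mc].
  - move=> i j ij p [[Up Cp] bp]; split => //; split => // -[k /= ki Pk].
    by apply: Cp; exists k => //=; exact: leq_trans ij.
  - move=> p hp; have [[[k _ Pk] _] bp] := hp 0%N I; exists k => //; split => //; split => // Pk1.
    by have [[_ h] _] := hp k.+1 I; apply: h; exists k => /=.
  - exact: bigcup_measurable.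
  exists (C n), U; split => //.
  - by move=> p [k /= _ Pk]; exists k => //; have [_ _ h _ _] := hP k; exact: h.
  - by apply: subset_bigcup => k _; have [] := hP k.
  apply: (le_trans hn); rewrite [e in leRHS]splitr EFinD leeD2r//.
move=> sg mA; apply: (smallest_sub sg _ mA) => O oO; exact: close_approx_open.
Qed.

End Regularity.

(* [rk] orders the sets by decreasing size. *)
Lemma vitali_cover {R : realType} (I : choiceType) (T : Type) (rk : I -> R)
    (S S' : I -> set T) (l : seq I) :
  (forall i, S i `<=` S' i) ->
  (forall i j, rk i <= rk j -> S i `&` S j !=set0 -> S j `<=` S' i) ->
  uniq l -> exists l', [/\ uniq l', {subset l' <= l}, trivIset [set` l'] S &
    \bigcup_(i in [set` l]) S i `<=` \bigcup_(i in [set` l']) S' i].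
Proof.
move=> SS' eng; have [n] := ubnP (size l); elim: n l => // n IH [|i0 l0].
  move=> _ _; exists [::]; split => //; last by move=> p [k].
have [l el] : exists l, l = i0 :: l0 by exists (i0 :: l0).
rewrite -el => sl ul.
(* Greedy choice: the enlargement of a largest set contains all the sets that it meets, and the
   remaining ones are left to the induction. *)
have [i [il imin]] : exists i, i \in l /\ forall j, j \in l -> rk i <= rk j.
  rewrite el; elim: l0 {el sl ul l} i0 => [|j l IHl] i0.
    by exists i0; rewrite mem_head; split => // j; rewrite inE => /eqP ->.
  have [k [kl kmin]] := IHl j.
  have [ik|ki] := leP (rk i0) (rk k).
    exists i0; rewrite mem_head; split => // a; rewrite inE => /orP[/eqP -> //|/kmin].
    exact: le_trans ik.
  exists k; rewrite inE kl orbT; split => // a; rewrite inE => /orP[/eqP ->|/kmin//].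
  exact: ltW.
pose l1 := [seq j <- l | `[< S i `&` S j = set0 >] && (j != i)].
have [||l' [ul' l'l1 tl' cl']] := IH l1.
- rewrite -ltnS; apply: leq_trans sl; rewrite ltnS size_filter ltn_neqAle count_size andbT.
  by rewrite -all_count; apply/negP => /allP/(_ i il); rewrite eqxx andbF.
- by rewrite filter_uniq.
have l1P j : j \in l1 -> [/\ S i `&` S j = set0, j != i & j \in l].
  by rewrite mem_filter => /andP[/andP[/asboolP]].
exists (i :: l'); split.
- by rewrite /= ul' andbT; apply/negP => /l'l1/l1P[_ /eqP].
- by move=> j; rewrite inE => /orP[/eqP -> //|/l'l1/l1P[]].
- move=> a b /=; rewrite !inE => /orP[/eqP ->|al] /orP[/eqP ->|bl] //.
  + by have [-> _ _] := l1P _ (l'l1 _ bl) => -[].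
  + by rewrite setIC; have [-> _ _] := l1P _ (l'l1 _ al) => -[].
  + exact: tl'.
move=> p [j /= jl Sj].
have [e|ji] := eqVneq j i.
  by subst j; exists i => /=; [rewrite mem_head | exact: SS'].
have [e|/set0P ne] := eqVneq (S i `&` S j) set0.
  have [|k /= kl' Sk] := cl' p; first by exists j => //=; rewrite mem_filter jl ji !andbT; apply/asboolP.
  by exists k => //=; rewrite inE kl' orbT.
by exists i; [rewrite /= mem_head | apply: eng ne _ Sj; exact: imin].
Qed.

(** * Differentiation along shadows *)

Section Differentiation.
Context {R : realType} {X : pointedMetricType R}.
Hypothesis h4 : four_point_condition X.
Variables (G : set (X -> X)) (alpha : R)
  (mu : X -> {finite_measure set (gborel X) -> \bar R}) (x : X).
Hypotheses (hmu : conformal_density G alpha mu) (al0 : 0 < alpha).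
Hypothesis (hG : isometry_group G).
Hypothesis hfin : forall r, finite_set [set g | G g /\ mdist x (g x) <= r].
Variable r : R.
Implicit Types (A E : set (gborel X)) (g : X -> X) (V W : gboundary X).

Let d g : R := mdist x (g x).
Let T g : set (gborel X) := shadow x g r.

(** The loss 21 is 7 for the closures and 7 for each of two four-point conditions, through a common
    point and then to a point of the smaller shadow. *)
Lemma shadow_engulf g g' : d g <= d g' -> T g `&` T g' !=set0 ->
  T g' `<=` shadow x g (r + 21).
Proof.
move=> dd [p [p1 p2]] q q2.
have [V _ e] := bdcl_bdry p1; subst p; have [W _ e] := bdcl_bdry q2; subst q.
have e1 := shadow_gpb h4 p1; have e2 := shadow_gpb h4 p2; have e3 := shadow_gpb h4 q2.
apply: sub_shadow; rewrite gpb_ge// in e3; rewrite gpb_ge// gprodC in e2.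
have {e2 e3} e4 := gprod_four_point h4 e2 e3.
have {}e1 : d g - r - 14 <= gpb x (g x) V by rewrite /d in dd *; lra.
have {}e4 : ((d g - r - 14)%:E <= gprod x (Bd V) (Bd W))%E.
  by apply: le_trans e4; rewrite lee_fin /d in dd *; lra.
rewrite gpb_ge// in e1; rewrite gpb_ge//; apply: le_trans (gprod_four_point h4 e1 e4).
by rewrite lee_fin /d; lra.
Qed.

Lemma shadow_sub_open (U : set (gbar X)) V : open U -> U (Bd V) ->
  exists K : R, forall g, K <= d g -> T g (Bd V) -> T g `<=` U.
Proof.
move=> oU UV; have : nbhs (Bd V) U by exact: open_nbhs_nbhs.
move=> /(nbhs_bd x)[s hs]; exists (s + r + 14) => g gK gV q gq; apply: hs.
have [W _ e] := bdcl_bdry gq; subst q => /=.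
have := shadow_gpb h4 gV; have := shadow_gpb h4 gq; rewrite !gpb_ge// gprodC => e1 e2.
by apply: le_trans (gprod_four_point h4 e1 e2); rewrite lee_fin /d in gK *; lra.
Qed.

Lemma measure_bigsetU_le (I : eqType) (F : I -> set (gborel X)) (l : seq I) :
  (forall i, measurable (F i)) ->
  (mu x (\big[setU/set0]_(i <- l) F i) <= \sum_(i <- l) mu x (F i))%E.
Proof.
move=> mF; elim: l => [|i l IH]; first by rewrite !big_nil measure0.
rewrite !big_cons; apply: (le_trans (measureU2 _ _ _)) => //.
  exact: bigsetU_measurable.
by rewrite leeD2l.
Qed.

Lemma shadowS g s t : s <= t -> shadow x g s `<=` shadow x g t.
Proof.
move=> st; apply: closure_subset => _ [V hV <-]; exists V => //=.
by apply: le_trans hV; rewrite lerB.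
Qed.

Lemma negligible_small_covers A :
  (forall e : R, 0 < e -> exists B : set (gborel X),
    [/\ measurable B, A `<=` B & (mu x B <= e%:E)%E]) -> (mu x).-negligible A.
Proof.
move=> h; have /choice[B hB] : forall n : nat, exists B : set (gborel X),
    [/\ measurable B, A `<=` B & (mu x B <= (n.+1%:R^-1)%:E)%E].
  by move=> n; apply: h; rewrite invr_gt0 ltr0n.
exists (\bigcap_n B n); split.
- by apply: bigcap_measurable => // n _; have [] := hB n.
- have mB n : measurable (B n) by have [] := hB n.
  apply/eqP; rewrite eq_le measure_ge0 andbT; apply/lee_addgt0Pr => e e0; rewrite add0e.
  have [n _ /(_ n (leqnn n)) /= hn] := near_infty_natSinv_lt (PosNum e0).
  apply: (@le_trans _ _ (mu x (B n))).
    by rewrite le_measure ?inE//; [exact: bigcap_measurable | exact: bigcap_inf].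
  by have [_ _ h1] := hB n; apply: le_trans h1 _; rewrite lee_fin ltW.
- by move=> p Ap n _; have [_ h1 _] := hB n; exact: h1.
Qed.

(** Enclose E in an open U with so little boundary mass in U \ E that h has a small integral there.
    Deep bad shadows centred on E lie in U, and the mass of their union is at most c / s times the
    integral of h over a disjoint subfamily, all of it carried by U \ E. *)
Lemma density_zero E (h : gborel X -> R) : measurable E ->
  (forall v, 0 <= h v) -> (mu x).-integrable setT (EFin \o h) ->
  (forall v, E v -> h v = 0) -> forall s : R, 0 < s ->
  (mu x).-negligible [set v | E v /\ bdry X v /\ forall K : R, exists g,
     [/\ G g, K <= d g, T g v &
      (s%:E < (expR (alpha * d g))%:E * \int[mu x]_(u in T g) (h u)%:E)%E]].
Proof.
move=> mE h0 ih hE s s0; apply: negligible_small_covers => e e0.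
have [c [c0 hc]] := shadow_upper h4 x hmu al0 hG (r + 21).
have mh : measurable_fun setT h by apply/measurable_EFinP; exact: measurable_int ih.
have mhE B : measurable B -> measurable_fun B (EFin \o h).
  by move=> mB; apply/measurable_EFinP; exact: measurable_funS mh.
have es0 : 0 < e * s / c by rewrite divr_gt0// mulr_gt0.
have [dl [dl0 hdl]] := integral_normr_continuous ih es0.
have [C [U [cC oU CE EU hUC]]] := borel_close_approx h4 x (mu x) mE (divr_gt0 dl0 (ltr0n _ 2)).
have mU : measurable (U : set (gborel X)) by exact: sub_sigma_algebra.
have mb := @measurable_bdry R X.
have mUE : measurable ((U `\` E) `&` bdry X : set (gborel X)).
  by apply: measurableI => //; exact: measurableD.
have mC : measurable (C : set (gborel X)).
  by rewrite -[C]setCK; apply: measurableC; apply: sub_sigma_algebra; exact: closed_openC.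
have mUC : measurable ((U `\` C) `&` bdry X : set (gborel X)).
  by apply: measurableI => //; exact: measurableD.
have intUE : (\int[mu x]_(u in (U `\` E) `&` bdry X) (h u)%:E <= (e * s / c)%:E)%E.
  have lt : (mu x ((U `\` E) `&` bdry X : set (gborel X)) < dl%:E)%E.
    apply: (@le_lt_trans _ _ (mu x ((U `\` C) `&` bdry X : set (gborel X)))).
      by rewrite le_measure ?inE// => p [[Up Ep] bp]; split => //; split => // /CE.
    by apply: (le_lt_trans hUC); rewrite lte_fin ltr_pdivrMr// ltr_pMr// ltr1n.
  have fi : (\int[mu x]_(u in (U `\` E) `&` bdry X) (h u)%:E)%E \is a fin_num.
    by apply: integrable_fin_num => //; exact: integrableS ih.
  have := hdl _ mUE lt; rewrite /Rintegral.
  under eq_integral do rewrite ger0_norm//.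
  by move=> /ltW; rewrite -lee_fin fineK.
pose I g := `[< T g `<=` U /\
  (s%:E < (expR (alpha * d g))%:E * \int[mu x]_(u in T g) (h u)%:E)%E >].
have mT g : measurable (T g) := measurable_shadow x g r.
have intD B : measurable B ->
    (\int[mu x]_(u in B) (h u)%:E = \int[mu x]_(u in B `\` E) (h u)%:E)%E.
  move=> mB; rewrite integral_mkcond [RHS]integral_mkcond; congr (integral _ _ _).
  apply/funext => v; rewrite /patch; have [Ev|Ev] := pselect (E v).
    by rewrite hE//; case: ifP; case: ifP.
  congr (if _ then _ else _); apply/idP/idP; rewrite !inE; first by split.
  by case.
have /choice[L hL] : forall n : nat, exists l : seq (X -> X), uniq l /\
    forall g, (g \in l) <-> G g /\ d g <= n%:R.
  by move=> n; exact: orbit_enum.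
(* Bad shadows up to distance n form a finite family, to which the finite covering lemma applies;
   the bound on their union passes to the increasing limit. *)
pose B n : set (gborel X) := \bigcup_(g in [set` [seq g <- L n | I g]]) T g.
have mB n : measurable (B n) by apply: fin_bigcup_measurable => // g _.
have BE n : (mu x (B n) <= e%:E)%E.
  have ul : uniq [seq g <- L n | I g] by rewrite filter_uniq//; have [] := hL n.
  have [|l' [ul' l'l tl' cl']] := vitali_cover (rk := d) (S := T)
    (S' := fun g => shadow x g (r + 21)) _ shadow_engulf ul.
    by move=> g; apply: shadowS; rewrite lerDl.
  have mD : measurable (\big[setU/set0]_(g <- l') T g) by exact: bigsetU_measurable.
  apply: (@le_trans _ _ (mu x (\big[setU/set0]_(g <- l') shadow x g (r + 21)))).
    rewrite le_measure ?inE//.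
      by apply: bigsetU_measurable => g _; exact: measurable_shadow.
    by rewrite -bigcup_seq.
  apply: (le_trans (measure_bigsetU_le l' (fun g => measurable_shadow x g (r + 21)))).
  apply: (@le_trans _ _ (\sum_(g <- l') (c / s)%:E * \int[mu x]_(u in T g) (h u)%:E)%E).
    rewrite big_seq [leRHS]big_seq; apply: lee_sum => g gl.
    have := l'l _ gl; rewrite mem_filter => /andP[/asboolP[_ hI] gL].
    have Gg : G g by have [_ /(_ g)[/(_ gL)[]]] := hL n.
    apply: (le_trans (hc g Gg)).
    have fT : (\int[mu x]_(u in T g) (h u)%:E)%E \is a fin_num.
      by apply: integrable_fin_num => //; apply: (integrableS _ _ _ ih).
    move: hI; rewrite -(fineK fT) -!EFinM lte_fin lee_fin => hI.
    rewrite -mulrA ler_pM2l// ler_pdivlMl// -(ler_pM2l (expR_gt0 (alpha * d g))).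
    rewrite mulrCA -expRD mulNr addrN expR0 mulr1; exact: ltW.
  rewrite -ge0_sume_distrr; last by move=> g _; apply: integral_ge0 => u _; rewrite lee_fin.
  rewrite -ge0_integral_bigsetU//; last by move=> v _; rewrite lee_fin.
    rewrite intD//.
    apply: (@le_trans _ _ ((c / s)%:E * (e * s / c)%:E)%E).
      apply: lee_wpmul2l; first by rewrite lee_fin divr_ge0// ltW.
      apply: le_trans intUE.
      apply: ge0_subset_integral => //.
      - exact: measurableD.
      - exact: mhE.
      - by move=> v _; rewrite lee_fin.
      move=> v [Dv Ev]; move: Dv; rewrite -bigcup_seq => -[g /l'l].
      rewrite mem_filter => /andP[/asboolP[TU _] _] Tv.
      by split; [split => //; exact: TU | exact: shadow_bdry Tv].
    rewrite -EFinM lee_fin (_ : c / s * (e * s / c) = e)//.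
    by field; rewrite !lt0r_neq0.
  exact: mhE.
exists (\bigcup_n B n); split.
- exact: bigcup_measurable.
- move=> v [Ev [[V _ eV] hv]]; subst v.
  have [K hK] := shadow_sub_open oU (EU _ Ev).
  have [g [Gg gK gT gs]] := hv K.
  have [n _ /(_ n (leqnn n)) /= hn] := nbhs_infty_ger (d g).
  exists n => //; exists g => //=; rewrite mem_filter; apply/andP; split.
    by apply/asboolP; split => //; exact: hK.
  by have [_ ->] := hL n.
have cv : (mu x \o B) n @[n --> \oo] --> mu x (\bigcup_n B n).
  apply: nondecreasing_cvg_mu => //; first exact: bigcup_measurable.
  move=> i j ij; apply/subsetPset => v [g /=]; rewrite mem_filter => /andP[Ig gi] Tv.
  exists g => //=; rewrite mem_filter Ig /=; have [_ hj] := hL j; apply/hj.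
  have [_ /(_ g)[/(_ gi)[Gg di] _]] := hL i; split => //.
  by rewrite (le_trans di)// ler_nat.
rewrite -(cvg_lim _ cv)//; apply: lime_le; first by apply/cvg_ex; eexists; exact: cv.
by apply: nearW => n; exact: BE.
Qed.

End Differentiation.

Section LebesguePoints.
Context {R : realType} {X : pointedMetricType R}.
Hypothesis h4 : four_point_condition X.
Variables (G : set (X -> X)) (alpha : R)
  (mu : X -> {finite_measure set (gborel X) -> \bar R}) (x : X).
Hypotheses (hmu : conformal_density G alpha mu) (al0 : 0 < alpha).
Hypothesis (hG : isometry_group G).
Hypothesis hfin : forall r, finite_set [set g | G g /\ mdist x (g x) <= r].
Variable r : R.

Let d (g : X -> X) : R := mdist x (g x).
Let T (g : X -> X) : set (gborel X) := shadow x g r.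

(** Apply [density_zero] to the countably many sets where f is within 1 / (n + 1) of a rational q,
    with h = |f - q| outside them. For v in such a set, |f u - f v| <= h u + 2 / (n + 1). *)
Lemma lebesgue_points (f : gborel X -> R) : (mu x).-integrable setT (EFin \o f) ->
  {ae mu x, forall v, bdry X v -> forall e : R, 0 < e -> exists K : R, forall g,
    G g -> K <= d g -> T g v ->
    (\int[mu x]_(u in T g) `|f u - f v|%:E <= (e * expR (- alpha * d g))%:E)%E}.
Proof.
move=> intf; have mf : measurable_fun setT f by apply/measurable_EFinP; exact: measurable_int intf.
pose E (i : rat * nat) : set (gborel X) := [set v | `|f v - ratr i.1| < i.2.+1%:R^-1].
pose h (i : rat * nat) (v : gborel X) : R := `|f v - ratr i.1| * \1_(~` E i) v.
have mn (q : R) : measurable_fun setT (fun v => `|f v - q|).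
  by apply: measurableT_comp => //; exact: measurable_funB.
have mE i : measurable (E i).
  have -> : E i = setT `&` (fun v => `|f v - ratr i.1|) @^-1` `]-oo, i.2.+1%:R^-1[%classic.
    by rewrite setTI; apply/seteqP; split => v /=; rewrite in_itv.
  exact: mn.
have mh i : measurable_fun setT (h i).
  apply: measurable_funM => //; apply: measurable_indic; exact: measurableC.
have h0 i v : 0 <= h i v by rewrite mulr_ge0.
have ih i : (mu x).-integrable setT (EFin \o h i).
  have ic : (mu x).-integrable setT (fun v => (f v)%:E + (- ratr i.1)%:E)%E.
    by apply: integrableD => //; exact: finite_measure_integrable_cst.
  apply: (le_integrable measurableT _ _ ic); first exact/measurable_EFinP.
  move=> v _ /=; rewrite lee_fin ger0_norm// /h indicE.
  by case: (v \in _); rewrite ?mulr1 ?mulr0.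
have hE i v : E i v -> h i v = 0.
  by move=> Ev; rewrite /h indicE memNset ?mulr0// => /(_ Ev).
have [c [c0 hc]] := shadow_upper h4 x hmu al0 hG r.
pose N (i : (rat * nat)) := [set v | E i v /\ bdry X v /\ forall K : R, exists g,
     [/\ G g, K <= d g, T g v &
      ((i.2.+1%:R^-1)%:E < (expR (alpha * d g))%:E * \int[mu x]_(u in T g) (h i u)%:E)%E]].
have : (mu x).-negligible (\bigcup_i N i).
  apply: negligible_bigcup_countable; first exact: countableP.
  move=> i _; have i0 : 0 < i.2.+1%:R^-1 :> R by rewrite invr_gt0 ltr0n.
  exact: (density_zero h4 hmu al0 hG hfin r (mE i) (h0 i) (ih i) (hE i) i0).
apply: negligibleS => v /= hv; apply: contrapT => vN; apply: hv => bv e e0.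
have ec : 0 < e / (1 + 2 * c) by rewrite divr_gt0//; lra.
have [n _ /(_ n (leqnn n)) /= hn] := near_infty_natSinv_lt (PosNum ec).
have n0 : 0 < n.+1%:R^-1 :> R by rewrite invr_gt0 ltr0n.
have [|q] := @rat_in_itvoo R (f v - n.+1%:R^-1) (f v + n.+1%:R^-1); first by rewrite ltrD2l gtrN.
rewrite in_itv/= => /andP[q1 q2].
have Ev : E (q, n) v by rewrite /E /= ltr_norml; apply/andP; split; move: n0 q1 q2; move: (n.+1%:R^-1) => ?; lra.
have [K hK] : exists K : R, forall g, G g -> K <= d g -> T g v ->
    ((expR (alpha * d g))%:E * \int[mu x]_(u in T g) (h (q, n) u)%:E <= (n.+1%:R^-1)%:E)%E.
  apply: contrapT => hK; apply: vN; exists (q, n) => //; split => //; split => // K.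
  apply: contrapT => hg; apply: hK; exists K => g Gg gK Tg.
  by rewrite leNgt; apply/negP => lt; apply: hg; exists g.
exists K => g Gg gK Tg; have mT : measurable (T g) := measurable_shadow x g r.
have {hK} := hK g Gg gK Tg.
have fT : (\int[mu x]_(u in T g) (h (q, n) u)%:E)%E \is a fin_num.
  by apply: integrable_fin_num => //; apply: (integrableS _ _ _ (ih (q, n))).
have fm : mu x (T g) \is a fin_num by exact: fin_num_measure.
have := hc g Gg; rewrite -/(T g) -(fineK fT) -(fineK fm) -!EFinM !lee_fin => c1 c2.
set s : R := n.+1%:R^-1 in n0 hn q1 q2 c2 Ev.
apply: (@le_trans _ _ (\int[mu x]_(u in T g) ((h (q, n) u)%:E + (2 * s)%:E))%E).
  apply: ge0_le_integral => //.
  - by apply/measurable_EFinP; exact: measurable_funS (mn _).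
  - by apply: emeasurable_funD => //; apply/measurable_EFinP; exact: measurable_funS (mh _).
  move=> u Tu; rewrite -EFinD lee_fin.
  have e1 : `|f u - f v| <= `|f u - ratr q| + s.
    have -> : f u - f v = (f u - ratr q) + (ratr q - f v) by lra.
    apply: (le_trans (ler_normD _ _)); rewrite lerD2l.
    by rewrite distrC ltW.
  apply: (le_trans e1); rewrite /h indicE.
  have [Eu|nE] := pselect (E (q, n) u).
    rewrite memNset ?mulr0; last by move=> /(_ Eu).
    by move: Eu; rewrite /E /= -/s => Eu; lra.
  by rewrite mem_set// mulr1 lerD2l; lra.
rewrite ge0_integralD//; last 3 first.
- by move=> u _; rewrite lee_fin.
- by apply/measurable_EFinP; exact: measurable_funS (mh _).
- by move=> u _; rewrite lee_fin; lra.
rewrite integral_cst// -(fineK fT) -[X in (_ * X)%E](fineK fm) -EFinM -EFinD lee_fin.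
have E0 := expR_gt0 (- alpha * d g).
have {}c2 : fine (\int[mu x]_(u in T g) (h (q, n) u)%:E)%E <= s * expR (- alpha * d g).
  by rewrite mulNr expRN ler_pdivlMr ?expR_gt0// mulrC.
have hn' : s * (1 + 2 * c) <= e by rewrite -ler_pdivlMr ?ltW//; lra.
apply: (@le_trans _ _ (s * (1 + 2 * c) * expR (- alpha * d g))); last by rewrite ler_wpM2r// ltW.
have := ler_wpM2l (ltW (mulr_gt0 (ltr0n _ 2) n0)) c1; rewrite -/s.
move: (fine _) (fine _) (expR _) c2 => a b t; lra.
Qed.

End LebesguePoints.

(** * Integrals of almost everywhere equal functions and weighted averages *)

Section NonmeasurableIntegrands.
Context d (T : measurableType d) (R : realType) (m : {measure set T -> \bar R}).
Local Open Scope ereal_scope.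
Import HBNNSimple.

Let ge0_ae_le (f g : T -> \bar R) (N : set T) : measurable N -> m N = 0 ->
  (forall x, 0 <= f x) -> (forall x, 0 <= g x) -> (forall x, ~ N x -> f x = g x) ->
  \int[m]_x f x <= \int[m]_x g x.
Proof.
move=> mN N0 f0 g0 fg; rewrite !ge0_integralTE//.
have mNc : measurable (~` N) by exact: measurableC.
apply: ge_ereal_sup => _ [h /= hf <-].
apply: ereal_sup_ubound; exists (proj_nnsfun h mNc) => /=.
  move=> x; rewrite /mindic /= indicE; have [Nx|Nx] := pselect (N x).
    by rewrite memNset ?mulr0//= => /(_ Nx).
  by rewrite mem_set//= mulr1 -fg.
rewrite -!integralT_nnsfun; apply: ae_eq_integral => //.
- exact/measurable_EFinP.
- exact/measurable_EFinP.
exists N; split => // x /= hx; apply: contrapT => Nx; apply: hx => _.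
by rewrite /= /mindic indicE mem_set// mulr1.
Qed.

(* No measurability is needed: integrals of nonnegative functions are suprema
   over the simple functions below them. *)
Lemma ae_eq_integral_nonmeasurable (D : set T) (f g : T -> \bar R) :
  {ae m, forall x, D x -> f x = g x} -> \int[m]_(x in D) f x = \int[m]_(x in D) g x.
Proof.
move=> [N [mN N0 NP]].
have fg x : ~ N x -> (f \_ D) x = (g \_ D) x.
  move=> Nx; rewrite /patch; case: ifPn => //; rewrite inE => Dx.
  by apply: contrapT => h; apply: Nx; apply: NP => /(_ Dx).
rewrite integral_mkcond [RHS]integral_mkcond integralE [RHS]integralE.
by congr (_ - _); apply/eqP; rewrite eq_le; apply/andP; split;
  apply: (ge0_ae_le mN N0) => // x Nx; rewrite ?funeposE ?funenegE fg.
Qed.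

End NonmeasurableIntegrands.

Section WeightedAverages.
Context d (T : measurableType d) (R : realType) (m : {finite_measure set T -> \bar R}).

Lemma integrable_bounded_mul (D : set T) (psi f : T -> R) (M : R) : measurable D ->
  measurable_fun setT psi -> (forall x, 0 <= psi x <= M) ->
  m.-integrable D (EFin \o f) -> m.-integrable D (EFin \o (psi \* f)).
Proof.
move=> mD mpsi hpsi hf.
have mf : measurable_fun D f by apply/measurable_EFinP; exact: measurable_int hf.
have hM := integrableZl mD M hf.
apply: (le_integrable mD _ _ hM).
  by apply/measurable_EFinP; apply: measurable_funM => //; exact: measurable_funS mpsi.
move=> x _ /=; have /andP[p0 pM] := hpsi x.
by rewrite lee_fin !normrM ler_wpM2r// !ger0_norm// (le_trans p0).
Qed.

Lemma weighted_average (D : set T) (psi f : T -> R) (M a B Q : R) : measurable D ->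
  measurable_fun setT psi -> (forall x, 0 <= psi x <= M) ->
  m.-integrable D (EFin \o f) -> 0 < Q ->
  (Q%:E <= \int[m]_(x in D) (psi x)%:E)%E ->
  (\int[m]_(x in D) (psi x * `|f x - a|)%:E <= B%:E)%E ->
  `|(\int[m]_(x in D) (psi x * f x)) / (\int[m]_(x in D) psi x) - a| <= B / Q.
Proof.
move=> mD mpsi hpsi hf Q0 hQ hB.
have h1 : m.-integrable D (EFin \o cst (1 : R)) := finite_measure_integrable_cst m 1 mD.
have ipsi : m.-integrable D (EFin \o psi).
  have := integrable_bounded_mul mD mpsi hpsi h1.
  by apply: eq_integrable => // x _ /=; rewrite mulr1.
have ipf := integrable_bounded_mul mD mpsi hpsi hf.
have ha : m.-integrable D (EFin \o (fun x => f x - a)).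
  have := integrableB mD hf (finite_measure_integrable_cst m a mD).
  by apply: eq_integrable => // x _ /=.
have ipfa := integrable_bounded_mul mD mpsi hpsi ha.
set I := \int[m]_(x in D) psi x.
have QI : Q <= I by rewrite -lee_fin /I /Rintegral fineK//; exact: integrable_fin_num.
have I0 : 0 < I by exact: lt_le_trans QI.
have -> : (\int[m]_(x in D) (psi x * f x)) / I - a =
    (\int[m]_(x in D) (psi x * (f x - a))) / I.
  have -> : \int[m]_(x in D) (psi x * (f x - a)) =
      \int[m]_(x in D) (psi x * f x) - \int[m]_(x in D) (psi x * a).
    rewrite -RintegralB//.
      by apply: eq_Rintegral => x _; rewrite mulrBr.
    exact: (integrable_bounded_mul mD mpsi hpsi (finite_measure_integrable_cst m a mD)).
  by rewrite RintegralZr// -/I; field; exact: lt0r_neq0.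
rewrite normrM normfV (gtr0_norm I0).
have num : `|\int[m]_(x in D) (psi x * (f x - a))| <= B.
  apply: (le_trans (le_normr_Rintegral mD ipfa)).
  rewrite -lee_fin /Rintegral fineK.
    apply: le_trans hB; rewrite le_eqVlt; apply/orP; left; apply/eqP.
    apply: eq_integral => x _; have /andP[p0 _] := hpsi x.
    by rewrite normrM (ger0_norm p0).
  by apply: integrable_fin_num => //; have := integrable_norm ipfa.
have B0 : 0 <= B by exact: le_trans num.
by rewrite ler_pM// ?invr_ge0 ?(ltW I0)// lef_pV2.
Qed.

Lemma integral_sum_indic (D : set T) (n : nat) (b : nat -> R) (S : nat -> set T)
    (F : T -> R) : measurable D -> (forall k, 0 <= b k) -> (forall k, measurable (S k)) ->
  (forall k, S k `<=` D) -> measurable_fun D F -> (forall x, 0 <= F x) ->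
  (\int[m]_(x in D) (\sum_(k < n) b k * (\1_(S k) x * F x))%:E =
   \sum_(k < n) (b k)%:E * \int[m]_(x in S k) (F x)%:E)%E.
Proof.
move=> mD b0 mS SD mF F0.
under eq_integral do rewrite -sumEFin.
have m1 (k : 'I_n) : measurable_fun D (fun x => (\1_(S k) x * F x)%:E).
  apply/measurable_EFinP; apply: measurable_funM => //; exact: measurable_indic.
rewrite ge0_integral_sum//; last 2 first.
- by move=> k; under eq_fun do rewrite EFinM; apply: measurable_funeM.
- by move=> k x _; rewrite lee_fin !mulr_ge0.
apply: eq_bigr => k _; under eq_integral do rewrite EFinM.
rewrite ge0_integralZl_EFin//; last by move=> x _; rewrite lee_fin mulr_ge0.
congr (_ * _)%E; rewrite integral_mkcond [RHS]integral_mkcond; congr (integral _ _ _).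
apply/funext => x; rewrite /patch indicE; have [Sx|Sx] := pselect (S k x).
  by rewrite !mem_set ?mul1r//; exact: SD Sx.
by rewrite (memNset Sx); case: ifP; rewrite ?mul0r.
Qed.

End WeightedAverages.

Lemma measurable_sqrt_trunc d (T : measurableType d) (R : realType) (f : T -> R) (M : R) :
  measurable_fun setT f -> measurable_fun setT (fun v => Num.min (f v `^ 2^-1) M).
Proof.
by move=> mf; apply: measurable_minr => //; exact: (measurableT_comp (@measurable_powR R _)).
Qed.

(** * Upper and lower bounds for the kernel *)

Section GeometricSum.
Context {R : realType}.
Variables (alpha : R) (al0 : 0 < alpha).

Lemma geometric_sum_le (N : nat) :
  (1 - expR (- alpha)) * \sum_(k < N.+1) expR (alpha * k%:R) <= expR (alpha * N%:R).
Proof.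
elim: N => [|N IH].
  rewrite big_ord1 mulr0 expR0 mulr1; have := expR_gt0 (- alpha); lra.
rewrite big_ord_recr /= mulrDr; apply: (le_trans (lerD IH (lexx _))).
have -> : expR (alpha * N%:R) = expR (- alpha) * expR (alpha * N.+1%:R).
  by rewrite -expRD -natr1; congr expR; ring.
by rewrite -mulrDl addrC subrK mul1r.
Qed.

(** Used with s = (y | W) and t k the indicator of the shadow at depth k: the kernel exp(alpha s)
    dominates the sum of its values over all the levels that W reaches. *)
Lemma truncated_geometric_sum (N : nat) (s : R) (t : nat -> R) : 0 <= s ->
  (forall k, 0 <= t k <= 1) -> (forall k, s < k%:R -> t k = 0) ->
  (1 - expR (- alpha)) * \sum_(k < N) expR (alpha * k%:R) * t k <= expR (alpha * s).
Proof.
move=> s0 t01 ts; have q0 : 0 <= 1 - expR (- alpha).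
  by rewrite subr_ge0 expR_le1 oppr_le0 ltW.
elim: N => [|N IH]; first by rewrite big_ord0 mulr0 expR_ge0.
have [Ns|sN] := leP N%:R s; last by rewrite big_ord_recr /= ts// mulr0 addr0.
apply: (@le_trans _ _ (expR (alpha * N%:R))); last by rewrite ler_expR ler_pM2l.
apply: le_trans (geometric_sum_le N); rewrite ler_wpM2l//; apply: ler_sum => k _.
by rewrite ler_piMr ?expR_ge0//; have /andP[] := t01 k.
Qed.

End GeometricSum.

Section KernelBounds.
Context {R : realType} {X : pointedMetricType R}.
Hypothesis h4 : four_point_condition X.
Variables (G : set (X -> X)) (x : X) (D : R).
Hypotheses (hG : isometry_group G) (D0 : 0 <= D) (hD : quasi_convex_orbit G x D).
Implicit Types (g : nat -> X -> X) (V W : gboundary X) (y : X).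

Definition follows g V := forall k, [/\ G (g k), `|mdist x (g k x) - k%:R| <= D &
  k%:R - D - 7 <= gpb x (g k x) V].

Lemma follows_ex V : lims G x V -> exists g, follows g V.
Proof.
move=> lV; have /choice[g hg] : forall k : nat, exists h, [/\ G h,
    `|mdist x (h x) - k%:R| <= D & k%:R - D - 7 <= gpb x (h x) V].
  by move=> k; exact: (orbit_approx h4 D0 hD (ler0n _ k) (lV _)).
by exists g.
Qed.

(** The term that dominates has index k, the integer part of (y | W) capped at n. Up to depth k, W
    is close to y, y to w, w to V and V to g k x; these four comparisons cost 28. When k = n the
    product may be as large as d(x, y), whence the additional exponential. *)
Lemma kernel_upper (alpha c : R) g V w y (n : nat) : 0 < alpha -> 0 <= c ->
  follows g V -> mdist x y - c <= gpb x y w ->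
  (n%:R%:E <= gprod x (Bd w) (Bd V))%E -> forall W,
  expR (alpha * gpb x y W) <= \sum_(k < n.+1)
    (expR (alpha * k.+1%:R) + ((k : nat) == n)%:R * expR (alpha * mdist x y)) *
    \1_(shadow x (g k) (2 * D + c + 28)) (Bd W).
Proof.
move=> al0 c0 gV hw hn W; set s := gpb x y W.
have s0 : 0 <= s := gpb_ge0 _ _ _.
have sd : s <= mdist x y := gpb_le _ _ _.
have [k [kn ks sk]] : exists k : nat, [/\ (k <= n)%N, k%:R <= s & (k < n)%N -> s < k.+1%:R].
  have [sn|ns] := ltP s n%:R; last by exists n; split => //; rewrite ltnn.
  exists (Num.truncn s); have /andP[h1 h2] := truncn_itv s0; split => //.
  by rewrite -(ler_nat R); apply: ltW; exact: le_lt_trans h1 sn.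
have kl : (k < n.+1)%N by [].
rewrite (bigD1 (Ordinal kl)) //=.
have rest : 0 <= \sum_(i < n.+1 | i != Ordinal kl)
    (expR (alpha * i.+1%:R) + ((i : nat) == n)%:R * expR (alpha * mdist x y)) *
    \1_(shadow x (g i) (2 * D + c + 28)) (Bd W).
  by apply: sumr_ge0 => i _; rewrite mulr_ge0// addr_ge0 ?mulr_ge0 ?expR_ge0.
apply: ler_wpDr => //.
have kn' : k%:R <= n%:R :> R by rewrite ler_nat.
have D0' := D0; have [Gg gk gkV] := gV k.
have hW : shadow x (g k) (2 * D + c + 28) (Bd W).
  apply: sub_shadow; move: gk; rewrite ler_norml => /andP[gk1 gk2].
  have e1 : ((k%:R - c)%:E <= gprod x (Bd W) (Pt y))%E.
    by rewrite gprodC -gpb_ge// -/s; lra.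
  have e2 : ((k%:R - c)%:E <= gprod x (Pt y) (Bd w))%E.
    by rewrite -gpb_ge//; lra.
  have e3 := gprod_four_point h4 e1 e2.
  have e5 : ((k%:R - c - 7)%:E <= gprod x (Bd w) (Bd V))%E.
    by apply: le_trans hn; rewrite lee_fin; lra.
  have e6 := gprod_four_point h4 e3 e5.
  have e7 : ((k%:R - D - c - 21)%:E <= gprod x (Pt (g k x)) (Bd V))%E.
    by rewrite -gpb_ge//; lra.
  have e8 : ((k%:R - D - c - 21)%:E <= gprod x (Bd V) (Bd W))%E.
    by rewrite gprodC; apply: le_trans e6; rewrite lee_fin; lra.
  rewrite gpb_ge//; apply: le_trans (gprod_four_point h4 e7 e8).
  by rewrite lee_fin; lra.
rewrite indicE mem_set// mulr1; have [e|ne] := eqVneq k n.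
  by rewrite mul1r ler_wpDl ?expR_ge0// ler_expR ler_pM2l.
rewrite mul0r addr0 ler_expR ler_pM2l// ltW// sk//.
by rewrite ltn_neqAle ne.
Qed.

Lemma kernel_lower (r : R) : exists L : R, 0 <= L /\ forall y (g0 : X -> X), G g0 ->
  mdist y (g0 x) <= D -> forall k : nat, k%:R + L <= mdist x y ->
  exists h, [/\ G h, mdist x (h x) <= k%:R + L &
    forall W, shadow x h r (Bd W) -> k%:R <= gpb x y W].
Proof.
have D0' := D0; pose L := 4 * D + `|r| + 40.
have r0 := normr_ge0 r; have r1 := ler_norm r.
exists L; split; first by rewrite /L; lra.
move=> y g0 Gg0 yg0 k kL; have k0 : 0 <= k%:R :> R := ler0n _ _.
have d0 : mdist x y - D <= mdist x (g0 x).
  by have := metric_triangle x (g0 x) y; rewrite (metric_sym (g0 x)); lra.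
(* Aiming at depth k + L - D keeps h x within k + L of x; L is large enough for the shadow of h to
   stay at depth k as seen towards y. *)
have [|h [Gh h1 h2 h3]] := orbit_midpoint hD Gg0 (t := k%:R + L - D).
  by rewrite /L in kL *; apply/andP; split; lra.
move: h1; rewrite ler_norml => /andP[h1 h1'].
exists h; split => //; first lra.
move=> W hW; have hW' := shadow_gpb h4 hW.
have e1 : k%:R + L - 2 * D - `|r| - 7 <= gpb x (h x) W by lra.
have e2 : k%:R + L - 2 * D - `|r| - 7 <= gromov_product x (g0 x) (h x).
  by rewrite gromov_productC; lra.
have := gpb_gromov h4 e2 e1; rewrite !gpb_ge// => e3.
apply: le_trans (gprod_lip h4 y e3); rewrite lee_fin (metric_sym (g0 x)) /L; lra.
Qed.

End KernelBounds.

Section VisualMetric.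
Context {R : realType} {X : metricType R}.
Hypothesis h4 : four_point_condition X.

Lemma visual_dist_gprod (x : X) (V W : gboundary X) (t : R) :
  visual_dist x (Bd V) (Bd W) <= expR (- t) -> (t%:E <= gprod x (Bd V) (Bd W))%E.
Proof.
rewrite /visual_dist; case: eqP => [[->] _|VW]; first by rewrite gprod_bd_same// leey.
have g0 : (0%:E <= gprod x (Bd V) (Bd W))%E.
  have [u Vu] := end_ex V; have [v Wv] := end_ex W.
  apply: (@gprod_ge _ _ x (Bd V) (Bd W) u v _ Vu Wv).
  by near=> n; exact: gromov_product_ge0.
(* [fine] sends both infinite values to 0: at +oo the conclusion holds anyway, and -oo is excluded
   by [g0]. *)
case: (gprod _ _ _) g0 => [s| |] //= _; last by rewrite leey.
by rewrite ler_expR lerN2 lee_fin.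
Unshelve. all: by end_near. Qed.

End VisualMetric.

(** * Convergence of the averages against the kernel *)

Section PoissonAverages.
Context {R : realType} {X : pointedMetricType R}.
Hypothesis h4 : four_point_condition X.
Variables (G : set (X -> X)) (alpha : R)
  (mu : X -> {finite_measure set (gborel X) -> \bar R}) (x : X) (D : R).
Hypotheses (hmu : conformal_density G alpha mu) (al0 : 0 < alpha).
Hypotheses (hG : isometry_group G) (D0 : 0 <= D) (hD : quasi_convex_orbit G x D).
Hypothesis hfin : forall r, finite_set [set g | G g /\ mdist x (g x) <= r].
Hypothesis hdiv : unbounded_sums G (fun g => expR (- alpha * mdist x (g x))).
Implicit Types (y z : X) (g : X -> X) (V W : gboundary X).

Let b : set (gborel X) := bdry X.
Let mb : measurable b := @measurable_bdry R X.

(* The Poisson kernel is not known to be measurable; [psi] comes from a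
   Radon-Nikodym derivative. *)
Definition half_kernel y (psi : gborel X -> R) :=
  [/\ measurable_fun setT psi, forall v, 0 <= psi v <= expR (alpha / 2 * mdist x y) &
   {ae mu x, forall v, bdry X v -> psi v = poisson x y v `^ (alpha / 2)}].

Lemma half_kernelE y V :
  poisson x y (Bd V) `^ (alpha / 2) = expR (- (alpha / 2 * mdist x y)) * expR (alpha * gpb x y V).
Proof. by rewrite /poisson -expRM busemannE -expRD; congr expR; field. Qed.

(** The density is almost everywhere the kernel to the power alpha, hence the square root.
    Truncating at the largest value the kernel can take, as (y | v) <= d(x, y), makes the bound hold
    everywhere. *)
Lemma half_kernel_ex y : exists psi, half_kernel y psi.
Proof.
have [r [mr r0 re _]] := density_ex hmu x y.
exists (fun v => Num.min (r v `^ 2^-1) (expR (alpha / 2 * mdist x y))); split.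
- exact: measurable_sqrt_trunc.
- by move=> v; rewrite le_min powR_ge0 expR_ge0 ge_min lexx orbT.
apply: filterS re => v e [V _ eV]; subst v; rewrite e /poisson -!expRM busemannE.
rewrite min_l; first by congr expR; field.
rewrite ler_expR; have := ler_wpM2l (ltW al0) (gpb_le x y V); lra.
Qed.

Lemma half_kernel_lower : mu x (bdry X) != 0 -> exists Q d0 : R, 0 < Q /\
  forall y g0 psi, G g0 -> mdist y (g0 x) <= D -> d0 <= mdist x y -> half_kernel y psi ->
  ((Q * mdist x y * expR (- (alpha / 2 * mdist x y)))%:E <=
    \int[mu x]_(v in b) (psi v)%:E)%E.
Proof.
move=> mu0; have [c [r [c0 hc]]] := shadow_lower h4 hmu al0 hG D0 hD hfin hdiv mu0.
have [L [L0 hL]] := kernel_lower h4 D0 hD r.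
pose q := 1 - expR (- alpha).
have q0 : 0 < q by rewrite subr_gt0 expR_lt1 oppr_lt0.
(* Each level contributes q c exp(- alpha L) times a common factor, with q from the geometric sum;
   once d >= 2L there are at least d / 2 levels. *)
exists (q * c * expR (- alpha * L) / 2), (2 * L); split.
  by rewrite divr_gt0// !mulr_gt0// expR_gt0.
move=> y g0 psi Gg0 yg0 yd [mpsi psi01 psiE].
have /choice[h hh] : forall k : nat, exists h, k%:R + L <= mdist x y ->
    [/\ G h, mdist x (h x) <= k%:R + L & forall W, shadow x h r (Bd W) -> k%:R <= gpb x y W].
  move=> k; have [kL|kL] := pselect (k%:R + L <= mdist x y); last by exists id.
  by have [h hh] := hL y g0 Gg0 yg0 k kL; exists h.
(* Beyond depth d - L nothing is known of [h k], and the level is left empty. *)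
pose S (k : nat) : set (gborel X) :=
  if `[< k%:R + L <= mdist x y >] then shadow x (h k) r else set0.
have mS k : measurable (S k).
  by rewrite /S; case: ifP => // _; exact: measurable_shadow.
have Sb k : S k `<=` b by rewrite /S; case: ifP => _; [exact: shadow_bdry | exact: sub0set].
pose E := expR (- (alpha / 2 * mdist x y)); have E0 : 0 < E := expR_gt0 _.
pose a (k : nat) := q * E * expR (alpha * k%:R).
have a0 k : 0 <= a k by rewrite !mulr_ge0// ?expR_ge0// ltW.
pose N := (Num.truncn (mdist x y - L)).+1.
have dL0 : 0 <= mdist x y - L by lra.
have /andP[N1 N2] := truncn_itv dL0; rewrite -/N in N2.
apply: (@le_trans _ _ (\int[mu x]_(v in b) (\sum_(k < N) a k * (\1_(S k) v * 1))%:E)%E).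
  rewrite (integral_sum_indic (mu x) N (F := cst 1) mb a0 mS Sb)//.
  have hk (k : 'I_N) : ((q * E * c * expR (- alpha * L))%:E <=
      (a k)%:E * \int[mu x]_(v in S k) (cst 1 v)%:E)%E.
    have kL : k%:R + L <= mdist x y.
      rewrite -lerBrDr; apply: le_trans N1; rewrite ler_nat -ltnS; exact: ltn_ord.
    have [Gh dh _] := hh k kL.
    have Sk : S k = shadow x (h k) r by rewrite /S ifT//; exact/asboolP.
    have -> : (\int[mu x]_(v in S k) (cst 1 v)%:E = mu x (S k))%E.
      by rewrite -[RHS]mul1e -(integral_cst (mu x) (mS k)).
    have ak : (0 <= (a k)%:E)%E by rewrite lee_fin.
    rewrite Sk; apply: le_trans (lee_wpmul2l ak (hc _ Gh)).
    rewrite -EFinM lee_fin /a.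
    have -> : q * E * expR (alpha * k%:R) * (c * expR (- alpha * mdist x (h k x))) =
        q * E * c * expR (alpha * k%:R - alpha * mdist x (h k x)).
      by rewrite expRD mulNr; ring.
    rewrite ler_pM2l ?mulr_gt0// ler_expR.
    by have := ler_wpM2l (ltW al0) dh; lra.
  apply: (@le_trans _ _ (\sum_(k < N) (q * E * c * expR (- alpha * L))%:E)%E); last first.
    by apply: lee_sum => k _; exact: hk.
  rewrite sumEFin lee_fin sumr_const card_ord -[leRHS]mulr_natr.
  have c1 : 0 <= q * E * c * expR (- alpha * L) by rewrite !mulr_ge0 ?expR_ge0// ltW.
  have hN : mdist x y / 2 <= N%:R by apply: le_trans (ltW N2); lra.
  apply: le_trans (ler_wpM2l c1 hN); rewrite -/E le_eqVlt; apply/orP; left; apply/eqP.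
  by field.
apply: ae_ge0_le_integral => //.
- by move=> v _; rewrite lee_fin; apply: sumr_ge0 => k _; rewrite mulr_ge0// mulr1 indicE.
- apply/measurable_EFinP; apply: measurable_sum => k.
  by apply: measurable_funM => //; apply: measurable_funM => //; exact: measurable_indic.
- by move=> v _; rewrite lee_fin; have /andP[] := psi01 v.
- by apply/measurable_EFinP; exact: measurable_funS mpsi.
apply: negligibleS psiE => v /= hv ve; apply: hv => bv; rewrite lee_fin ve//.
have [V _ eV] := bv; subst v; rewrite half_kernelE -/E.
have := @truncated_geometric_sum R alpha al0 N (gpb x y V) (fun k => \1_(S k) (Bd V)) (gpb_ge0 _ _ _).
have h1 (k : nat) : 0 <= (\1_(S k) (Bd V) : R) <= 1 by rewrite indicE; case: (_ \in _); rewrite /= ?lexx ?ler01.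
have h2 (k : nat) : gpb x y V < k%:R -> \1_(S k) (Bd V) = 0 :> R.
  move=> lt; rewrite indicE memNset// => hS; move: hS lt; rewrite /S.
  case: asboolP => // kL hS; have [_ _ /(_ V hS)] := hh k kL.
  by rewrite leNgt => /negP.
move=> /(_ h1 h2) h3; rewrite -(ler_pM2l E0) in h3.
apply: le_trans h3; rewrite mulrA [E * _]mulrC mulr_sumr.
by under [leLHS]eq_bigr do rewrite mulr1 -mulrA.
Qed.

Lemma half_kernel_upper (c : R) (g : nat -> X -> X) V w y psi (n : nat) (F : gborel X -> R) :
  0 <= c -> follows G x D g V -> half_kernel y psi -> mdist x y - c <= gpb x y w ->
  (n%:R%:E <= gprod x (Bd w) (Bd V))%E -> measurable_fun b F -> (forall v, 0 <= F v) ->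
  (\int[mu x]_(v in b) (psi v * F v)%:E <= \sum_(k < n.+1)
    (expR (- (alpha / 2 * mdist x y)) *
      (expR (alpha * k.+1%:R) + ((k : nat) == n)%:R * expR (alpha * mdist x y)))%:E *
    \int[mu x]_(v in shadow x (g k) (2 * D + c + 28)) (F v)%:E)%E.
Proof.
move=> c0 gV [mpsi psi01 psiE] hw hn mF F0.
pose a (k : nat) : R := expR (- (alpha / 2 * mdist x y)) *
      (expR (alpha * k.+1%:R) + (k == n)%:R * expR (alpha * mdist x y)).
pose S (k : nat) := shadow x (g k) (2 * D + c + 28).
have a0 k : 0 <= a k by rewrite mulr_ge0 ?expR_ge0// addr_ge0 ?mulr_ge0 ?expR_ge0.
have mS k : measurable (S k) := measurable_shadow _ _ _.
have Sb k : S k `<=` b by exact: shadow_bdry.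
rewrite -(integral_sum_indic (mu x) n.+1 mb a0 mS Sb mF F0).
apply: ae_ge0_le_integral => //.
- by move=> v _; rewrite lee_fin mulr_ge0//; have /andP[] := psi01 v.
- apply/measurable_EFinP; apply: measurable_funM => //; exact: measurable_funS mpsi.
- by move=> v _; rewrite lee_fin; apply: sumr_ge0 => k _; rewrite !mulr_ge0.
- apply/measurable_EFinP; apply: measurable_sum => k.
  by apply: measurable_funM => //; apply: measurable_funM => //; exact: measurable_indic.
apply: negligibleS psiE => v /= hv ve; apply: hv => bv; rewrite lee_fin ve//.
have [W _ eW] := bv; subst v; rewrite half_kernelE.
have := kernel_upper h4 D0 al0 c0 gV hw hn W.
move=> /(ler_wpM2l (expR_ge0 (- (alpha / 2 * mdist x y))))/(ler_wpM2r (F0 (Bd W))).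
move/le_trans; apply; rewrite mulr_sumr mulr_suml; apply: ler_sum => k _.
by rewrite /a /S !mulrA.
Qed.

Lemma half_kernel_cvg (c : R) (f : gborel X -> R) : 0 <= c -> mu x (bdry X) != 0 ->
  (mu x).-integrable b (EFin \o f) ->
  {ae mu x, forall v, bdry X v -> forall C e : R, 0 < C -> 0 < e ->
    exists d1 : R, forall y g0 w psi, G g0 -> mdist y (g0 x) <= D -> d1 <= mdist x y ->
    mdist x y - c <= gpb x y w -> half_kernel y psi ->
    visual_dist x (Bd w) v <= C * mdist x y `^ alpha^-1 * expR (- mdist x y) ->
    `|(\int[mu x]_(u in b) (psi u * f u)) / (\int[mu x]_(u in b) psi u) - f v| <= e}.
Proof.
move=> c0 mu0 intf.
have [Q [d0 [Q0 hQ]]] := half_kernel_lower mu0.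
pose r := 2 * D + c + 28.
have intf0 : (mu x).-integrable setT (EFin \o (fun v => f v * \1_b v)).
  have /(integrable_mkcond _ mb) := intf; apply: eq_integrable => // v _ /=.
  by rewrite /patch indicE; case: (v \in b); rewrite ?mulr1 ?mulr0.
have leb := lebesgue_points h4 hmu al0 hG hfin r intf0.
have off := mu_off_limit h4 hmu al0 hG D0 hD hfin hdiv.
apply: negligibleS (negligibleU leb off) => v /= hv.
apply: contrapT => /not_orP[/contrapT lv ov]; apply: hv => bv C e C0 e0.
have [V _ eV] := bv; subst v.
have lV : lims G x V.
  by apply: contrapT => lV; apply: ov; split => // -[W lW [WV]]; apply: lV; rewrite -WV.
have [g gV] := follows_ex h4 D0 hD lV.
pose F u : R := `|f u - f (Bd V)|.
have iF : (mu x).-integrable b (EFin \o F).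
  have := integrable_abse (integrableB mb intf (finite_measure_integrable_cst (mu x) (f (Bd V)) mb)).
  by apply: eq_integrable => // u _ /=.
have mF : measurable_fun b F by apply/measurable_EFinP; exact: measurable_int iF.
have F0 u : 0 <= F u by exact: normr_ge0.
pose Ca := expR (alpha * ln C); have Ca0 : 0 < Ca := expR_gt0 _.
pose A1 := expR (alpha * (D + 1)); have A10 : 0 < A1 := expR_gt0 _.
(* Sized so that the levels from k0 on use half of e Q d: they sum to at most eps A1 (n + 1 + 1 + Ca
   d), and this is at most eps A1 (3 + Ca) d since n <= d and d >= 1. *)
pose eps := e * Q / (2 * A1 * (3 + Ca)).
have eps0 : 0 < eps by rewrite divr_gt0 ?mulr_gt0//; lra.
have epsE : eps = e * Q / (2 * A1 * (3 + Ca)) by [].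
clearbody eps.
have [K0 hK0] := lv bv eps eps0.
have [k0 _ /(_ k0 (leqnn k0)) /= hk0] := nbhs_infty_ger (K0 + D).
pose T (k : nat) := shadow x (g k) r.
have mT k : measurable (T k) := measurable_shadow _ _ _.
have Tb k : T k `<=` b by exact: shadow_bdry.
have fT k : (\int[mu x]_(u in T k) (F u)%:E)%E \is a fin_num.
  by apply: integrable_fin_num => //; apply: (integrableS _ _ _ iF).
have fb : (\int[mu x]_(u in b) (F u)%:E)%E \is a fin_num by exact: integrable_fin_num.
pose I k := fine (\int[mu x]_(u in T k) (F u)%:E)%E.
pose M := fine (\int[mu x]_(u in b) (F u)%:E)%E.
have M0 : 0 <= M by apply: fine_ge0; apply: integral_ge0 => u _; rewrite lee_fin.
have IM k : I k <= M.
  rewrite -lee_fin /I /M !fineK//; apply: ge0_subset_integral => //.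
    by apply/measurable_EFinP.
  by move=> u _; rewrite lee_fin.
have Ismall k : (k0 <= k)%N -> I k <= eps * expR (alpha * D) * expR (- alpha * k%:R).
  move=> kk; have [Gk gk gkV] := gV k.
  have kk' : k0%:R <= k%:R :> R by rewrite ler_nat.
  have TV : T k (Bd V).
    by apply: sub_shadow; move: gk; rewrite ler_norml /r => /andP[]; lra.
  move: gk; rewrite ler_norml => /andP[gk1 gk2].
  have Kd : K0 <= mdist x (g k x) by lra.
  have := hK0 (g k) Gk Kd TV.
  have -> : (\int[mu x]_(u in shadow x (g k) r) `|f u * \1_b u - f (Bd V) * \1_b (Bd V)|%:E =
      \int[mu x]_(u in T k) (F u)%:E)%E.
    apply: eq_integral => u; rewrite inE => /Tb bu.
    by rewrite /F !indicE !mem_set// !mulr1.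
  rewrite -(fineK (fT k)) lee_fin => /le_trans; apply.
  rewrite -mulrA ler_pM2l// -expRD ler_expR.
  by have := ler_wpM2l (ltW al0) gk1; lra.
pose M1 := M * \sum_(k < k0) expR (alpha * k.+1%:R).
have M10 : 0 <= M1 by rewrite mulr_ge0// sumr_ge0// => k _; exact: expR_ge0.
pose l1 := k0%:R + `|ln (2 / alpha) / alpha| + `|ln C|.
exists (Num.max d0 (Num.max 1 (Num.max (2 * M1 / (Q * e)) (2 * l1)))).
move=> y g0 w psi Gg0 yg0; rewrite !ge_max => /and4P[d0y d1y d2y d3y] hw hpsi hvis.
set d := mdist x y in d0y d1y d2y d3y hw hvis *.
have dgt0 : 0 < d by lra.
(* Chosen so that exp(- K') is exactly the radius C d^(1 / alpha) exp(- d) of the approach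
   region. *)
pose K' := d - ln d / alpha - ln C.
have hK' : (K'%:E <= gprod x (Bd w) (Bd V))%E.
  apply: visual_dist_gprod => //; apply: (le_trans hvis).
  rewrite /powR gt_eqF// -[X in X * _ * _]lnK ?posrE// -!expRD ler_expR /K'.
  by rewrite [alpha^-1 * _]mulrC; lra.
(* From ln t <= t at t = alpha d / 2. Hence K' >= d / 2 - O(1), which exceeds k0 once d >= 2 l1. *)
have hln : ln d / alpha <= d / 2 + `|ln (2 / alpha) / alpha|.
  have t0 : 0 < alpha * d / 2 by rewrite divr_gt0// mulr_gt0.
  have : ln (alpha * d / 2) <= alpha * d / 2.
    by have := expR_ge1Dx (ln (alpha * d / 2)); rewrite lnK ?posrE//; lra.
  have lnd : ln d = ln (alpha * d / 2) + ln (2 / alpha).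
    have de : alpha * d / 2 * (2 / alpha) = d by field; exact: lt0r_neq0.
    by rewrite -[in LHS]de lnM ?posrE ?divr_gt0 ?mulr_gt0.
  move=> h; rewrite lnd mulrDl lerD ?ler_norm//.
  rewrite ler_pdivrMr//; apply: (le_trans h); rewrite le_eqVlt; apply/orP; left; apply/eqP.
  by ring.
have k0d : k0%:R <= d /\ k0%:R <= K'.
  have := ler_norm (ln C); have := normr_ge0 (ln C).
  have := normr_ge0 (ln (2 / alpha) / alpha); have k00 : 0 <= k0%:R :> R := ler0n _ _.
  move: d3y hln; rewrite /l1 /K'; move: (`|ln (2 / alpha) / alpha|) (`|ln C|) (ln d / alpha) (k0%:R : R) k00.
  by move=> *; split; lra.
(* K' exceeds d when C is small, while counting the levels requires n <= d. *)
pose K := Num.min d K'.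
have Kk0 : k0%:R <= K by rewrite le_min k0d.1 k0d.2.
have K0' : 0 <= K by apply: le_trans Kk0; exact: ler0n.
pose n := Num.truncn K; have /andP[n1 n2] := truncn_itv K0'; rewrite -/n in n1 n2.
have nd : n%:R <= d by rewrite (le_trans n1)// ge_min lexx.
have k0n : (k0 <= n)%N by rewrite -ltnS -(ltr_nat R) (le_lt_trans Kk0).
have hn : (n%:R%:E <= gprod x (Bd w) (Bd V))%E.
  by apply: le_trans hK'; rewrite lee_fin (le_trans n1)// ge_min lexx orbT.
have tail : expR (alpha * (d - n%:R)) <= expR alpha * (1 + Ca * d).
  apply: (@le_trans _ _ (expR (alpha + alpha * (d - K)))).
    by rewrite ler_expR; have := ler_wpM2l (ltW al0) (ltW n2); rewrite -natr1; lra.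
  rewrite expRD ler_wpM2l ?expR_ge0// /K; have [dK|Kd] := leP d K'.
    by rewrite subrr mulr0 expR0 lerDl mulr_ge0// ltW.
  apply: ler_wpDl => //.
  have -> : alpha * (d - K') = alpha * ln C + ln d by rewrite /K'; field; exact: lt0r_neq0.
  by rewrite expRD lnK ?posrE.
pose E := expR (- (alpha / 2 * d)); have E0 : 0 < E := expR_gt0 _.
pose bk (k : nat) := expR (alpha * k.+1%:R) + (k == n)%:R * expR (alpha * d).
have bk0 k : 0 <= bk k by rewrite addr_ge0 ?mulr_ge0 ?expR_ge0.
have num : (\int[mu x]_(u in b) (psi u * F u)%:E <=
    (E * (M1 + eps * A1 * (3 + Ca) * d))%:E)%E.
  apply: (le_trans (half_kernel_upper c0 gV hpsi hw hn mF F0)).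
  rewrite -/d -/E; under eq_bigr => k _ do rewrite -/r -/(T k) -(fineK (fT k)) -EFinM -/(I k) -/(bk k) -mulrA.
  rewrite sumEFin lee_fin -mulr_sumr ler_pM2l//.
  have term (k : 'I_n.+1) : bk k * I k <= (if (k < k0)%N then expR (alpha * k.+1%:R) else 0) * M +
      eps * expR (alpha * D) * (bk k * expR (- alpha * k%:R)).
    case: ltnP => kk.
      have kn : ((k : nat) == n) = false by rewrite ltn_eqF ?(leq_trans kk).
      apply: ler_wpDr; first exact: mulr_ge0 (mulr_ge0 (ltW eps0) (expR_ge0 _)) (mulr_ge0 (bk0 _) (expR_ge0 _)).
      by rewrite /bk kn mul0r addr0 ler_wpM2l ?expR_ge0.
    rewrite mul0r add0r mulrCA; apply: ler_wpM2l => //.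
    exact: Ismall.
  apply: (@le_trans _ _ _ _ _ (ler_sum _ (fun k _ => term k))); rewrite big_split /=.
  apply: lerD.
    rewrite -mulr_suml mulrC ler_wpM2l// -big_mkcond /=.
    by rewrite (big_ord_widen n.+1 (fun k => expR (alpha * k.+1%:R))) ?leqW.
  rewrite -mulr_sumr.
  have -> : \sum_(k < n.+1) bk k * expR (- alpha * k%:R) =
      n.+1%:R * expR alpha + expR (alpha * (d - n%:R)).
    under eq_bigr do rewrite mulrDl; rewrite big_split /=; congr (_ + _).
      rewrite (eq_bigr (fun=> expR alpha)); last first.
        by move=> k _; rewrite -expRD -natr1; congr expR; ring.
      by rewrite sumr_const card_ord -[LHS]mulr_natl.
    rewrite big_ord_recr /= eqxx mul1r big1 ?add0r; last first.
      by move=> k _; rewrite ltn_eqF ?mul0r.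
    by rewrite -expRD; congr expR; ring.
  have A1E : A1 = expR (alpha * D) * expR alpha by rewrite -expRD; congr expR; ring.
  rewrite A1E -!mulrA; apply: ler_wpM2l; first exact: ltW.
  apply: ler_wpM2l; first exact: expR_ge0.
  apply: (le_trans (lerD (lexx _) tail)); rewrite [_ * expR alpha]mulrC -mulrDr.
  apply: ler_wpM2l; first exact: expR_ge0.
  by move: nd; rewrite -natr1; move: (n%:R : R) => a ad; lra.
have [mpsi psi01 _] := hpsi.
have den := hQ y g0 psi Gg0 yg0 d0y hpsi; rewrite -/d -/E in den.
have QdE : 0 < Q * d * E by rewrite !mulr_gt0.
apply: (le_trans (weighted_average mb mpsi psi01 intf QdE den num)).
rewrite ler_pdivrMr//.
have -> : e * (Q * d * E) = E * (e * Q * d) by ring.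
rewrite ler_pM2l//.
have -> : eps * A1 * (3 + Ca) = e * Q / 2.
  by rewrite epsE; field; rewrite !lt0r_neq0//; lra.
move: d2y; rewrite ler_pdivrMr ?mulr_gt0//; lra.
Qed.

End PoissonAverages.

(** * Complex-valued functions and the conclusion *)

Lemma norm_complex_lt (R : realType) (a b r : R) (z : R[i]) :
  `|a - complex.Re z| <= r / 3 -> `|b - complex.Im z| <= r / 3 -> 0 < r ->
  `|Complex a b - z| < real_complex R r.
Proof.
case: z => s t /= ha hb r0.
rewrite normc_def ltcR /=.
have r30 : 0 <= r / 3 by lra.
apply: (@le_lt_trans _ _ (Num.sqrt ((r / 3 + r / 3) ^+ 2))); last first.
  by rewrite sqrtr_sqr ger0_norm; lra.
rewrite ler_wsqrtr// -[(a - s) ^+ 2]real_normK ?num_real// -[(b - t) ^+ 2]real_normK ?num_real//.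
move: ha hb (normr_ge0 (a - s)) (normr_ge0 (b - t)); move: (`|a - s|) (`|b - t|) => p q *.
by nra.
Qed.

Section PoissonTransform.
Context {R : realType} {X : pointedMetricType R}.
Variables (alpha : R) (mu : X -> {finite_measure set (gborel X) -> \bar R}) (x : X).

(** [P0] integrates the kernel itself, of unknown measurability; an almost everywhere equal
    integrand has the same integral all the same, so [psi] may replace it in numerator and
    denominator. *)
Lemma P0_half_kernel y psi (f : gborel X -> R[i]) : half_kernel alpha mu x y psi ->
  P0 alpha (mu x) x f y = Complex
    ((\int[mu x]_(v in (bdry X : set (gborel X))) (psi v * complex.Re (f v))) /
      \int[mu x]_(v in (bdry X : set (gborel X))) psi v)
    ((\int[mu x]_(v in (bdry X : set (gborel X))) (psi v * complex.Im (f v))) /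
      \int[mu x]_(v in (bdry X : set (gborel X))) psi v).
Proof.
move=> [_ _ psiE].
have aeE (F H : gborel X -> R) : (forall v, psi v = poisson x y v `^ (alpha / 2) -> F v = H v) ->
    (\int[mu x]_(v in (bdry X : set (gborel X))) F v =
      \int[mu x]_(v in (bdry X : set (gborel X))) H v).
  move=> FH; rewrite /Rintegral; congr fine; apply: ae_eq_integral_nonmeasurable.
  by apply: negligibleS psiE => v /= hv h; apply: hv => bv; rewrite FH// h.
rewrite /P0 /cintegral -(aeE psi (fun v => poisson x y v `^ (alpha / 2)))//.
pose z (v : gborel X) := real_complex R (poisson x y v `^ (alpha / 2)) * f v.
rewrite -(aeE (fun v => psi v * complex.Re (f v)) (fun v => complex.Re (z v))); last first.
  by move=> v ->; rewrite /z; case: (f v) => a b /=; rewrite mul0r subr0.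
rewrite -(aeE (fun v => psi v * complex.Im (f v)) (fun v => complex.Im (z v))); last first.
  by move=> v ->; rewrite /z; case: (f v) => a b /=; rewrite mul0r addr0.
move: (Rintegral _ _ psi) (Rintegral _ _ _) (Rintegral _ _ _) => I A B.
rewrite -fmorphV; apply/eqP; rewrite eq_complex /=.
by rewrite !mulr0 subr0 add0r !eqxx.
Qed.

End PoissonTransform.

Theorem corollary1p6 (R : realType) (X : pointedMetricType R)
  (hproper : proper_space X) (hcat : cat_minus1 X)
  (G : set (X -> X)) (o : X)
  (hG : isometry_group G) (hdiscrete : discrete_group G)
  (hnonel : nonelementary G o) (hcc : convex_cocompact G o)
  (alpha : R) (halpha : critical_exponent G o = alpha%:E)
  (mu : X -> {finite_measure set (gborel X) -> \bar R})
  (hmu : conformal_density G alpha mu)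
  (x : X) (w : X -> gboundary X) (c : R) (hc : 0 < c)
  (hw : forall y, geodesic_hull (limit_set G o) y ->
    ((mdist x y - c)%:E <= gprod x (Pt y) (Bd (w y)))%E)
  (f : gborel X -> R[i]) (hf : cintegrable (mu x) (bdry X) f) :
  {ae mu x, forall v, bdry X v ->
    weak_nontangential_limit (limit_set G o) alpha x w
      (P0 alpha (mu x) x f) (f v) v}.
Proof.
have h4 : four_point_condition X := four_point hcat.
have al0 := critical_exponent_gt0 hproper hcat hG hnonel hcc halpha.
have hfin := locally_finite hproper hG hdiscrete x.
have hdiv := critical_divergence hproper hcat hG hdiscrete hnonel hcc halpha x.
have [D [D0 hD hull]] := quasi_convex_orbit_ex hproper hcat x hG hnonel hcc.
(* When the boundary is null the claim is empty; otherwise the shadow lemma applies. *)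
have [mu0|mu0] := eqVneq (mu x (bdry X)) 0%E.
  exists (bdry X); split => //; first exact: measurable_bdry.
  by move=> v /= h; apply: contrapT => nb; apply: h.
have [iRe iIm] := hf.
have cvgRe := half_kernel_cvg h4 hmu al0 hG D0 hD hfin hdiv (ltW hc) mu0 iRe.
have cvgIm := half_kernel_cvg h4 hmu al0 hG D0 hD hfin hdiv (ltW hc) mu0 iIm.
have off := mu_off_limit h4 hmu al0 hG D0 hD hfin hdiv.
apply: negligibleS (negligibleU (negligibleU cvgRe cvgIm) off) => v /= hv.
apply: contrapT => /not_orP[/not_orP[/contrapT vRe /contrapT vIm] ov]; apply: hv => bv.
have [V _ eV] := bv; subst v.
have lV : lims G x V.
  by apply: contrapT => lV; apply: ov; split => // -[W lW [WV]]; apply: lV; rewrite -WV.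
split; first by apply/(limit_setP hcat o x hG).
move=> C C0 e e0.
(* In [R[i]] the order makes every positive e real. *)
have [r r0 ->] : exists2 r : R, 0 < r & e = real_complex R r.
  case: e e0 => a b; rewrite ltcE /= => /andP[/eqP-> a0]; by exists a.
have r30 : 0 < r / 3 by lra.
have [d1 hd1] := vRe bv C _ C0 r30; have [d2 hd2] := vIm bv C _ C0 r30.
(* Closeness of y to V means a large product (y | V)_x, which forces d(x, y) past both
   thresholds. *)
apply: filterS (nbhs_gprod h4 x V (Num.max d1 d2)) => p hp y py [hy hvis].
have [g0 Gg0 yg0] := hull y hy.
move: hp; rewrite py /= -gpb_ge// ge_max => /andP[yd1 yd2].
have yV := gpb_le x y V.
have yw : mdist x y - c <= gpb x y (w y) by rewrite gpb_ge//; exact: hw.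
have [psi hpsi] : exists psi, half_kernel alpha mu x y psi by exact: half_kernel_ex hmu al0 y.
rewrite (P0_half_kernel f hpsi); apply: norm_complex_lt => //.
- exact: hd1 Gg0 yg0 (le_trans yd1 yV) yw hpsi hvis.
- exact: hd2 Gg0 yg0 (le_trans yd2 yV) yw hpsi hvis.
Qed.
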